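(* Let $T$ be a POL of a massive scalar boson of mass $m=1$ (represented by $W=W^{m,0,+}$), extended Poincar\'e covariantly to all regions in $\mathfrak{S}$. Suppose that its kernel $t$ is conserved covariant. Then $T$ is causal, i.e. $T(\Delta)\le T(\Delta_\sigma)$ for every region $\Delta\in\mathfrak{S}$ and every spacelike hyperplane $\sigma$.
   Context: Minkowski space is $\mathbb{R}^4$ with $\mathfrak{a}\cdot\mathfrak{a}'=a_0a_0'-a_1a_1'-a_2a_2'-a_3a_3'$. $\tilde{\mathcal P}=ISL(2,\mathbb{C})$ acts on $\mathbb{R}^4$ by $(\mathfrak{a},A)\cdot\mathfrak{x}=\mathfrak{a}+\Lambda(A)\mathfrak{x}$, with $\Lambda:SL(2,\mathbb{C})\to O(1,3)_0$ the universal covering homomorphism onto the proper orthochronous Lorentz group; $\tilde{\mathcal E}=ISU(2)$ is the subgroup covering the Euclidean group, acting on $\mathbb{R}^3\equiv\{0\}\times\mathbb{R}^3$. Put $\epsilon(p)=\sqrt{1+|p|^2}$, $\mathfrak{p}=(\epsilon(p),p)$ for $p\in\mathbb{R}^3$, and for $L\in O(1,3)_0$ let $L\cdot p$ be the spatial part of $L\mathfrak{p}$. The scalar boson of mass $1$ is described by the unitary representation on $L^2(\mathbb{R}^3)$ $$(W(\mathfrak{a},A)\phi)(p)=\sqrt{\epsilon(q)/\epsilon(p)}\;e^{i\mathfrak{a}\cdot\mathfrak{p}}\phi(q),\qquad q:=\Lambda(A)^{-1}\cdot p .$$ A POL of the boson is a normalized positive operator valued measure $T$ on the Borel sets of $\mathbb{R}^3$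 with values in operators on $L^2(\mathbb{R}^3)$, $T(\mathbb{R}^3)=I$, with $W(g)T(\Delta)W(g)^{-1}=T(g\cdot\Delta)$ for all $g\in\tilde{\mathcal E}$; $T$ vanishes on Lebesgue null sets and is extended to Lebesgue measurable sets. A region is a Lebesgue measurable subset of a spacelike hyperplane of $\mathbb{R}^4$; $\mathfrak{S}$ is the set of regions. $T$ extends uniquely to a map on $\mathfrak{S}$ with $W(g)T(\Delta)W(g)^{-1}=T(g\cdot\Delta)$ for all $g\in\tilde{\mathcal P}$, $\Delta\in\mathfrak{S}$. For $\Delta\in\mathfrak{S}$ and a spacelike hyperplane $\sigma$, the region of influence is $$\Delta_\sigma=\{\mathfrak{x}\in\sigma:\exists\,\mathfrak{z}\in\Delta,\ (\mathfrak{x}-\mathfrak{z})\cdot(\mathfrak{x}-\mathfrak{z})\ge0\}.$$ The kernel of $T$ is the measurable, positive definite, rotation invariant kernel $t$ on $\mathbb{R}^3\setminus\{0\}$ with $t(p,p)=1$ for all $p$ such that for all $\phi\in L^1(\mathbb{R}^3)\cap L^2(\mathbb{R}^3)$ and measurable $\Delta\subset\mathbb{R}^3$ $$\langle\phi,T(\Delta)\phi\rangle=(2\pi)^{-3}\int_\Delta\int\int t(k,p)e^{i(p-k)x}\overline{\phi(k)}\phi(p)\,d^3k\,d^3p\,d^3x .$$ The kernel $t$ is called conserved covariant if there is $\mathfrak{v}=(v_0,v_1,v_2,v_3):(\mathbb{R}^3\setminus\{0\})^2\to\mathbb{C}^4$ with $v_0(k,p)=\sqrt{\epsilon(k)\epsilon(p)}\,t(k,p)$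 that is conserved, $(\mathfrak{k}-\mathfrak{p})\cdot\mathfrak{v}(k,p)=0$ (Minkowski product), and covariant, $L\,\mathfrak{v}(k,p)=\mathfrak{v}(L\cdot k,L\cdot p)$, for all $k,p\ne0$ and $L\in O(1,3)_0$ with $L\cdot k,L\cdot p\ne0$. *)

(* Defs.v *)
From HB Require Import structures.
From mathcomp Require Import all_boot all_order all_algebra.
From mathcomp Require Import complex.
From mathcomp Require Import all_classical all_reals all_analysis.
From mathcomp Require Import measurable_realfun.

Set Implicit Arguments.
Unset Strict Implicit.
Unset Printing Implicit Defensive.

Import Order.TTheory GRing.Theory Num.Theory.
Import numFieldNormedType.Exports.

Local Open Scope classical_set_scope.
Local Open Scope ring_scope.
Local Open Scope complex_scope.

Notation R3 R := (measurableTypeR R * measurableTypeR R * measurableTypeR R)%type.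

Section minkowski.
Context (R : realType).
Local Notation C := R[i].
Local Notation R3 := (R3 R).
Local Notation R4 := 'cV[R]_4.

Definition mu3 : {measure set R3 -> \bar R} :=
  ((@lebesgue_measure R \x @lebesgue_measure R) \x @lebesgue_measure R)%E.

Definition dot3 (x y : R3) : R := x.1.1 * y.1.1 + x.1.2 * y.1.2 + x.2 * y.2.

Definition mink (K : comNzRingType) (a b : 'cV[K]_4) : K :=
  a 0 0 * b 0 0 - a 1 0 * b 1 0 - a 2 0 * b 2 0 - a 3 0 * b 3 0.

Definition four (t : R) (x : R3) : R4 :=
  \col_(i < 4) nth 0 [:: t; x.1.1; x.1.2; x.2] i.

Definition spatial (a : R4) : R3 := (a 1 0, a 2 0, a 3 0).

Definition eps (p : R3) : R := Num.sqrt (1 + dot3 p p).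

Definition onshell (p : R3) : R4 := four (eps p) p.

Definition lact (L : 'M[R]_4) (p : R3) : R3 := spatial (L *m onshell p).

(* The identity component O(1,3)_0 of the Lorentz group. *)
Definition proper_orthochronous (L : 'M[R]_4) : Prop :=
  [/\ forall a b : R4, mink (L *m a) (L *m b) = mink a b,
      \det L = 1 & 0 < L 0 0].

Definition mx2 (a b c d : C) : 'M[C]_2 :=
  \matrix_(i < 2, j < 2) nth 0 (nth [::] [:: [:: a; b]; [:: c; d]] i) j.

Definition pauli (i : 'I_4) : 'M[C]_2 :=
  nth 0 [:: 1%:M; mx2 0 1 1 0; mx2 0 (- 'i) 'i 0; mx2 1 0 0 (-1)] i.

Definition adjointmx (A : 'M[C]_2) : 'M[C]_2 := (map_mx (@conjc R) A)^T.

(* SL(2,C) acts on Hermitian matrices X = \sum_j x_j pauli_j by X |-> A X A^*;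
   the coordinates of X are x_i = tr(pauli_i X) / 2, which are real. *)
Definition Lambda (A : 'M[C]_2) : 'M[R]_4 :=
  \matrix_(i < 4, j < 4)
    (complex.Re (\tr (pauli i *m A *m pauli j *m adjointmx A)) / 2).

Definition SL2C (A : 'M[C]_2) : Prop := \det A = 1.

Definition SU2 (A : 'M[C]_2) : Prop := SL2C A /\ A *m adjointmx A = 1%:M.

Definition poincare (a : R4) (A : 'M[C]_2) (x : R4) : R4 := a + Lambda A *m x.

Definition euclidean (b : R3) (B : 'M[C]_2) (x : R3) : R3 :=
  spatial (poincare (four 0 b) B (four 0 x)).

Definition spacelike_hyperplane (s : set R4) : Prop :=
  (exists (n : R4) (tau : R), n != 0 /\ s = [set x | mink n x = tau]) /\
  (forall x y, s x -> s y -> x != y -> mink (x - y) (x - y) < 0).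

Definition lebesgue_measurable3 (D : set R3) : Prop :=
  completed_algebra_gen mu3 D.

(* The spatial projection restricts to an affine isomorphism of every
   spacelike hyperplane onto R^3, hence transports Lebesgue measurability. *)
Definition region (D : set R4) : Prop :=
  exists s, [/\ spacelike_hyperplane s, D `<=` s
              & lebesgue_measurable3 (spatial @` D)].

Definition region_of_influence (D s : set R4) : set R4 :=
  [set x | s x /\ exists2 z, D z & 0 <= mink (x - z) (x - z)].

End minkowski.

Section hilbert.
Context (R : realType).
Local Notation C := R[i].
Local Notation R3 := (R3 R).

Definition cintegral d (X : measurableType d) (mu : {measure set X -> \bar R})
    (D : set X) (f : X -> C) : C :=
  (\int[mu]_(x in D) complex.Re (f x)) +i* (\int[mu]_(x in D) complex.Im (f x)).

(* Representatives of the complex space L^p(R^3). *)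
Definition LC (p : \bar R) (f : R3 -> C) : Prop :=
  @complex.Re R \o f \in Lfun (mu3 R) p /\ @complex.Im R \o f \in Lfun (mu3 R) p.

Definition inner (f g : R3 -> C) : C :=
  cintegral (mu3 R) setT (fun p => (f p)^*%C * g p).

(* Bounded operators on L^2(R^3) are given on representatives; the second
   clause makes them well defined on classes of a.e. equal functions, and
   [op_eq] is their equality. *)
Definition bounded_operator (A : (R3 -> C) -> (R3 -> C)) : Prop :=
  [/\ forall f, LC 2%:E f -> LC 2%:E (A f),
      forall f g, LC 2%:E f -> LC 2%:E g -> f = g %[ae mu3 R] ->
        A f = A g %[ae mu3 R],
      forall (c : C) f g, LC 2%:E f -> LC 2%:E g ->
        A (fun p => c * f p + g p) = (fun p => c * A f p + A g p) %[ae mu3 R]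
    & exists K : R, forall f, LC 2%:E f ->
        complex.Re (inner (A f) (A f)) <= K * complex.Re (inner f f)].

Record L2op := MkL2op {
  L2op_fun :> (R3 -> C) -> (R3 -> C);
  L2opP : bounded_operator L2op_fun }.

Definition op_eq (A B : (R3 -> C) -> (R3 -> C)) : Prop :=
  forall f, LC 2%:E f -> A f = B f %[ae mu3 R].

(* The order of R[i] relates only numbers with the same imaginary part, so
   [0 <= z] means that z is real and nonnegative. *)
Definition op_pos (A : (R3 -> C) -> (R3 -> C)) : Prop :=
  forall f, LC 2%:E f -> 0 <= inner f (A f).

Definition op_le (A B : (R3 -> C) -> (R3 -> C)) : Prop :=
  forall f, LC 2%:E f -> inner f (A f) <= inner f (B f).

End hilbert.

Section localization.
Context (R : realType).
Local Notation C := R[i].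
Local Notation R3 := (R3 R).
Local Notation R4 := 'cV[R]_4.

Definition cis (x : R) : C := cos x +i* sin x.

Definition W (a : R4) (A : 'M[C]_2) (phi : R3 -> C) : R3 -> C := fun p =>
  let q := lact (invmx (Lambda A)) p in
  (Num.sqrt (eps q / eps p))%:C * cis (mink a (onshell p)) * phi q.

(* W(g)^-1 = W(g^-1) with (a, A)^-1 = (- Lambda(A^-1) a, A^-1) *)
Definition Winv (a : R4) (A : 'M[C]_2) : (R3 -> C) -> (R3 -> C) :=
  W (- (Lambda (invmx A) *m a)) (invmx A).

Definition is_POVM (T : set R3 -> L2op R) : Prop :=
  [/\ forall D : set R3, measurable D -> op_pos (T D),
      op_eq (T setT) id
    & forall f, LC 2%:E f ->
        semi_sigma_additive
          (fun D : set R3 => (complex.Re (inner f (T D f)))%:E)].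

Definition is_POL (T : set R3 -> L2op R) : Prop :=
  is_POVM T /\
  forall (b : R3) (B : 'M[C]_2) (D : set R3), SU2 B -> measurable D ->
    op_eq (W (four 0 b) B \o T D \o Winv (four 0 b) B)
          (T (euclidean b B @` D)).

(* Tx extends T, first to the Lebesgue measurable subsets A `|` N of R^3 (with
   A Borel and N Lebesgue null), identified with subsets of {0} x R^3, then
   covariantly to all regions; it is unconstrained on sets that are not
   regions. The first clause forces T to vanish on Lebesgue null sets. *)
Definition is_covariant_extension
    (T : set R3 -> L2op R) (Tx : set R4 -> L2op R) : Prop :=
  (forall A N : set R3, measurable A -> (mu3 R).-negligible N ->
     op_eq (Tx (four 0 @` (A `|` N))) (T A)) /\
  (forall (a : R4) (A : 'M[C]_2) (D : set R4), SL2C A -> region D ->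
     op_eq (W a A \o Tx D \o Winv a A) (Tx (poincare a A @` D))).

Definition causal (Tx : set R4 -> L2op R) : Prop :=
  forall D s : set R4, region D -> spacelike_hyperplane s ->
    op_le (Tx D) (Tx (region_of_influence D s)).

Definition positive_definite (t : R3 -> R3 -> C) : Prop :=
  forall (n : nat) (c : 'I_n -> C) (p : 'I_n -> R3), (forall i, p i != 0) ->
    0 <= \sum_(i < n) \sum_(j < n) (c i)^*%C * c j * t (p i) (p j).

Definition rotation_invariant (t : R3 -> R3 -> C) : Prop :=
  forall (B : 'M[C]_2) (k p : R3), SU2 B -> k != 0 -> p != 0 ->
    t (euclidean 0 B k) (euclidean 0 B p) = t k p.

(* A kernel on R^3 \ {0}; its values at k = 0 or p = 0 are irrelevant. *)
Definition kernel_measurable (t : R3 -> R3 -> C) : Prop :=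
  let D := [set kp : R3 * R3 | kp.1 != 0 /\ kp.2 != 0] in
  measurable_fun D (fun kp => complex.Re (t kp.1 kp.2)) /\
  measurable_fun D (fun kp => complex.Im (t kp.1 kp.2)).

Definition is_kernel (T : set R3 -> L2op R) (t : R3 -> R3 -> C) : Prop :=
  [/\ kernel_measurable t, positive_definite t, rotation_invariant t,
      forall p : R3, p != 0 -> t p p = 1
    & forall (phi : R3 -> C) (D : set R3), LC 1%:E phi -> LC 2%:E phi ->
        measurable D ->
        inner phi (T D phi) =
          (((2 * pi) ^- 3)%:C *
          cintegral (mu3 R) D (fun x : R3 =>
            cintegral (mu3 R) setT (fun p : R3 =>
              cintegral (mu3 R) setT (fun k : R3 =>
                t k p * cis (dot3 (p - k) x) * (phi k)^*%C * phi p))))].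

Definition toC n m (L : 'M[R]_(n, m)) : 'M[C]_(n, m) :=
  map_mx (real_complex R) L.

Definition conserved_covariant (t : R3 -> R3 -> C) : Prop :=
  exists v : R3 -> R3 -> 'cV[C]_4,
    [/\ forall k p : R3, k != 0 -> p != 0 ->
          v k p 0 0 = (Num.sqrt (eps k * eps p))%:C * t k p,
        forall k p : R3, k != 0 -> p != 0 ->
          mink (toC (onshell k - onshell p)) (v k p) = 0
      & forall (L : 'M[R]_4) (k p : R3), proper_orthochronous L ->
          k != 0 -> p != 0 -> lact L k != 0 -> lact L p != 0 ->
          toC L *m v k p = v (lact L k) (lact L p)].

End localization.

(* Main.v *)
From HB Require Import structures.
Require Import Defs.
From mathcomp Require Import all_boot all_order all_algebra.
From mathcomp Require Import complex.
From mathcomp Require Import all_classical all_reals all_analysis.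
From mathcomp Require Import measurable_realfun.
From mathcomp Require Import ring lra.

Set Implicit Arguments.
Unset Strict Implicit.
Unset Printing Implicit Defensive.

Import Order.TTheory GRing.Theory Num.Theory.
Import numFieldNormedType.Exports.

Local Open Scope classical_set_scope.
Local Open Scope ring_scope.
Local Open Scope complex_scope.

(** Write psi = sqrt(eps) phi. The kernel of the current v gives, for every
    compactly supported bounded phi, a real vector field J on Minkowski space,
    the superposition of the plane waves
      V(k,p) e^(i (k - p) . x) (phi k)^* phi p,  V = v / sqrt(eps(k) eps(p)).
    Covariance of v makes J a Poincare covariant field, conservation makes each
    plane wave divergence free, and <phi, T(D) phi> is the flux of J through D,
    for D in any spacelike hyperplane. Positivity of T at time zero yields
    J_0 >= 0, hence n . J >= 0 for all future timelike n by covariance.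

    Causality is the divergence theorem in the wedge between the hyperplane of D
    and {x_0 = 0}, applied to w J, where w is a smooth weight which is a sum of
    functions supported in the past (above the wedge: future) cones of rational
    points influenced by D and which saturates to the indicator function of the
    union of these cones: since J is causal, w J has divergence of one sign.
    Translating D by a small time puts it inside this open union, and strong
    continuity of the time translations removes the translation afterwards. *)

(** The current [v] comes with no regularity: only its time component is measurable, through the
    kernel, and covariance holds only away from momentum 0. The analysis therefore rests on a
    measurable [V] rebuilt from that component by covariance, with the required properties outside a
    null set of momenta. The field is never differentiated: the divergence theorem is applied to the
    weight times one plane wave, for almost every pair of momenta, and the outcome is integrated
    over the momenta by Fubini. Covariance is used one explicit generator at a time (rotations about
    two axes, boosts along one, translations); induction principles bring vectors, hyperplanes and
    regions to standard position, which leaves graphs over x_0 = 0 tilted along the third axis. The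
    cones of the weights are open, the region of influence uses closed ones, and the region need not
    be Borel; disjoint translates show that the difference is null. As [Tx] is unconstrained off
    regions, the region of influence must be shown to be a region, and as the order of [R[i]]
    compares only equal imaginary parts, the forms must be shown to be real. *)

Section product_sigma_finite.
Context d1 d2 (T1 : measurableType d1) (T2 : measurableType d2) (R : realType).
Variables (m1 : {sigma_finite_measure set T1 -> \bar R}).
Variables (m2 : {sigma_finite_measure set T2 -> \bar R}).
Local Open Scope ereal_scope.

Lemma product_measure_sigma_finite : sigma_finite setT (m1 \x m2).
Proof.
have /sigma_finiteP[F [TF ndF Foo]] := sigma_finiteT m1.
have /sigma_finiteP[G [TG ndG Goo]] := sigma_finiteT m2.
exists (fun n => F n `*` G n).
  rewrite -setXTT TF TG predeqE => -[x y]; split.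
    move=> [/= [n _ Fnx] [k _ Gky]]; exists (maxn n k) => //; split.
    - by move: x Fnx; exact/subsetPset/ndF/leq_maxl.
    - by move: y Gky; exact/subsetPset/ndG/leq_maxr.
  by move=> [n _ []/= ? ?]; split; exists n.
move=> k; have [? ?] := Foo k; have [? ?] := Goo k.
split; first exact: measurableX.
by rewrite product_measure1E// lte_mul_pinfty// ge0_fin_numE.
Qed.

(* The canonical sigma-finite structure on [m1 \x m2] requires finite measures. *)
Definition sigma_finite_product : {sigma_finite_measure set (T1 * T2)%type -> \bar R} :=
  HB.pack (product_measure1 m1 m2)
    (Measure_isSigmaFinite.Build _ _ _ (product_measure1 m1 m2)
       product_measure_sigma_finite).

End product_sigma_finite.

(** * Change of variables: measures with a density, and maps of the line *)

Section density_measure.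
Context d (T : measurableType d) (R : realType) (mu : {measure set T -> \bar R}).
Local Open Scope ereal_scope.

Import HBNNSimple.

Lemma ge0_integral_density (g : T -> R) (f : T -> \bar R) :
  measurable_fun setT g -> (forall x, 0 <= g x)%R ->
  measurable_fun setT f -> (forall x, 0 <= f x) ->
  exists2 nu : {measure set T -> \bar R},
    (forall A, nu A = \int[mu]_(x in A) (g x)%:E) &
    \int[nu]_x f x = \int[mu]_x (f x * (g x)%:E).
Proof.
move=> mg g0 mf f0.
pose m A := \int[mu]_(x in A) (g x)%:E.
have g0' x : 0 <= (g x)%:E by rewrite lee_fin.
have mg' : measurable_fun setT (EFin \o g) by exact/measurable_EFinP.
have m0 : m set0 = 0 by exact: integral_set0.
have m_ge0 A : 0 <= m A by exact: integral_ge0.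
have m_sigma : semi_sigma_additive m by exact: semi_sigma_additive_nng_induced.
pose mmix := isMeasure.Build _ _ _ m m0 m_ge0 m_sigma.
pose nu : {measure set T -> \bar R} := HB.pack m mmix.
exists nu => //.
pose f_ := nnsfun_approx measurableT mf.
transitivity (limn (fun n => \int[nu]_x (f_ n x)%:E)).
  rewrite -monotone_convergence//.
  - apply: eq_integral => y _; apply/esym/cvg_lim => //.
    exact: cvg_nnsfun_approx.
  - by move=> n; exact/measurable_EFinP/measurable_funP.
  - by move=> n y _; rewrite lee_fin.
  - by move=> y _ a b ab; rewrite lee_fin; exact/lefP/nd_nnsfun_approx.
rewrite [X in limn X](_ : _ =
    (fun n => \int[mu]_x ((f_ n x)%:E * (g x)%:E))); last first.
  apply/funext => n.
  transitivity (\sum_(k \in range (f_ n))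
      \int[nu]_x (k * \1_(f_ n @^-1` [set k]) x)%:E).
    under eq_integral do rewrite fimfunE -fsumEFin//.
    rewrite ge0_integral_fsum//; last by move=> y x _; rewrite nnfun_muleindic_ge0.
    by move=> y; exact/measurable_EFinP/measurable_funM.
  transitivity (\sum_(k \in range (f_ n))
      \int[mu]_x ((k * \1_(f_ n @^-1` [set k]) x)%:E * (g x)%:E)).
    apply: eq_fsbigr => r /[!inE] -[y _ yr].
    rewrite integralZl_indic_nnsfun// integral_indic// setIT.
    have r0 : (0 <= r)%R by rewrite -yr.
    under eq_integral do rewrite EFinM -muleA.
    rewrite ge0_integralZl//; last 2 first.
    - apply: emeasurable_funM => //; exact/measurable_EFinP/measurable_indic.
    - by move=> x _; rewrite mule_ge0// lee_fin.
    congr (_ * _); rewrite /nu/= /m integral_mkcond; apply: eq_integral => x _.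
    by rewrite patchE indicE; case: ifPn => _; rewrite ?mul1e ?mul0e.
  rewrite -ge0_integral_fsum//; last 2 first.
  - move=> y; apply: emeasurable_funM => //.
    exact/measurable_EFinP/measurable_funM.
  - by move=> y x _; rewrite mule_ge0// nnfun_muleindic_ge0.
  apply: eq_integral => x _; rewrite [in RHS]fimfunE -fsumEFin//.
  by rewrite ge0_mule_fsuml// => r; rewrite nnfun_muleindic_ge0.
rewrite -monotone_convergence//.
- apply: eq_integral => y _; apply/cvg_lim => //.
  by apply: cvgeZr => //; exact: cvg_nnsfun_approx.
- move=> n; apply: emeasurable_funM => //.
  exact/measurable_EFinP/measurable_funP.
- by move=> n y _; rewrite mule_ge0// lee_fin.
- move=> y _ a b ab; rewrite lee_wpmul2r// lee_fin; exact/lefP/nd_nnsfun_approx.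
Qed.

End density_measure.

Section preserves1.
Context {R : realType}.
Local Notation mu := (@lebesgue_measure R).

(** The change of variables formula with Jacobian [J], stated for nonnegative functions so that it
    passes through Tonelli without any integrability. *)
Definition preserves1 (F J : R -> R) : Prop :=
  forall f : R -> \bar R, measurable_fun setT f -> (forall x, 0 <= f x)%E ->
    (\int[mu]_x (f (F x) * (J x)%:E) = \int[mu]_x f x)%E.

(** The pushforward under [F] of the measure with density [J] gives []a, b]] the mass F (G b) - F (G
    a) = b - a by the fundamental theorem of calculus, and Lebesgue measure is determined by its
    values on such intervals. *)
Lemma preserves1_diffeo (F J G : R -> R) :
  (forall x, is_derive x (1 : R) F (J x)) -> continuous J -> (forall x, 0 < J x) ->
  cancel G F -> preserves1 F J.
Proof.
move=> dF cJ J0 GK f mf f0.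
have F_lt : {homo F : x y / x < y}.
  move=> x y xy.
  have [z _ FE] : exists2 z, z \in `]x, y[%R & F y - F x = J z * (y - x).
    apply: MVT => //; apply: derivable_within_continuous => z _.
    exact: ex_derive.
  by rewrite -subr_gt0 FE mulr_gt0// subr_gt0.
have F_mono : {mono F : x y / x <= y} by exact: le_mono.
have cF : continuous F.
  move=> x; apply: differentiable_continuous.
  exact/derivable1_diffP/ex_derive.
have mF : measurable_fun setT F by exact: continuous_measurable_fun.
have mJ : measurable_fun setT J by exact: continuous_measurable_fun.
have [nu nuE <-] := @ge0_integral_density _ _ R mu J (f \o F) mJ
  (fun x => ltW (J0 x)) (measurableT_comp mf mF) (fun x => f0 (F x)).
rewrite -(@ge0_integral_pushforward _ _ (measurableTypeR R) (measurableTypeR R) R F mF nu setT f)//.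
apply: eq_measure_integral => A mA _; apply/esym.
have mF' : measurable_fun setT (F : measurableTypeR R -> measurableTypeR R) by [].
have U := @lebesgue_measure_unique R (measure_function_pushforward__canonical__measure_function_Measure nu mF').


refine (U _ A mA) => _ [[a b]/= ab <-].
rewrite /pushforward nuE.
have -> : F @^-1` `]a, b] = `]G a, G b]%classic.
  apply/seteqP; split => x /=;
  by rewrite !in_itv/= -(F_mono x) -(leW_mono F_mono _ x) !GK.
rewrite (lebesgue_measure_itv (Interval _ _))/= lte_fin.
case: ifPn => [lab|]; last first.
  rewrite -leNgt => ba; rewrite set_itv_ge ?integral_set0//.
  by rewrite bnd_simp -leNgt -F_mono !GK.
have GaGb : G a < G b by rewrite -(leW_mono F_mono) !GK.
rewrite integral_itv_obnd_cbnd; last first.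
  by apply: measurable_funTS; exact/measurable_EFinP.
rewrite (@continuous_FTC2 _ J F)// ?GK//.
- exact: continuous_subspaceT.
- split => [x _|//|//]; first exact: ex_derive.
    by apply: cvg_at_right_filter; exact: cF.
  by apply: cvg_at_left_filter; exact: cF.
- by move=> x _; rewrite derive1E; exact: derive_val.
Qed.

End preserves1.

Section weighted_integral_comp.
Context d (X : measurableType d) (R : realType) (mu : {measure set X -> \bar R}).
Variables (T : X -> X) (J : X -> R).
Hypothesis J_gt0 : forall x, 0 < J x.
Local Open Scope ereal_scope.
Hypothesis ge0_TJ : forall f : X -> \bar R, measurable_fun setT f ->
  (forall x, 0 <= f x) -> \int[mu]_x (f (T x) * (J x)%:E) = \int[mu]_x f x.

Lemma weighted_integral_comp (f : X -> \bar R) : measurable_fun setT f ->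
  \int[mu]_x (f (T x) * (J x)%:E) = \int[mu]_x f x.
Proof.
move=> mf; rewrite integralE [RHS]integralE; congr (_ - _).
- rewrite -(ge0_TJ (f := f^\+))//; last exact: measurable_funepos.
  apply: eq_integral => x _; rewrite !funeposE muleC -[in LHS](mule0 (J x)%:E).
  by rewrite -maxe_pMr// 1?muleC// lee_fin ltW.
- rewrite -(ge0_TJ (f := f^\-))//; last exact: measurable_funeneg.
  apply: eq_integral => x _; rewrite !funenegE muleC -muleN -[in LHS](mule0 (J x)%:E).
  by rewrite -maxe_pMr// 1?muleC// lee_fin ltW.
Qed.

End weighted_integral_comp.

(** * Change of variables in three dimensions: shears, rotations, translations, null sets *)

Section preserves3.
Context {R : realType}.
Local Notation R3 := (R3 R).
Local Notation mu := (@lebesgue_measure R).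
Local Notation mu3 := (mu3 R).

Definition sigma_finite_mu2 : {sigma_finite_measure set _ -> \bar R} :=
  sigma_finite_product mu mu.

Definition sigma_finite_mu3 : {sigma_finite_measure set R3 -> \bar R} :=
  sigma_finite_product sigma_finite_mu2 mu.

Local Notation mu2 := sigma_finite_mu2.

Lemma ge0_integral_mu3 (f : R3 -> \bar R) :
  measurable_fun setT f -> (forall x, 0 <= f x)%E ->
  (\int[mu3]_x f x = \int[mu2]_u \int[mu]_y f (u, y))%E.
Proof. exact: (@fubini_tonelli1 _ _ _ _ R mu2 mu f). Qed.

Definition preserves (T : R3 -> R3) (J : R3 -> R) : Prop :=
  [/\ measurable_fun setT T, measurable_fun setT J, forall x, 0 < J x
    & forall f : R3 -> \bar R, measurable_fun setT f -> (forall x, 0 <= f x)%E ->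
      (\int[mu3]_x (f (T x) * (J x)%:E) = \int[mu3]_x f x)%E].

Lemma preserves_comp T1 J1 T2 J2 : preserves T1 J1 -> preserves T2 J2 ->
  preserves (T1 \o T2) (fun x => J1 (T2 x) * J2 x).
Proof.
move=> [mT1 mJ1 J1_gt0 P1] [mT2 mJ2 J2_gt0 P2]; split => //.
- exact: measurableT_comp.
- by apply: measurable_funM => //; exact: measurableT_comp.
- by move=> x; rewrite mulr_gt0.
move=> f mf f0 /=.
under eq_integral do rewrite EFinM muleA.
rewrite (P2 (fun x => f (T1 x) * (J1 x)%:E)%E)//; first exact: P1.
- apply: emeasurable_funM; last exact/measurable_EFinP.
  exact: measurableT_comp.
- by move=> x; rewrite mule_ge0// lee_fin ltW.
Qed.

Lemma eq_preserves T1 J1 T2 J2 : T1 =1 T2 -> J1 =1 J2 ->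
  preserves T1 J1 -> preserves T2 J2.
Proof. by move=> /funext -> /funext ->. Qed.

Lemma preserves_integral T J (f : R3 -> \bar R) : preserves T J ->
  measurable_fun setT f ->
  (\int[mu3]_x (f (T x) * (J x)%:E) = \int[mu3]_x f x)%E.
Proof.
by move=> [mT mJ J_gt0 P]; exact: weighted_integral_comp.
Qed.

(** Only the innermost integral of Tonelli is affected, so the one-dimensional formula on each fibre
    suffices. Linear maps and boosts are all built from such maps and coordinate swaps. *)
Lemma preserves_coord3 (F J : R3 -> R) :
  measurable_fun setT F -> measurable_fun setT J -> (forall x, 0 < J x) ->
  (forall u, preserves1 (fun y => F (u, y)) (fun y => J (u, y))) ->
  preserves (fun x => (x.1, F x)) J.
Proof.
move=> mF mJ J_gt0 P; split => //.
  by apply: measurable_fun_pair => //; exact: measurable_fst.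
move=> f mf f0.
have mTJ : measurable_fun setT (fun x : R3 => (f (x.1, F x) * (J x)%:E)%E).
  apply: emeasurable_funM; last exact/measurable_EFinP.
  apply: (measurableT_comp mf).
  by apply: measurable_fun_pair => //; exact: measurable_fst.
have TJ0 (x : R3) : (0 <= f (x.1, F x) * (J x)%:E)%E.
  by rewrite mule_ge0// lee_fin ltW.
rewrite (ge0_integral_mu3 mTJ TJ0) (ge0_integral_mu3 mf f0).
apply: eq_integral => u _; apply: (P u (fun y => f (u, y))) => //.
exact: measurable_fun_pair2.
Qed.

Definition swap12 (x : R3) : R3 := (x.1.2, x.1.1, x.2).
Definition swap13 (x : R3) : R3 := (x.2, x.1.2, x.1.1).

Lemma measurable_coord1 : measurable_fun setT (fun x : R3 => x.1.1 : R).
Proof. by apply: measurableT_comp; [exact: measurable_fst|exact: measurable_fst]. Qed.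

Lemma measurable_coord2 : measurable_fun setT (fun x : R3 => x.1.2 : R).
Proof. by apply: measurableT_comp; [exact: measurable_snd|exact: measurable_fst]. Qed.

Lemma measurable_coord3 : measurable_fun setT (fun x : R3 => x.2 : R).
Proof. exact: measurable_snd. Qed.

Lemma measurable_triple d (T : measurableType d) (f g h : T -> R) :
  measurable_fun setT f -> measurable_fun setT g -> measurable_fun setT h ->
  measurable_fun setT (fun x => (f x, g x, h x) : R3).
Proof.
by move=> mf mg mh; do ?apply: measurable_fun_pair.
Qed.

Lemma preserves_swap12 : preserves swap12 (cst 1).
Proof.
have ms : measurable_fun setT swap12.
  apply: measurable_triple; [exact: measurable_coord2|exact: measurable_coord1|].
  exact: measurable_coord3.
split => //.
move=> f mf f0; under eq_integral do rewrite mule1.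
have mfs : measurable_fun setT (f \o swap12) by exact: measurableT_comp.
have fs0 x : (0 <= (f \o swap12) x)%E by exact: f0.
rewrite (ge0_integral_mu3 mfs fs0) (ge0_integral_mu3 mf f0).
pose g u := (\int[mu]_y f (u, y))%E.
have mg : measurable_fun setT g.
  exact: (@measurable_fun_fubini_tonelli_F _ _ _ _ _ mu f).
have g0 u : (0 <= g u)%E by exact: integral_ge0.
have mgs : measurable_fun setT (fun u : R * R => g (u.2, u.1)).
  exact: (measurableT_comp mg (@measurable_swap _ _ _ _)).
have gs0 (u : R * R) : (0 <= g (u.2, u.1))%E by exact: g0.
have -> := @fubini_tonelli1 _ _ _ _ R mu mu _ mg g0.
exact: (@fubini_tonelli2 _ _ _ _ R mu mu _ mgs gs0).
Qed.

Lemma preserves_swap13 : preserves swap13 (cst 1).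
Proof.
have ms : measurable_fun setT swap13.
  apply: measurable_triple; [exact: measurable_coord3|exact: measurable_coord2|].
  exact: measurable_coord1.
split => //.
move=> f mf f0; under eq_integral do rewrite mule1.
have mfs : measurable_fun setT (f \o swap13) by exact: measurableT_comp.
have fs0 x : (0 <= (f \o swap13) x)%E by exact: f0.
rewrite (ge0_integral_mu3 mfs fs0) (ge0_integral_mu3 mf f0).
have mG h : measurable_fun setT h -> (forall x : R3, 0 <= h x)%E ->
    measurable_fun setT (fun u => \int[mu]_y h (u, y))%E.
  by move=> mh h0; exact: (@measurable_fun_fubini_tonelli_F _ _ _ _ _ mu h).
have G0 (h : R3 -> \bar R) u : (forall x, 0 <= h x)%E ->
  (0 <= \int[mu]_y h (u, y))%E by move=> h0; exact: integral_ge0.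
have -> := @fubini_tonelli2 _ _ _ _ R mu mu _ (mG _ mfs fs0) (fun u => G0 _ u fs0).
have -> := @fubini_tonelli1 _ _ _ _ R mu mu _ (mG _ mf f0) (fun u => G0 _ u f0).
rewrite /fubini_G /fubini_F.
transitivity (\int[mu]_b \int[mu]_c \int[mu]_a f (c, b, a))%E.
  apply: eq_integral => b _.
  have mfb : measurable_fun setT (fun u : R * R => f (u.2, b, u.1)).
    apply: (measurableT_comp mf); apply: measurable_triple => //.
  exact: (@fubini_tonelli _ _ _ _ R mu mu _ mfb).
have mGs : measurable_fun setT (fun u : R * R => \int[mu]_a f (u.2, u.1, a))%E.
  exact: (measurableT_comp (mG _ mf f0) (@measurable_swap _ _ _ _)).
have Gs0 (u : R * R) : (0 <= \int[mu]_a f (u.2, u.1, a))%E by exact: integral_ge0.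
exact: (@fubini_tonelli _ _ _ _ R mu mu _ mGs Gs0).
Qed.

(** With a coordinate swap for [T1], this carries a result about the third coordinate to the other
    two. *)
Lemma preserves_involution T1 T2 J : preserves T1 (cst 1) -> preserves T2 J ->
  preserves (T1 \o T2 \o T1) (J \o T1).
Proof.
move=> p1 p2; have := preserves_comp (preserves_comp p1 p2) p1.
by apply: eq_preserves => x //=; rewrite mulr1 mul1r.
Qed.

Lemma preserves_affine3 (alpha l1 l2 l0 : R) : 0 < alpha ->
  preserves (fun x => (x.1, alpha * x.2 + (l1 * x.1.1 + l2 * x.1.2 + l0)))
    (cst alpha).
Proof.
move=> a0; apply: (@preserves_coord3
  (fun x => alpha * x.2 + (l1 * x.1.1 + l2 * x.1.2 + l0)) (cst alpha)) => //.
- have m1 := measurable_coord1; have m2 := measurable_coord2.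
  have m3 := measurable_coord3.
  by do ?[apply: measurable_funD|apply: measurable_funM].
- move=> u /=; set c := (l1 * _ + _ + _).
  apply: (@preserves1_diffeo _ _ _ (fun y => (y - c) / alpha)).
  + move=> x; apply: is_derive_eq; rewrite /GRing.scale/=; ring.
  + by move=> ?; exact: cvg_cst.
  + by [].
  + by move=> y; field; rewrite gt_eqF.
Qed.

Lemma preserves_affine1 (alpha l2 l3 l0 : R) : 0 < alpha ->
  preserves (fun x => (alpha * x.1.1 + (l3 * x.2 + l2 * x.1.2 + l0), x.1.2, x.2))
    (cst alpha).
Proof.
move=> a0; have := preserves_involution preserves_swap13 (preserves_affine3 l3 l2 l0 a0).
by apply: eq_preserves => -[[x1 x2] x3].
Qed.

Lemma preserves_affine2 (alpha l1 l3 l0 : R) : 0 < alpha ->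
  preserves (fun x => (x.1.1, alpha * x.1.2 + (l1 * x.1.1 + l3 * x.2 + l0), x.2))
    (cst alpha).
Proof.
move=> a0; have := preserves_involution preserves_swap12 (preserves_affine1 l1 l3 l0 a0).
by apply: eq_preserves => -[[x1 x2] x3] //=; rewrite /swap12/=; do 2 f_equal; ring.
Qed.

Lemma preserves_translation (a : R3) : preserves (fun x => x + a) (cst 1).
Proof.
have := preserves_comp (preserves_affine1 0 0 a.1.1 ltr01)
  (preserves_comp (preserves_affine2 0 0 a.1.2 ltr01) (preserves_affine3 0 0 a.2 ltr01)).
apply: eq_preserves => -[[x1 x2] x3] //=; last by rewrite !mulr1.
by rewrite !mul0r !mul1r !add0r.
Qed.

(* A rotation of a coordinate plane is a product of three shears. *)
Lemma preserves_rotation13 (c s : R) : c ^+ 2 + s ^+ 2 = 1 -> 0 < c ->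
  preserves (fun x => ((c ^+ 2 - s ^+ 2) * x.1.1 + 2 * c * s * x.2, x.1.2,
    (c ^+ 2 - s ^+ 2) * x.2 - 2 * c * s * x.1.1)) (cst 1).
Proof.
move=> cs1 c0.
(* [c] and [s] are cosine and sine of half the angle: the outer shears have slope s / c, the tangent
   of the half angle, and the inner one has minus the sine of the full angle. *)
have := preserves_comp (preserves_affine1 0 (s / c) 0 ltr01)
  (preserves_comp (preserves_affine3 (- (2 * c * s)) 0 0 ltr01)
    (preserves_affine1 0 (s / c) 0 ltr01)).
have s2 : s ^+ 2 = 1 - c ^+ 2 by rewrite -cs1; ring.
apply: eq_preserves => -[[x1 x2] x3] //=; last by rewrite !mulr1.
have c0' : c != 0 by rewrite gt_eqF.
congr ((_, _), _); field: s2 => //.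
Qed.

Lemma preserves_rotation12 (c s : R) : c ^+ 2 + s ^+ 2 = 1 -> 0 < c ->
  preserves (fun x => ((c ^+ 2 - s ^+ 2) * x.1.1 + 2 * c * s * x.1.2,
    (c ^+ 2 - s ^+ 2) * x.1.2 - 2 * c * s * x.1.1, x.2)) (cst 1).
Proof.
move=> cs1 c0.
have := preserves_involution (preserves_involution preserves_swap12 preserves_swap13)
  (preserves_rotation13 cs1 c0).
by apply: eq_preserves => -[[x1 x2] x3].
Qed.

(** The integral of the indicator of [N] at [T x] against [J] equals the measure of [N]; since [J]
    is positive everywhere, its vanishing forces the preimage to be null. *)
Lemma preserves_null T J (N : set R3) : preserves T J -> measurable N ->
  mu3 N = 0%E -> mu3 (T @^-1` N) = 0%E.
Proof.
move=> [mT mJ J0 P] mN N0.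
have mTN : measurable (T @^-1` N) by rewrite -[X in measurable X]setTI; exact: mT.
have mTJ : measurable_fun setT (fun x => (\1_N (T x) * J x)%:E).
  apply/measurable_EFinP; apply: measurable_funM => //.
  exact: (measurableT_comp (@measurable_indic _ _ R setT N mN) mT).
have : (\int[mu3]_x `|(\1_N (T x) * J x)%:E| = 0)%E.
  have := integral_indic mu3 measurableT mN; rewrite setIT N0 => <-.
  rewrite -(P (fun x => (\1_N x)%:E))//.
    apply: eq_integral => x _; rewrite -EFinM gee0_abs// lee_fin.
    by rewrite mulr_ge0// ltW.
  exact/measurable_EFinP/measurable_indic.
move/(ae_eq_integral_abs mu3 measurableT mTJ).
move=> [A [mA A0 NA]]; apply/eqP; rewrite eq_le measure_ge0 andbT -A0.
rewrite le_measure ?inE//; apply: subset_trans NA => x /= TNx /(_ I) /eqP.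
by rewrite indicE mem_set//= mul1r eqe gt_eqF.
Qed.

Lemma preserves_negligible T J (N : set R3) : preserves T J ->
  mu3.-negligible N -> mu3.-negligible (T @^-1` N).
Proof.
move=> pT [A [mA A0 NA]]; exists (T @^-1` A); split.
- by rewrite -[X in measurable X]setTI; case: pT => mT _ _ _; exact: mT.
- exact: preserves_null pT _ _.
- by move=> x /=; exact: NA.
Qed.

Lemma preserves_lebesgue T J (D : set R3) : preserves T J ->
  lebesgue_measurable3 D -> lebesgue_measurable3 (T @^-1` D).
Proof.
move=> pT [A mA [N nN <-]]; exists (T @^-1` A).
  by rewrite -[X in measurable X]setTI; case: pT => mT _ _ _; exact: mT.
by exists (T @^-1` N) => //; exact: preserves_negligible pT nN.
Qed.

End preserves3.

(** * Generators of the Lorentz group, their lifts to SL(2,C), and reduction of vectors *)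

Section four_vectors.
Context {R : realType}.
Local Notation C := R[i].
Local Notation R3 := (R3 R).
Local Notation R4 := 'cV[R]_4.

Lemma sum_ord4 (V : nmodType) (F : 'I_4 -> V) :
  \sum_i F i = F 0 + F 1 + F 2 + F 3.
Proof.
rewrite !big_ord_recl big_ord0 addr0 !addrA.
by do ?[congr (_ + _)]; congr F; exact: val_inj.
Qed.

Lemma ord4_cases (P : 'I_4 -> Prop) : P 0 -> P 1 -> P 2 -> P 3 -> forall i, P i.
Proof.
move=> P0 P1 P2 P3 [[|[|[|[|//]]]] Hi].
- by have -> : Ordinal Hi = 0 by exact: val_inj.
- by have -> : Ordinal Hi = 1 by exact: val_inj.
- by have -> : Ordinal Hi = 2 by exact: val_inj.
- by have -> : Ordinal Hi = 3 by exact: val_inj.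
Qed.

Lemma col4P (K : Type) (a b : 'cV[K]_4) :
  [/\ a 0 0 = b 0 0, a 1 0 = b 1 0, a 2 0 = b 2 0 & a 3 0 = b 3 0] -> a = b.
Proof.
move=> [e0 e1 e2 e3]; apply/matrixP => i j; rewrite ord1.
by move: i; apply: ord4_cases.
Qed.

Lemma mulmx4E (K : pzSemiRingType) (L : 'M[K]_4) (x : 'cV[K]_4) i :
  (L *m x) i 0 = L i 0 * x 0 0 + L i 1 * x 1 0 + L i 2 * x 2 0 + L i 3 * x 3 0.
Proof. by rewrite mxE sum_ord4. Qed.

Lemma four0 t (x : R3) : four t x 0 0 = t. Proof. by rewrite mxE. Qed.
Lemma four1 t (x : R3) : four t x 1 0 = x.1.1. Proof. by rewrite mxE. Qed.
Lemma four2 t (x : R3) : four t x 2 0 = x.1.2. Proof. by rewrite mxE. Qed.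
Lemma four3 t (x : R3) : four t x 3 0 = x.2. Proof. by rewrite mxE. Qed.
Definition fourE := (four0, four1, four2, four3).

Lemma four_spatial (a : R4) : four (a 0 0) (spatial a) = a.
Proof. by apply: col4P; rewrite !fourE. Qed.

Lemma spatial_four t (x : R3) : spatial (four t x) = x.
Proof. by rewrite /spatial !fourE; case: x => [[]]. Qed.

Definition mx4 (K : nmodType) (s : seq (seq K)) : 'M[K]_4 :=
  \matrix_(i, j) nth 0 (nth [::] s i) j.

Lemma ord2_cases (P : 'I_2 -> Prop) : P 0 -> P 1 -> forall i, P i.
Proof.
move=> P0 P1 [[|[|//]] Hi].
- by rewrite (_ : Ordinal Hi = 0)//; exact: val_inj.
- by rewrite (_ : Ordinal Hi = 1)//; exact: val_inj.
Qed.

Lemma mx2P (K : Type) (A B : 'M[K]_2) :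
  [/\ A 0 0 = B 0 0, A 0 1 = B 0 1, A 1 0 = B 1 0 & A 1 1 = B 1 1] -> A = B.
Proof.
by move=> [e0 e1 e2 e3]; apply/matrixP; apply: ord2_cases; apply: ord2_cases.
Qed.

Lemma mul_mx2 (a b c d e f g h : C) :
  mx2 a b c d *m mx2 e f g h =
  mx2 (a * e + b * g) (a * f + b * h) (c * e + d * g) (c * f + d * h).
Proof. by apply: mx2P; rewrite !mxE !big_ord_recl !big_ord0 !mxE /= !addr0. Qed.

Lemma adjoint_mx2 (a b c d : C) :
  adjointmx (mx2 a b c d) = mx2 a^*%C c^*%C b^*%C d^*%C.
Proof. by apply: mx2P; rewrite !mxE. Qed.

Lemma tr_mx2 (a b c d : C) : \tr (mx2 a b c d) = a + d.
Proof. by rewrite /mxtrace !big_ord_recl big_ord0 addr0 !mxE. Qed.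

Lemma det_mx2 (a b c d : C) : \det (mx2 a b c d) = a * d - b * c.
Proof.
rewrite (expand_det_row _ ord0) !big_ord_recl big_ord0 /cofactor !det_mx11 !mxE /=.
by rewrite addr0 expr0 expr1 mul1r mulN1r mulrN.
Qed.

Lemma scalar_mx2 : 1%:M = mx2 1 0 0 1 :> 'M[C]_2.
Proof. by apply: mx2P; rewrite !mxE. Qed.

Lemma pauliE : [/\ pauli R 0 = mx2 1 0 0 1, pauli R 1 = mx2 0 1 1 0,
  pauli R 2 = mx2 0 (- 'i) 'i 0 & pauli R 3 = mx2 1 0 0 (-1)].
Proof. by split => //; rewrite -scalar_mx2. Qed.

(** Spin parameters: [c] and [s] are cosine and sine of half the rotation angle, and in [boostz] the
    number [r] is the exponential of half the rapidity. The Lorentz matrices below contain the full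
    angle and rapidity. *)
Definition rotz (c s : R) := mx2 (c -i* s) 0 0 (c +i* s).
Definition roty (c s : R) := mx2 c%:C (- s)%:C s%:C c%:C.
Definition boostz (r : R) := mx2 r%:C 0 0 (r^-1)%:C.

Definition Rotz (c s : R) : 'M[R]_4 := let C := c ^+ 2 - s ^+ 2 in let S := 2 * c * s in
  mx4 [:: [:: 1; 0; 0; 0]; [:: 0; C; - S; 0]; [:: 0; S; C; 0]; [:: 0; 0; 0; 1]].
Definition Roty (c s : R) : 'M[R]_4 := let C := c ^+ 2 - s ^+ 2 in let S := 2 * c * s in
  mx4 [:: [:: 1; 0; 0; 0]; [:: 0; C; 0; S]; [:: 0; 0; 1; 0]; [:: 0; - S; 0; C]].
Definition Boostz (r : R) : 'M[R]_4 :=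
  let ch := (r ^+ 2 + r ^- 2) / 2 in let sh := (r ^+ 2 - r ^- 2) / 2 in
  mx4 [:: [:: ch; 0; 0; sh]; [:: 0; 1; 0; 0]; [:: 0; 0; 1; 0]; [:: sh; 0; 0; ch]].

Lemma Lambda_rotz c s : c ^+ 2 + s ^+ 2 = 1 -> Lambda (rotz c s) = Rotz c s.
Proof.
move=> cs1; have [p0 p1 p2 p3] := pauliE.
have s2 : s ^+ 2 = 1 - c ^+ 2 by rewrite -cs1; ring.
apply/matrixP; apply: ord4_cases; apply: ord4_cases; rewrite !mxE /rotz /=;
  rewrite ?p0 ?p1 ?p2 ?p3 adjoint_mx2 !mul_mx2 tr_mx2 /=; by field: s2.
Qed.

Lemma Lambda_roty c s : c ^+ 2 + s ^+ 2 = 1 -> Lambda (roty c s) = Roty c s.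
Proof.
move=> cs1; have [p0 p1 p2 p3] := pauliE.
have s2 : s ^+ 2 = 1 - c ^+ 2 by rewrite -cs1; ring.
apply/matrixP; apply: ord4_cases; apply: ord4_cases; rewrite !mxE /roty /=;
  rewrite ?p0 ?p1 ?p2 ?p3 adjoint_mx2 !mul_mx2 tr_mx2 /=; by field: s2.
Qed.

Lemma Lambda_boostz r : r != 0 -> Lambda (boostz r) = Boostz r.
Proof.
move=> r0; have [p0 p1 p2 p3] := pauliE.
apply/matrixP; apply: ord4_cases; apply: ord4_cases; rewrite !mxE /boostz /=;
  rewrite ?p0 ?p1 ?p2 ?p3 adjoint_mx2 !mul_mx2 tr_mx2 /=; by field.
Qed.

Lemma det_Rotz c s : c ^+ 2 + s ^+ 2 = 1 -> \det (Rotz c s) = 1.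
Proof.
move=> cs1; have s2 : s ^+ 2 = 1 - c ^+ 2 by rewrite -cs1; ring.
rewrite (expand_det_row _ ord0) !big_ord_recl big_ord0 !mxE /= !mul0r !addr0 mul1r.
rewrite /cofactor (expand_det_row _ ord0) !big_ord_recl big_ord0 !mxE /=.
rewrite /cofactor !(expand_det_row _ ord0) !big_ord_recl !big_ord0 !mxE /=.
rewrite /cofactor !det_mx11 !mxE /=.
by ring: s2.
Qed.

Lemma det_Roty c s : c ^+ 2 + s ^+ 2 = 1 -> \det (Roty c s) = 1.
Proof.
move=> cs1; have s2 : s ^+ 2 = 1 - c ^+ 2 by rewrite -cs1; ring.
rewrite (expand_det_row _ ord0) !big_ord_recl big_ord0 !mxE /= !mul0r !addr0 mul1r.
rewrite /cofactor (expand_det_row _ ord0) !big_ord_recl big_ord0 !mxE /=.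
rewrite /cofactor !(expand_det_row _ ord0) !big_ord_recl !big_ord0 !mxE /=.
rewrite /cofactor !det_mx11 !mxE /=.
by ring: s2.
Qed.

Lemma det_Boostz r : r != 0 -> \det (Boostz r) = 1.
Proof.
move=> r0.
rewrite (expand_det_row _ 1) !big_ord_recl big_ord0 !mxE /= !mul0r !addr0 mul1r !add0r.
rewrite /cofactor (expand_det_row _ ord0) !big_ord_recl big_ord0 !mxE /=.
rewrite /cofactor !(expand_det_row _ ord0) !big_ord_recl !big_ord0 !mxE /=.
rewrite /cofactor !det_mx11 !mxE /=.
by field.
Qed.

Lemma mul_Rotz c s : c ^+ 2 + s ^+ 2 = 1 -> Rotz c s *m Rotz c (- s) = 1%:M.
Proof.
move=> cs1; have s2 : s ^+ 2 = 1 - c ^+ 2 by rewrite -cs1; ring.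
apply/matrixP; apply: ord4_cases; apply: ord4_cases; rewrite !mxE sum_ord4 !mxE /=;
 by ring: s2.
Qed.

Lemma mul_Roty c s : c ^+ 2 + s ^+ 2 = 1 -> Roty c s *m Roty c (- s) = 1%:M.
Proof.
move=> cs1; have s2 : s ^+ 2 = 1 - c ^+ 2 by rewrite -cs1; ring.
apply/matrixP; apply: ord4_cases; apply: ord4_cases; rewrite !mxE sum_ord4 !mxE /=;
 by ring: s2.
Qed.

Lemma mul_Boostz r : r != 0 -> Boostz r *m Boostz r^-1 = 1%:M.
Proof.
move=> r0.
apply/matrixP; apply: ord4_cases; apply: ord4_cases; rewrite !mxE sum_ord4 !mxE /=;
 by field.
Qed.

Lemma mul_rotz c s : c ^+ 2 + s ^+ 2 = 1 -> rotz c s *m rotz c (- s) = 1%:M.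
Proof.
move=> cs1; have s2 : s ^+ 2 = 1 - c ^+ 2 by rewrite -cs1; ring.
rewrite /rotz mul_mx2 scalar_mx2; congr mx2; simpc => //; congr (_ +i* _); by ring: s2.
Qed.

Lemma mul_roty c s : c ^+ 2 + s ^+ 2 = 1 -> roty c s *m roty c (- s) = 1%:M.
Proof.
move=> cs1; have s2 : s ^+ 2 = 1 - c ^+ 2 by rewrite -cs1; ring.
rewrite /roty mul_mx2 scalar_mx2; congr mx2; simpc => //; congr (_ +i* _); by ring: s2.
Qed.

Lemma mul_boostz r : r != 0 -> boostz r *m boostz r^-1 = 1%:M.
Proof.
move=> r0.
rewrite /boostz mul_mx2 scalar_mx2; congr mx2; simpc => //; congr (_ +i* _); by field.
Qed.

Lemma det_rotz c s : c ^+ 2 + s ^+ 2 = 1 -> \det (rotz c s) = 1.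
Proof.
move=> cs1; have s2 : s ^+ 2 = 1 - c ^+ 2 by rewrite -cs1; ring.
rewrite /rotz det_mx2; simpc => //; congr (_ +i* _); by ring: s2.
Qed.

Lemma det_roty c s : c ^+ 2 + s ^+ 2 = 1 -> \det (roty c s) = 1.
Proof.
move=> cs1; have s2 : s ^+ 2 = 1 - c ^+ 2 by rewrite -cs1; ring.
rewrite /roty det_mx2; simpc => //; congr (_ +i* _); by ring: s2.
Qed.

Lemma det_boostz r : r != 0 -> \det (boostz r) = 1.
Proof.
move=> r0.
rewrite /boostz det_mx2; simpc => //; congr (_ +i* _); by field.
Qed.

Lemma mink_Rotz c s (a b : R4) : c ^+ 2 + s ^+ 2 = 1 ->
  mink (Rotz c s *m a) (Rotz c s *m b) = mink a b.
Proof.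
move=> cs1; have s2 : s ^+ 2 = 1 - c ^+ 2 by rewrite -cs1; ring.
rewrite /mink !mulmx4E !mxE /=; by ring: s2.
Qed.

Lemma mink_Roty c s (a b : R4) : c ^+ 2 + s ^+ 2 = 1 ->
  mink (Roty c s *m a) (Roty c s *m b) = mink a b.
Proof.
move=> cs1; have s2 : s ^+ 2 = 1 - c ^+ 2 by rewrite -cs1; ring.
rewrite /mink !mulmx4E !mxE /=; by ring: s2.
Qed.

Lemma mink_Boostz r (a b : R4) : r != 0 ->
  mink (Boostz r *m a) (Boostz r *m b) = mink a b.
Proof. by move=> r0; rewrite /mink !mulmx4E !mxE /=; field. Qed.

Definition future (n : R4) : Prop := 0 < n 0 0 /\ 0 < mink n n.

Lemma future_Rotz c s n : c ^+ 2 + s ^+ 2 = 1 -> future n -> future (Rotz c s *m n).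
Proof.
move=> cs1 [n0 nn]; split; last by rewrite mink_Rotz.
by rewrite mulmx4E !mxE /= mul1r !mul0r !addr0.
Qed.

Lemma future_Roty c s n : c ^+ 2 + s ^+ 2 = 1 -> future n -> future (Roty c s *m n).
Proof.
move=> cs1 [n0 nn]; split; last by rewrite mink_Roty.
by rewrite mulmx4E !mxE /= mul1r !mul0r !addr0.
Qed.

Lemma future_Boostz r n : r != 0 -> future n -> future (Boostz r *m n).
Proof.
move=> r0 [n0 nn]; split; last by rewrite mink_Boostz.
rewrite mulmx4E !mxE /= !mul0r !addr0.
have r2 : 0 < r ^+ 2 by rewrite exprn_even_gt0.
have r2' : 0 < r ^- 2 by rewrite invr_gt0.
have n30 : n 3 0 ^+ 2 < n 0 0 ^+ 2 by move: nn; rewrite /mink; nra.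
have [n3l n3r] : - n 0 0 < n 3 0 /\ n 3 0 < n 0 0 by split; nra.
nra.
Qed.

Lemma eps_gt0 (p : R3) : 0 < eps p.
Proof.
rewrite sqrtr_gt0 /dot3; nra.
Qed.

Lemma sqr_eps (p : R3) : eps p ^+ 2 = 1 + dot3 p p.
Proof. rewrite sqr_sqrtr// /dot3; nra. Qed.

Lemma mink_onshell (p : R3) : mink (onshell p) (onshell p) = 1.
Proof. rewrite /mink !fourE -expr2 sqr_eps /dot3; ring. Qed.

Lemma future_onshell (p : R3) : future (onshell p).
Proof. by rewrite /future mink_onshell four0 eps_gt0. Qed.

(** Both sides lie on the future mass shell, where the spatial part determines the time
    component. *)
Lemma onshell_lact (L : 'M[R]_4) (p : R3) :
  (forall a b : R4, mink (L *m a) (L *m b) = mink a b) ->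
  (forall n, future n -> future (L *m n)) ->
  onshell (lact L p) = L *m onshell p.
Proof.
move=> mL fL; rewrite -[RHS]four_spatial /onshell; congr (four _ _).
rewrite -/(onshell p) -/(lact L p).
have [L0 _] := fL _ (future_onshell p).
have := mL (onshell p) (onshell p); rewrite mink_onshell => H.
apply/eqP; rewrite -(@eqrXn2 _ 2)// ?(ltW L0) ?(ltW (eps_gt0 _))// sqr_eps.
by apply/eqP; move: H; rewrite /mink /lact /dot3 /spatial /=; nra.
Qed.

Lemma measurable_eps : measurable_fun setT (@eps R).
Proof.
apply: (measurableT_comp (continuous_measurable_fun (@sqrt_continuous R))).
have m1 := @measurable_coord1 R; have m2 := @measurable_coord2 R.
have m3 := @measurable_coord3 R.
by rewrite /dot3; do ?[apply: measurable_funD|apply: measurable_funM].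
Qed.

Lemma measurable_eps_inv : measurable_fun setT (fun p : R3 => (eps p)^-1).
Proof.
rewrite (_ : (fun p => _) = (fun p => (eps p) `^ (-1))); last first.
  by apply/funext => p; rewrite powR_inv1// ltW// eps_gt0.
exact: (measurableT_comp (measurable_powR (-1)) measurable_eps).
Qed.

(** This is the Lorentz invariance of d^3p / eps(p), written as a Jacobian for d^3p. For a rotation
    [eps] does not change and the factor is 1. *)
Lemma preserves_lact_Rotz c s : c ^+ 2 + s ^+ 2 = 1 -> 0 < c ->
  preserves (lact (Rotz c s)) (fun p => eps (lact (Rotz c s) p) / eps p).
Proof.
move=> cs1 c0.
have cs1' : c ^+ 2 + (- s) ^+ 2 = 1 by rewrite sqrrN.
have lE p : lact (Rotz c s) p = ((c ^+ 2 - (- s) ^+ 2) * p.1.1 + 2 * c * - s * p.1.2,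
    (c ^+ 2 - (- s) ^+ 2) * p.1.2 - 2 * c * - s * p.1.1, p.2).
  rewrite /lact /spatial !mulmx4E !mxE /=; congr ((_, _), _); ring.
have := preserves_rotation12 cs1' c0; apply: eq_preserves => p //=.
have -> : eps (lact (Rotz c s) p) = eps p.
  rewrite /eps; congr Num.sqrt; congr (1 + _); rewrite lE /dot3 /=.
  have s2 : s ^+ 2 = 1 - c ^+ 2 by rewrite -cs1; ring.
  by ring: s2.
by rewrite divff// gt_eqF// eps_gt0.
Qed.

Lemma preserves_lact_Roty c s : c ^+ 2 + s ^+ 2 = 1 -> 0 < c ->
  preserves (lact (Roty c s)) (fun p => eps (lact (Roty c s) p) / eps p).
Proof.
move=> cs1 c0.
have lE p : lact (Roty c s) p = ((c ^+ 2 - s ^+ 2) * p.1.1 + 2 * c * s * p.2,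
    p.1.2, (c ^+ 2 - s ^+ 2) * p.2 - 2 * c * s * p.1.1).
  rewrite /lact /spatial !mulmx4E !mxE /=; congr ((_, _), _); ring.
have := preserves_rotation13 cs1 c0; apply: eq_preserves => p //=.
have -> : eps (lact (Roty c s) p) = eps p.
  rewrite /eps; congr Num.sqrt; congr (1 + _); rewrite lE /dot3 /=.
  have s2 : s ^+ 2 = 1 - c ^+ 2 by rewrite -cs1; ring.
  by ring: s2.
by rewrite divff// gt_eqF// eps_gt0.
Qed.

(** A boost at fixed transverse momentum, with [m] = 1 + p_1^2 + p_2^2; the boost with [- sh] is its
    inverse. The Jacobian is positive because ch^2 (m + y^2) > sh^2 y^2. *)
Lemma preserves1_boost (m ch sh : R) : 0 < m -> ch ^+ 2 - sh ^+ 2 = 1 -> 0 < ch ->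
  preserves1 (fun y => sh * Num.sqrt (m + y ^+ 2) + ch * y)
    (fun y => (ch * Num.sqrt (m + y ^+ 2) + sh * y) / Num.sqrt (m + y ^+ 2)).
Proof.
move=> m0 h1 ch0.
have my y : 0 < m + y ^+ 2 by rewrite ltr_wpDr// sqr_ge0.
have sq0 y : 0 < Num.sqrt (m + y ^+ 2) by rewrite sqrtr_gt0.
have sqE y : Num.sqrt (m + y ^+ 2) ^+ 2 = m + y ^+ 2 by rewrite sqr_sqrtr// ltW.
have pos (a : R) y : a ^+ 2 = sh ^+ 2 -> 0 < ch * Num.sqrt (m + y ^+ 2) + a * y.
  move=> ha.
  have H : (a * y) ^+ 2 < (ch * Num.sqrt (m + y ^+ 2)) ^+ 2.
    by rewrite !exprMn sqE ha; move: (sqr_ge0 sh) (sqr_ge0 y); nra.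
  have : 0 < ch * Num.sqrt (m + y ^+ 2) by rewrite mulr_gt0.
  nra.
apply: (@preserves1_diffeo _ _ _ (fun y => - sh * Num.sqrt (m + y ^+ 2) + ch * y)).
- move=> x.
  have d1 : is_derive x (1 : R) (fun y : R => m + y ^+ 2) (x *+ 2).
    by apply: is_derive_eq; rewrite /GRing.scale/=; ring.
  have d2 : is_derive x (1 : R) (fun y : R => Num.sqrt (m + y ^+ 2))
      ((2 * Num.sqrt (m + x ^+ 2))^-1 *: (x *+ 2)).
    exact: (@is_derive1_comp _ Num.sqrt _ x _ _ (is_derive1_sqrt (my x)) d1).
  apply: is_derive_eq.
  rewrite /GRing.scale/=; field; exact: lt0r_neq0.
- have cs : continuous (fun y : R => Num.sqrt (m + y ^+ 2)).
    move=> y; apply: (@continuous_comp _ _ _ (fun y : R => m + y ^+ 2) Num.sqrt).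
      apply: cvgD; [exact: cvg_cst|exact: exprn_continuous].
    exact: sqrt_continuous.
  move=> y; apply: cvgM; last first.
    by apply: cvgV; [exact: lt0r_neq0|exact: cs].
  apply: cvgD; apply: cvgM; [exact: cvg_cst|exact: cs|exact: cvg_cst|exact: cvg_id].
- by move=> x; rewrite divr_gt0// pos.
- move=> y; set w := Num.sqrt (m + y ^+ 2).
  have -> : Num.sqrt (m + (- sh * w + ch * y) ^+ 2) = ch * w - sh * y.
    have p0 : 0 < ch * w + (- sh) * y by apply: pos; rewrite sqrrN.
    rewrite -[RHS]gtr0_norm; last by move: p0; rewrite mulNr.
    rewrite -sqrtr_sqr; congr Num.sqrt.
    have mE : m = w ^+ 2 - y ^+ 2 by rewrite sqE; ring.
    have chE : ch ^+ 2 = 1 + sh ^+ 2 by rewrite -h1; ring.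
    by rewrite mE; ring: chE.
  have chE : ch ^+ 2 = 1 + sh ^+ 2 by rewrite -h1; ring.
  by ring: chE.
Qed.

Lemma preserves_lact_Boostz r : r != 0 ->
  preserves (lact (Boostz r)) (fun p => eps (lact (Boostz r) p) / eps p).
Proof.
move=> r0.
have r2 : 0 < r ^+ 2 by rewrite exprn_even_gt0.
have r2' : 0 < r ^- 2 by rewrite invr_gt0.
set ch := (r ^+ 2 + r ^- 2) / 2; set sh := (r ^+ 2 - r ^- 2) / 2.
have h1 : ch ^+ 2 - sh ^+ 2 = 1 by rewrite /ch /sh; field.
have ch0 : 0 < ch by rewrite divr_gt0// addr_gt0.
have lE p : lact (Boostz r) p = (p.1, sh * eps p + ch * p.2).
  rewrite /lact /spatial !mulmx4E !mxE /= -/ch -/sh; case: p => [[a b] c] /=.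
  congr ((_, _), _); ring.
have eE p : eps (lact (Boostz r) p) = ch * eps p + sh * p.2.
  have := onshell_lact p (fun a b => mink_Boostz a b r0) (fun n => future_Boostz r0).
  move/(congr1 (fun a : R4 => a 0 0)).
  rewrite four0 mulmx4E !mxE /= => ->; rewrite -/ch -/sh; ring.
have me := measurable_eps; have m3 := @measurable_coord3 R.
have H p : 0 < (ch * eps p + sh * p.2) / eps p.
  by rewrite divr_gt0 ?eps_gt0// -eE eps_gt0.
have mF : measurable_fun setT (fun p : R3 => sh * eps p + ch * p.2).
  by do ?[apply: measurable_funD|apply: measurable_funM].
have mJ : measurable_fun setT (fun p : R3 => (ch * eps p + sh * p.2) / eps p).
  apply: measurable_funM; first by do ?[apply: measurable_funD|apply: measurable_funM].
  exact: measurable_eps_inv.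
have P1 (u : R * R) : preserves1 (fun y => sh * eps (u, y) + ch * (u, y).2)
    (fun y => (ch * eps (u, y) + sh * (u, y).2) / eps (u, y)).
  have m0 : 0 < 1 + u.1 * u.1 + u.2 * u.2 by nra.
  have eps2 : (fun y : R => eps (u, y)) =
      (fun y => Num.sqrt (1 + u.1 * u.1 + u.2 * u.2 + y ^+ 2)).
    by apply/funext => y; rewrite /eps /dot3 /= expr2 !addrA.
  have := preserves1_boost m0 h1 ch0.
  rewrite (_ : (fun y => sh * _ + _) = (fun y => sh * eps (u, y) + ch * (u, y).2)).
    rewrite (_ : (fun y => (ch * _ + _) / _) =
      (fun y => (ch * eps (u, y) + sh * (u, y).2) / eps (u, y)))//.
    by apply/funext => y; rewrite -!(congr1 (fun f => f y) eps2).
  by apply/funext => y; rewrite -(congr1 (fun f => f y) eps2).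
have := preserves_coord3 mF mJ H P1.
by apply: eq_preserves => p; [rewrite lE|rewrite eE].
Qed.

(** [L] read in spatial coordinates, on a spacelike hyperplane of slope [e] and on its image. It
    serves to transport Lebesgue measurability of regions, for which any Jacobian will do. *)
Definition affine_preserving (L : 'M[R]_4) : Prop := forall (a : R) (e : R3),
  dot3 e e < 1 ->
  exists J, preserves (fun x => spatial (L *m four (a + dot3 e x) x)) J.

Lemma affine_Rotz c s : c ^+ 2 + s ^+ 2 = 1 -> 0 < c -> affine_preserving (Rotz c s).
Proof.
move=> cs1 c0 a e _; exists (cst 1).
have cs1' : c ^+ 2 + (- s) ^+ 2 = 1 by rewrite sqrrN.
have := preserves_rotation12 cs1' c0; apply: eq_preserves => p //=.
rewrite /spatial !mulmx4E !fourE !mxE /=; congr ((_, _), _); ring.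
Qed.

Lemma affine_Roty c s : c ^+ 2 + s ^+ 2 = 1 -> 0 < c -> affine_preserving (Roty c s).
Proof.
move=> cs1 c0 a e _; exists (cst 1).
have := preserves_rotation13 cs1 c0; apply: eq_preserves => p //=.
rewrite /spatial !mulmx4E !fourE !mxE /=; congr ((_, _), _); ring.
Qed.

Lemma affine_Boostz r : r != 0 -> affine_preserving (Boostz r).
Proof.
move=> r0 a e e1.
have r2 : 0 < r ^+ 2 by rewrite exprn_even_gt0.
have r2' : 0 < r ^- 2 by rewrite invr_gt0.
set ch := (r ^+ 2 + r ^- 2) / 2; set sh := (r ^+ 2 - r ^- 2) / 2.
have al0 : 0 < ch + sh * e.2.
  have : e.2 ^+ 2 < 1 by move: e1; rewrite /dot3; nra.
  rewrite /ch /sh => ?; have [? ?] : -1 < e.2 /\ e.2 < 1 by split; nra.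
  nra.
exists (cst (ch + sh * e.2)).
have := preserves_affine3 (sh * e.1.1) (sh * e.1.2) (sh * a) al0.
apply: eq_preserves => -[[x1 x2] x3] //=.
rewrite /spatial !mulmx4E !fourE !mxE /= -/ch -/sh /dot3 /=; congr ((_, _), _); ring.
Qed.

Definition good_lorentz (L : 'M[R]_4) : Prop :=
  [/\ proper_orthochronous L, forall n, future n -> future (L *m n),
      preserves (lact L) (fun p => eps (lact L p) / eps p) & affine_preserving L].

(** An element of SL(2,C) bundled with its inverse and both Lorentz images. Covariance is invoked
    only for such bundles, whose [Lambda] is computed explicitly; longer products arise by induction
    in the reduction principles. *)
Record generator (A A' : 'M[C]_2) (L L' : 'M[R]_4) : Prop := Generator {
  gen_det : \det A = 1;
  gen_det' : \det A' = 1;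
  gen_mul : A *m A' = 1%:M;
  gen_Lambda : Lambda A = L;
  gen_Lambda' : Lambda A' = L';
  gen_mulL : L *m L' = 1%:M;
  gen_good : good_lorentz L;
  gen_good' : good_lorentz L' }.

Lemma generatorV A A' L L' : generator A A' L L' -> generator A' A L' L.
Proof.
by case=> *; split => //; exact: mulmx1C.
Qed.

Lemma good_Rotz c s : c ^+ 2 + s ^+ 2 = 1 -> 0 < c -> good_lorentz (Rotz c s).
Proof.
move=> cs1 c0; split.
- split; first by move=> a b; exact: mink_Rotz.
    exact: det_Rotz.
  by rewrite mxE.
- by move=> n; exact: future_Rotz.
- exact: preserves_lact_Rotz.
- exact: affine_Rotz.
Qed.

Lemma good_Roty c s : c ^+ 2 + s ^+ 2 = 1 -> 0 < c -> good_lorentz (Roty c s).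
Proof.
move=> cs1 c0; split.
- split; first by move=> a b; exact: mink_Roty.
    exact: det_Roty.
  by rewrite mxE.
- by move=> n; exact: future_Roty.
- exact: preserves_lact_Roty.
- exact: affine_Roty.
Qed.

Lemma good_Boostz r : r != 0 -> good_lorentz (Boostz r).
Proof.
move=> r0; split.
- split; first by move=> a b; exact: mink_Boostz.
    exact: det_Boostz.
  by rewrite mxE /= divr_gt0// addr_gt0// ?invr_gt0 exprn_even_gt0.
- by move=> n; exact: future_Boostz.
- exact: preserves_lact_Boostz.
- exact: affine_Boostz.
Qed.

Lemma generator_rotz c s : c ^+ 2 + s ^+ 2 = 1 -> 0 < c ->
  generator (rotz c s) (rotz c (- s)) (Rotz c s) (Rotz c (- s)).
Proof.
move=> cs1 c0; have cs1' : c ^+ 2 + (- s) ^+ 2 = 1 by rewrite sqrrN.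
split; [exact: det_rotz|exact: det_rotz|exact: mul_rotz|exact: Lambda_rotz|
  exact: Lambda_rotz|exact: mul_Rotz|exact: good_Rotz|exact: good_Rotz].
Qed.

Lemma generator_roty c s : c ^+ 2 + s ^+ 2 = 1 -> 0 < c ->
  generator (roty c s) (roty c (- s)) (Roty c s) (Roty c (- s)).
Proof.
move=> cs1 c0; have cs1' : c ^+ 2 + (- s) ^+ 2 = 1 by rewrite sqrrN.
split; [exact: det_roty|exact: det_roty|exact: mul_roty|exact: Lambda_roty|
  exact: Lambda_roty|exact: mul_Roty|exact: good_Roty|exact: good_Roty].
Qed.

Lemma generator_boostz r : r != 0 ->
  generator (boostz r) (boostz r^-1) (Boostz r) (Boostz r^-1).
Proof.
move=> r0; have r0' : r^-1 != 0 by rewrite invr_eq0.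
split; [exact: det_boostz|exact: det_boostz|exact: mul_boostz|exact: Lambda_boostz|
  exact: Lambda_boostz|exact: mul_Boostz|exact: good_Boostz|exact: good_Boostz].
Qed.

(** The rotation by angle 0; it is the generator behind every pure translation. *)
Lemma generator1 : generator 1%:M 1%:M 1%:M 1%:M.
Proof.
have e : (1 : R) ^+ 2 + 0 ^+ 2 = 1 by rewrite expr1n expr0n addr0.
have := generator_rotz e ltr01; rewrite oppr0.
have -> : rotz 1 0 = 1%:M by rewrite scalar_mx2 /rotz oppr0.
have -> // : Rotz 1 0 = 1%:M.
by apply/matrixP; apply: ord4_cases; apply: ord4_cases; rewrite !mxE /= ?expr1n ?expr0n/= ?mulr0 ?subr0 ?oppr0.
Qed.

(** Some rotation of the plane kills a given coordinate, and its angle can be chosen with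
    nonnegative cosine, so that the half angle has the positive cosine required by the shear
    decomposition. *)
Lemma half_angle (x y : R) : exists c s : R,
  [/\ c ^+ 2 + s ^+ 2 = 1, 0 < c & 2 * c * s * x + (c ^+ 2 - s ^+ 2) * y = 0].
Proof.
set r := Num.sqrt (x ^+ 2 + y ^+ 2).
have [r0|r0] := eqVneq r 0.
  have [x0 y0] : x = 0 /\ y = 0.
    have : x ^+ 2 + y ^+ 2 <= 0 by rewrite -sqrtr_eq0 -/r r0.
    by move=> ?; split; nra.
  by exists 1, 0; rewrite x0 y0; split; rewrite ?ltr01//; ring.
have rgt0 : 0 < r by rewrite lt0r r0 sqrtr_ge0.
have r2 : r ^+ 2 = x ^+ 2 + y ^+ 2 by rewrite sqr_sqrtr// addr_ge0// sqr_ge0.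
(* The sign [e] makes the cosine C = e x / r nonnegative; then 1 + C > 0 and the half angle formula
   yields c > 0. *)
have [e [ex ee]] : exists e : R, 0 <= e * x /\ e ^+ 2 = 1.
  have [x0|x0] := leP 0 x; first by exists 1; rewrite mul1r expr1n.
  by exists (-1); rewrite sqrrN expr1n mulN1r oppr_ge0 ltW.
set C := e * x / r; set S := - e * y / r.
have C0 : 0 <= C by rewrite divr_ge0// ltW.
have CS : C ^+ 2 + S ^+ 2 = 1.
  have -> : C ^+ 2 + S ^+ 2 = e ^+ 2 * (x ^+ 2 + y ^+ 2) / r ^+ 2.
    by rewrite /C /S; field.
  by rewrite ee mul1r -r2 divff// expf_neq0.
set c := Num.sqrt ((1 + C) / 2).
have c0 : 0 < c by rewrite sqrtr_gt0; lra.
have c2 : c ^+ 2 = (1 + C) / 2 by rewrite sqr_sqrtr//; lra.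
have S2 : S ^+ 2 = 1 - C ^+ 2 by rewrite -CS; ring.
have c0' : c != 0 by exact: lt0r_neq0.
have s2 : (S / (2 * c)) ^+ 2 = (1 - C) / 2.
  have -> : (S / (2 * c)) ^+ 2 = S ^+ 2 / (4 * c ^+ 2) by field.
  by rewrite S2 c2; field; lra.
exists c, (S / (2 * c)); split => //.
  by rewrite s2 c2; field.
rewrite s2 c2.
have -> : 2 * c * (S / (2 * c)) = S by field.
by rewrite /S /C; field.
Qed.

(* Rotations fix the time axis. *)
Lemma rotation_reduction (P : R4 -> Prop) :
  (forall A A' L L' n, generator A A' L L' ->
     (forall t, L *m four t 0 = four t 0) -> P (L *m n) -> P n) ->
  (forall t z, P (four t (0, 0, z))) -> forall n, P n.
Proof.
move=> PL P0 n.
have [c [s [cs1 c0 E]]] := half_angle (n 1 0) (n 2 0).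
have g1 := generator_rotz cs1 c0.
apply: (PL _ _ _ _ _ g1) => [t|].
  by apply: col4P; rewrite !mulmx4E !fourE !mxE /=; split; ring.
set n' := _ *m n.
have n2 : n' 2 0 = 0 by rewrite mulmx4E !mxE /= -[RHS]E; ring.
clearbody n'.
have [c' [s' [cs1' c0' E']]] := half_angle (n' 3 0) (n' 1 0).
have g2 := generator_roty cs1' c0'.
apply: (PL _ _ _ _ _ g2) => [t|].
  by apply: col4P; rewrite !mulmx4E !fourE !mxE /=; split; ring.
set n'' := _ *m n'.
have n1' : n'' 1 0 = 0 by rewrite mulmx4E !mxE /= -[RHS]E'; ring.
have n2' : n'' 2 0 = 0 by rewrite mulmx4E !mxE /= n2; ring.
by rewrite -(four_spatial n'') /spatial n1' n2'.
Qed.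

(** Rotations bring a timelike vector into the plane of the time axis and the third axis, and one
    boost then brings it to rest. *)
Lemma future_reduction (P : R4 -> Prop) :
  (forall A A' L L' n, generator A A' L L' -> P (L *m n) -> P n) ->
  (forall m, 0 < m -> P (four m 0)) -> forall n, future n -> P n.
Proof.
move=> PL P0; apply: rotation_reduction.
  move=> A A' L L' n g _ IH fn; apply: (PL _ _ _ _ _ g); apply: IH.
  by have [_ fL _ _] := gen_good g; exact: fL.
move=> t z [t0 tz].
rewrite fourE in t0.
have {}tz : z ^+ 2 < t ^+ 2 by move: tz; rewrite /mink !fourE /=; nra.
have [zl zr] : - t < z /\ z < t by split; nra.
have q0 : 0 < (t - z) / (t + z) by rewrite divr_gt0; lra.
(* The boost multiplies t + z by r^2 and t - z by r^-2; the third component vanishes when the two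
   products agree. *)
set r := Num.sqrt (Num.sqrt ((t - z) / (t + z))).
have rgt0 : 0 < r by rewrite !sqrtr_gt0.
have r0 : r != 0 by exact: lt0r_neq0.
have r4 : r ^+ 4 = (t - z) / (t + z).
  by rewrite (exprM r 2 2) !sqr_sqrtr ?sqrtr_ge0// ltW.
have E : r ^+ 4 * (t + z) = t - z by rewrite r4 divfK//; lra.
apply: (PL _ _ _ _ _ (generator_boostz r0)).
set n := _ *m _.
have n3 : n 3 0 = 0.
  rewrite mulmx4E !fourE !mxE /=.
  have -> : (r ^+ 2 - r ^- 2) / 2 * t + 0 * 0 + 0 * 0 + (r ^+ 2 + r ^- 2) / 2 * z =
    (r ^+ 4 * (t + z) - (t - z)) / 2 / r ^+ 2 by field.
  by rewrite E subrr !mul0r.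
have n1 : n 1 0 = 0 by rewrite mulmx4E !fourE !mxE /=; ring.
have n2 : n 2 0 = 0 by rewrite mulmx4E !fourE !mxE /=; ring.
rewrite -(four_spatial n) /spatial n1 n2 n3; apply: P0.
suff [] : future n by [].
apply: future_Boostz => //; split; rewrite /mink !fourE //=; nra.
Qed.

End four_vectors.

(** * Square integrable functions, quadratic forms and a dense class of states *)

Section operators.
Context {R : realType}.
Local Notation C := R[i].
Local Notation R3 := (R3 R).
Local Notation R4 := 'cV[R]_4.
Local Notation mu3 := (mu3 R).
Local Notation L2 := (@LC R 2%:E).
Local Notation Re := (@complex.Re R).
Local Notation Im := (@complex.Im R).

Lemma ae_eq_Rintegral d (T : measurableType d) (mu : {measure set T -> \bar R})
    (f g : T -> R) : measurable_fun setT f -> measurable_fun setT g ->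
  f = g %[ae mu] -> \int[mu]_x f x = \int[mu]_x g x.
Proof.
move=> mf mg fg; rewrite /Rintegral; congr fine.
apply: ae_eq_integral => //; [exact/measurable_EFinP|exact/measurable_EFinP|].
by move: fg; apply: filterS => x /= H /H ->.
Qed.

Lemma preserves_Rintegral T J (f : R3 -> R) : preserves T J ->
  measurable_fun setT f ->
  \int[mu3]_x (f (T x) * J x) = \int[mu3]_x f x.
Proof.
move=> p mf; rewrite /Rintegral; congr fine.
have := preserves_integral p (measurableT_comp (@EFin_measurable R setT) mf).
by move=> <-; apply: eq_integral => x _; rewrite EFinM.
Qed.

Lemma preserves_integrable T J (f : R3 -> R) : preserves T J ->
  mu3.-integrable setT (EFin \o f) ->
  mu3.-integrable setT (EFin \o (fun x => f (T x) * J x)).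
Proof.
move=> p /integrableP[/measurable_EFinP mf fi]; apply/integrableP.
have [mT mJ J0 P] := p; split.
  apply/measurable_EFinP; apply: measurable_funM => //.
  exact: measurableT_comp.
rewrite (_ : integral _ _ _ = \int[mu3]_x (`|(f (T x))%:E| * (J x)%:E))%E.
  by rewrite (P (fun x => `|(f x)%:E|)%E)//; do 2 apply: measurableT_comp => //.
by apply: eq_integral => x _ /=; rewrite normrM EFinM (gtr0_norm (J0 x)).
Qed.

Definition cmeasurable d (X : measurableType d) (f : X -> C) : Prop :=
  measurable_fun setT (Re \o f) /\ measurable_fun setT (Im \o f).

Definition normsq (z : C) : R := Re z ^+ 2 + Im z ^+ 2.
Definition rdot (z w : C) : R := Re z * Re w + Im z * Im w.

Lemma normsq_ge0 z : 0 <= normsq z.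
Proof. by rewrite addr_ge0// sqr_ge0. Qed.

Lemma rdotxx z : rdot z z = normsq z. Proof. by rewrite /rdot /normsq !expr2. Qed.

Lemma Re_conjM (z w : C) : Re (z^*%C * w) = rdot z w.
Proof. by case: z w => a b [c d]; rewrite /rdot /= mulNr opprK. Qed.

(** Young's inequality with a free weight; integrated in [rinner_le], it does the work of the
    Cauchy-Schwarz inequality without square roots of norms. *)
Lemma rdot_le (s : R) z w : 0 < s -> `|rdot z w| <= (s * normsq z + normsq w / s) / 2.
Proof.
case: z w => a b [c d] s0; rewrite /rdot /normsq /=.
have E x y : x * y <= (s * x ^+ 2 + y ^+ 2 / s) / 2 /\ - (x * y) <= (s * x ^+ 2 + y ^+ 2 / s) / 2.
  have s0' : s != 0 by rewrite gt_eqF.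
  have -> : (s * x ^+ 2 + y ^+ 2 / s) / 2 = x * y + (s * x - y) ^+ 2 / (2 * s) by field.
  have H : 0 <= (s * x - y) ^+ 2 / (2 * s) by rewrite divr_ge0 ?sqr_ge0// mulr_ge0// ltW.
  have H2 : 0 <= (s * x + y) ^+ 2 / (2 * s) by rewrite divr_ge0 ?sqr_ge0// mulr_ge0// ltW.
  have E2 : (s * x + y) ^+ 2 / (2 * s) = (s * x - y) ^+ 2 / (2 * s) + 2 * x * y by field.
  split; lra.
have [] := E a c; have [] := E b d; rewrite ler_norml => ? ? ? ?; apply/andP; split; lra.
Qed.

Lemma normsqD z w : normsq (z + w) <= 2 * normsq z + 2 * normsq w.
Proof.
case: z w => a b [c d]; rewrite /normsq /=.
have := sqr_ge0 (a - c); have := sqr_ge0 (b - d); nra.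
Qed.

Lemma normsqM z w : normsq (z * w) = normsq z * normsq w.
Proof. by case: z w => a b [c d]; rewrite /normsq /=; ring. Qed.

Lemma cmeasurable_rdot d (X : measurableType d) (f g : X -> C) :
  cmeasurable f -> cmeasurable g -> measurable_fun setT (fun x => rdot (f x) (g x)).
Proof. by move=> [? ?] [? ?]; apply: measurable_funD; apply: measurable_funM. Qed.

Lemma cmeasurable_normsq d (X : measurableType d) (f : X -> C) :
  cmeasurable f -> measurable_fun setT (fun x => normsq (f x)).
Proof.
move=> mf; under eq_fun do rewrite -rdotxx; exact: cmeasurable_rdot.
Qed.

Lemma cmeasurableD d (X : measurableType d) (f g : X -> C) :
  cmeasurable f -> cmeasurable g -> cmeasurable (fun x => f x + g x).
Proof.
move=> [mf1 mf2] [mg1 mg2]; split.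
- rewrite (_ : _ \o _ = (fun x => Re (f x) + Re (g x))); first exact: measurable_funD.
  by apply/funext => x /=; case: (f x) (g x) => ? ? [].
- rewrite (_ : _ \o _ = (fun x => Im (f x) + Im (g x))); first exact: measurable_funD.
  by apply/funext => x /=; case: (f x) (g x) => ? ? [].
Qed.

Lemma cmeasurableM d (X : measurableType d) (f g : X -> C) :
  cmeasurable f -> cmeasurable g -> cmeasurable (fun x => f x * g x).
Proof.
move=> [mf1 mf2] [mg1 mg2]; split.
- rewrite (_ : _ \o _ = (fun x => Re (f x) * Re (g x) - Im (f x) * Im (g x))).
    by apply: measurable_funB; apply: measurable_funM.
  by apply/funext => x /=; case: (f x) (g x) => ? ? [].
- rewrite (_ : _ \o _ = (fun x => Re (f x) * Im (g x) + Im (f x) * Re (g x))).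
    by apply: measurable_funD; apply: measurable_funM.
  by apply/funext => x /=; case: (f x) (g x) => ? ? [].
Qed.

Lemma cmeasurableC d (X : measurableType d) (c : C) : cmeasurable (fun _ : X => c).
Proof. by split; exact: measurable_cst. Qed.

Lemma cmeasurable_real d (X : measurableType d) (f : X -> R) :
  measurable_fun setT f -> cmeasurable (fun x => (f x)%:C).
Proof. by move=> mf; split; [exact: mf|exact: measurable_cst]. Qed.

Lemma cmeasurable_cis d (X : measurableType d) (f : X -> R) :
  measurable_fun setT f -> cmeasurable (fun x => cis (f x)).
Proof.
move=> mf; split.
  exact: (measurableT_comp (continuous_measurable_fun (@continuous_cos R)) mf).
exact: (measurableT_comp (continuous_measurable_fun (@continuous_sin R)) mf).
Qed.

Lemma cmeasurable_comp d d' (X : measurableType d) (Y : measurableType d')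
    (f : Y -> C) (g : X -> Y) :
  cmeasurable f -> measurable_fun setT g -> cmeasurable (f \o g).
Proof. by move=> [mf1 mf2] mg; split; [exact: (measurableT_comp mf1)|exact: (measurableT_comp mf2)]. Qed.

Lemma cmeasurable_conj d (X : measurableType d) (f : X -> C) :
  cmeasurable f -> cmeasurable (fun x => (f x)^*%C).
Proof.
move=> [mf1 mf2]; split.
  by rewrite (_ : _ \o _ = Re \o f)//; apply/funext => x /=; case: (f x).
rewrite (_ : _ \o _ = (fun x => - (Im \o f) x)); first exact: measurable_funN.
by apply/funext => x /=; case: (f x).
Qed.

Lemma normsq_cis x : normsq (cis x) = 1.
Proof. by rewrite /normsq /= cos2Dsin2. Qed.

Lemma LfunP2 (u : R3 -> R) : u \in Lfun mu3 2%:E <->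
  measurable_fun setT u /\ mu3.-integrable setT (EFin \o (fun x => u x ^+ 2)).
Proof.
split=> [uL|[mu ui]].
  split; first by move/sub_Lfun_mfun : uL; rewrite inE.
  exact: Lfun2_integrable_sqr.
apply/andP; split; first by rewrite inE.
rewrite inE /= /finite_norm unlock poweR_lty//.
have /integrableP[_] := ui; congr (_ < _)%E; apply: eq_integral => x _ /=.
by rewrite powR_mulrn// real_normK ?num_real// ger0_norm// sqr_ge0.
Qed.

Lemma LC2P (f : R3 -> C) : L2 f <->
  cmeasurable f /\ mu3.-integrable setT (EFin \o (fun x => normsq (f x))).
Proof.
split=> [[/LfunP2[m1 i1] /LfunP2[m2 i2]]|[[m1 m2] fi]].
  split => //; have := integrableD measurableT i1 i2.
  by apply: eq_integrable => // x _.
have mf := cmeasurable_normsq (conj m1 m2).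
split; apply/LfunP2; split => //.
- apply: le_integrable fi => //.
    by apply/measurable_EFinP; exact: measurable_funX.
  move=> x _ /=; rewrite lee_fin !ger0_norm ?normsq_ge0 ?sqr_ge0//.
  by rewrite lerDl sqr_ge0.
- apply: le_integrable fi => //.
    by apply/measurable_EFinP; exact: measurable_funX.
  move=> x _ /=; rewrite lee_fin !ger0_norm ?normsq_ge0 ?sqr_ge0//.
  by rewrite lerDr sqr_ge0.
Qed.

Lemma integrable_rdot f g : L2 f -> L2 g ->
  mu3.-integrable setT (EFin \o (fun x => rdot (f x) (g x))).
Proof.
move=> /LC2P[mf fi] /LC2P[mg gi].
have fgi := integrableD measurableT fi gi.
apply: le_integrable fgi => //.
  exact/measurable_EFinP/cmeasurable_rdot.
move=> x _ /=; rewrite lee_fin [leRHS]ger0_norm; last by rewrite addr_ge0 ?normsq_ge0.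
have := rdot_le (f x) (g x) ltr01; rewrite mul1r divr1 => /le_trans; apply.
have := normsq_ge0 (f x); have := normsq_ge0 (g x); lra.
Qed.

Definition rinner (f g : R3 -> C) : R := complex.Re (inner f g).

Lemma rinnerE f g : rinner f g = \int[mu3]_x rdot (f x) (g x).
Proof. by rewrite /rinner /=; apply: eq_Rintegral => x _; rewrite Re_conjM. Qed.

Definition sqnorm f := \int[mu3]_x normsq (f x).

Lemma rinnerxx f : rinner f f = sqnorm f.
Proof. by rewrite rinnerE; apply: eq_Rintegral => x _; rewrite rdotxx. Qed.

Lemma sqnorm_ge0 f : 0 <= sqnorm f.
Proof. by apply: Rintegral_ge0 => x _; exact: normsq_ge0. Qed.

Lemma rinner_le (s : R) f g : 0 < s -> L2 f -> L2 g ->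
  `|rinner f g| <= (s * sqnorm f + sqnorm g / s) / 2.
Proof.
move=> s0 Lf Lg; rewrite rinnerE.
have [mf fi] := (LC2P f).1 Lf; have [mg gi] := (LC2P g).1 Lg.
have fgi := integrable_rdot Lf Lg.
apply: (le_trans (le_normr_Rintegral measurableT fgi)).
have fi2 := integrableZl measurableT s fi.
have gi2 := integrableZl measurableT s^-1 gi.
have i2 := integrableZl measurableT 2^-1 (integrableD measurableT fi2 gi2).
have -> : (s * sqnorm f + sqnorm g / s) / 2 =
   \int[mu3]_x (2^-1 * (s * normsq (f x) + s^-1 * normsq (g x))).
  rewrite RintegralZl//; last exact: (integrableD measurableT fi2 gi2).
  rewrite RintegralD// !RintegralZl//; rewrite /sqnorm; field; exact: lt0r_neq0.
apply: le_Rintegral => //; first exact: integrable_norm.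
move=> x _; apply: le_trans (rdot_le _ _ s0) _.
by rewrite mulrC [normsq (g x) / s]mulrC.
Qed.

Lemma LC2D f g : L2 f -> L2 g -> L2 (fun x => f x + g x).
Proof.
move=> /LC2P[mf fi] /LC2P[mg gi]; apply/LC2P; split; first exact: cmeasurableD.
have := integrableZl measurableT 2 (integrableD measurableT fi gi).
apply: le_integrable => //; first exact/measurable_EFinP/cmeasurable_normsq/cmeasurableD.
move=> x _ /=; rewrite lee_fin ger0_norm ?normsq_ge0// ger0_norm.
  by rewrite mulrDr; exact: normsqD.
by rewrite mulr_ge0// addr_ge0 ?normsq_ge0.
Qed.

Lemma LC2Z c f : L2 f -> L2 (fun x => c * f x).
Proof.
move=> /LC2P[mf fi]; apply/LC2P; split.
  by apply: cmeasurableM => //; exact: cmeasurableC.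
have := integrableZl measurableT (normsq c) fi.
by apply: eq_integrable => // x _ /=; rewrite normsqM.
Qed.

Lemma LC2B f g : L2 f -> L2 g -> L2 (fun x => f x - g x).
Proof.
move=> Lf Lg; have := LC2D Lf (LC2Z (-1) Lg).
by under eq_fun do rewrite mulN1r.
Qed.

Lemma eq_rinner f g f' g' : L2 f -> L2 g -> L2 f' -> L2 g' ->
  f = f' %[ae mu3] -> g = g' %[ae mu3] -> rinner f g = rinner f' g'.
Proof.
move=> /LC2P[mf _] /LC2P[mg _] /LC2P[mf' _] /LC2P[mg' _] ff' gg'; rewrite !rinnerE.
apply: ae_eq_Rintegral; [exact: cmeasurable_rdot|exact: cmeasurable_rdot|].
by apply: filterS2 ff' gg' => x /= H1 H2 _; rewrite H1// H2.
Qed.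

Lemma rinnerDl f g h : L2 f -> L2 g -> L2 h ->
  rinner (fun x => f x + g x) h = rinner f h + rinner g h.
Proof.
move=> Lf Lg Lh; rewrite !rinnerE -RintegralD//; try exact: integrable_rdot.
apply: eq_Rintegral => x _; rewrite /rdot.
by case: (f x) (g x) => ? ? [? ?] /=; ring.
Qed.

Lemma rinnerDr f g h : L2 f -> L2 g -> L2 h ->
  rinner h (fun x => f x + g x) = rinner h f + rinner h g.
Proof.
move=> Lf Lg Lh; rewrite !rinnerE -RintegralD//; try exact: integrable_rdot.
apply: eq_Rintegral => x _; rewrite /rdot.
by case: (f x) (g x) => ? ? [? ?] /=; ring.
Qed.

Definition quad (A : (R3 -> C) -> R3 -> C) f := rinner f (A f).

Lemma sqnormD f g : L2 f -> L2 g ->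
  sqnorm (fun x => f x + g x) <= 2 * sqnorm f + 2 * sqnorm g.
Proof.
move=> Lf Lg; have [mf fi] := (LC2P f).1 Lf; have [mg gi] := (LC2P g).1 Lg.
have fi2 := integrableZl measurableT 2 fi; have gi2 := integrableZl measurableT 2 gi.
rewrite /sqnorm -!RintegralZl// -RintegralD//.
apply: le_Rintegral => //; first by have [] := (LC2P _).1 (LC2D Lf Lg).
- exact: (integrableD measurableT fi2 gi2).
- by move=> x _; exact: normsqD.
Qed.

Lemma quad_continuous (A : L2op R) f : L2 f -> forall e : R, 0 < e ->
  exists2 d : R, 0 < d & forall g, L2 g ->
    sqnorm (fun x => g x - f x) <= d -> `|quad A g - quad A f| <= e.
Proof.
move=> Lf e e0.
have [AL Aae Alin [K AK]] := L2opP A.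
have AK' h : L2 h -> sqnorm (A h) <= `|K| * sqnorm h.
  move=> Lh; rewrite -!rinnerxx; apply: le_trans (AK _ Lh) _.
  by rewrite ler_wpM2r ?ler_norm// -/(rinner h h) rinnerxx sqnorm_ge0.
pose M : R := sqnorm f; pose K' : R := `|K|.
have M0 : 0 <= M by exact: sqnorm_ge0.
have K0 : 0 <= K' by exact: normr_ge0.
(* With h = g - f the difference of the forms is (h, A g) + (f, A h). The weight [s] makes the terms
   in the norms of A g and f small; [d] is then chosen small against [s] for the terms in h and A
   h. *)
pose s := e / (K' * (2 * M + 2) + M + 1).
have D0 : 0 < K' * (2 * M + 2) + M + 1 by nra.
have s0 : 0 < s by rewrite divr_gt0.
pose d := Num.min 1 (e * s / (1 + K')).
have K1 : 0 < 1 + K' by lra.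
have d0 : 0 < d by rewrite lt_min ltr01; apply: divr_gt0 => //; exact: mulr_gt0.
exists d => // g Lg gd.
pose h := fun x => g x - f x.
have Lh : L2 h by exact: LC2B.
have gE : g = (fun x => h x + f x) by apply/funext => x; rewrite /h subrK.
have AgE : A g = (fun x => A h x + A f x) %[ae mu3].
  have := Alin 1 h f Lh Lf.
  rewrite (_ : (fun p => 1 * h p + f p) = g); last first.
    by rewrite gE; apply/funext => x; rewrite mul1r.
  by apply: filterS => x /= H /H ->; rewrite mul1r.
have LAh := AL _ Lh; have LAf := AL _ Lf; have LAg := AL _ Lg.
have -> : quad A g - quad A f = rinner h (A g) + rinner f (A h).
  have E1 := rinnerDl Lh Lf LAg; rewrite -gE in E1.
  have E2 : rinner f (A g) = rinner f (A h) + rinner f (A f).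
    rewrite -rinnerDr//.
    by apply: (eq_rinner Lf LAg Lf (LC2D LAh LAf) _ AgE); exact: aeW.
  by rewrite /quad E1 E2; ring.
have d1 : d <= 1 by rewrite ge_min lexx.
have ds : d * (1 + K') <= e * s.
  rewrite -ler_pdivlMr; last lra.
  by rewrite ge_min lexx orbT.
have hd : sqnorm h <= d by [].
have gM : sqnorm g <= 2 * M + 2.
  by rewrite gE; apply: le_trans (sqnormD Lh Lf) _; rewrite -/M; clear - hd d1; lra.
have h0 := sqnorm_ge0 h; have g0 := sqnorm_ge0 g.
have is0 : 0 < s^-1 by rewrite invr_gt0.
have b1 := rinner_le is0 Lh LAg.
have b2 := rinner_le s0 Lf LAh.
have b3 := AK' _ Lg; have b4 := AK' _ Lh.
rewrite invrK in b1.
apply: (le_trans (ler_normD _ _)).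
apply: (le_trans (lerD b1 b2)).
have sE : s * (K' * (2 * M + 2) + M) <= e.
  by rewrite /s mulrAC ler_pdivrMr// ler_pM2l// lerDl.
have c1 : s^-1 * sqnorm h + sqnorm (A h) / s <= e.
  rewrite mulrC -mulrDl ler_pdivrMr//; apply: le_trans ds.
  by rewrite mulrDr mulr1 lerD// (le_trans b4)// mulrC ler_wpM2r.
have c2 : sqnorm (A g) * s + s * sqnorm f <= e.
  have b3' : sqnorm (A g) <= K' * (2 * M + 2).
    by apply: le_trans b3 _; rewrite ler_wpM2l.
  have := ler_wpM2l (ltW s0) b3'; move: sE; rewrite -/M mulrDr; clear; lra.
lra.
Qed.


Definition box (M : R) : set R3 :=
  [set x | [/\ `|x.1.1| <= M, `|x.1.2| <= M & `|x.2| <= M]].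

Lemma boxE M : box M = `[- M, M]%classic `*` `[- M, M]%classic `*` `[- M, M]%classic.
Proof.
apply/seteqP; split=> -[[a b] c]; rewrite /box /= !in_itv/= -!ler_norml.
  by case.
by case=> -[].
Qed.

Lemma measurable_box M : measurable (box M).
Proof. by rewrite boxE; apply: measurableX => //; exact: measurableX. Qed.

Lemma mu3_box M : (mu3 (box M) < +oo)%E.
Proof.
pose I : set (measurableTypeR R) := `[- M, M]%classic.
have lfin : (@lebesgue_measure R I < +oo)%E.
  by rewrite lebesgue_measure_itv; case: ifP => _; rewrite ltry.
have mI : measurable I by exact: measurable_itv.
have f2 : (@sigma_finite_mu2 R (I `*` I) < +oo)%E.
  have -> : @sigma_finite_mu2 R (I `*` I) = (@lebesgue_measure R I * @lebesgue_measure R I)%E.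
    exact: (product_measure1E (@lebesgue_measure R) (@lebesgue_measure R) mI mI).
  by apply: lte_mul_pinfty => //; rewrite ge0_fin_numE.
have -> : mu3 (box M) = (@sigma_finite_mu2 R (I `*` I) * @lebesgue_measure R I)%E.
  rewrite boxE.
  exact: (product_measure1E (@sigma_finite_mu2 R) (@lebesgue_measure R) (measurableX mI mI) mI).
by apply: lte_mul_pinfty => //; rewrite ge0_fin_numE.
Qed.

(** Bounded functions of bounded support lie in L^1 and L^2, which the kernel formula demands, and
    make every momentum integral below absolutely convergent. One constant bounds both the squared
    modulus and the support. *)
Definition nice (f : R3 -> C) : Prop := cmeasurable f /\
  exists2 M : R, 0 < M & forall p, normsq (f p) <= M /\ (~ box M p -> f p = 0).

Lemma integrable_scale d (T : measurableType d) (mu : {measure set T -> \bar R})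
    (k : R) (f : T -> R) : mu.-integrable setT (EFin \o f) ->
  mu.-integrable setT (EFin \o (fun x => k * f x)).
Proof. exact: integrableZl. Qed.

Lemma integrable_indic_lty d (T : measurableType d) (mu : {measure set T -> \bar R})
    (A : set T) : measurable A -> (mu A < +oo)%E ->
  mu.-integrable setT (EFin \o (\1_A : T -> R)).
Proof.
move=> mA muA; apply/integrableP; split; first exact/measurable_EFinP.
rewrite (_ : integral _ _ _ = mu A)//.
rewrite -[in RHS](setIT A) -integral_indic//; apply: eq_integral => x _ /=.
by rewrite ger0_norm.
Qed.

Lemma nice_LC2 f : nice f -> L2 f.
Proof.
move=> [mf [M M0 fM]]; apply/LC2P; split => //.
have : mu3.-integrable setT (EFin \o (fun x => M * \1_(box M) x)).
  apply: integrable_scale => //.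
  by apply: integrable_indic_lty; [exact: measurable_box|exact: mu3_box].
apply: le_integrable => //; first exact/measurable_EFinP/cmeasurable_normsq.
move=> x _ /=; rewrite lee_fin !ger0_norm ?normsq_ge0//; last by rewrite mulr_ge0// ltW.
rewrite indicE; case: (pselect (box M x)) => [bx|nbx].
  by rewrite mem_set// mulr1; have [] := fM x.
rewrite memNset// mulr0; have [_ ->//] := fM x.
by rewrite /normsq /= expr0n /= addr0.
Qed.

Lemma nice_LC1 f : nice f -> LC 1%:E f.
Proof.
move=> [mf [M M0 fM]].
have i1 : mu3.-integrable setT (EFin \o (fun x => (1 + M) * \1_(box M) x)).
  apply: integrable_scale => //.
  by apply: integrable_indic_lty; [exact: measurable_box|exact: mu3_box].
have H x (a : R) : a ^+ 2 <= normsq (f x) -> `|a| <= (1 + M) * \1_(box M) x.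
  move=> ha; rewrite indicE; case: (pselect (box M x)) => [bx|nbx].
    rewrite mem_set// mulr1; have [fx _] := fM x.
    have : a ^+ 2 <= M by exact: le_trans fx.
    have : `|a| ^+ 2 = a ^+ 2 by rewrite real_normK ?num_real.
    move=> <- ; have := sqr_ge0 (`|a| - 1); nra.
  rewrite memNset// mulr0; have [_ fx] := fM x.
  move: ha; rewrite fx// /normsq /= expr0n /= addr0 => ha.
  have -> : a = 0 by nra.
  by rewrite normr0.
split; apply/Lfun1_integrable; apply: (le_integrable measurableT _ _ i1);
  rewrite -/(comp _ _).
- by apply/measurable_EFinP; case: mf.
- move=> x _ /=; rewrite lee_fin [leRHS]ger0_norm ?mulr_ge0 ?addr_ge0 ?(ltW M0)//.
  by apply: H; rewrite lerDl sqr_ge0.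
- by apply/measurable_EFinP; case: mf.
- move=> x _ /=; rewrite lee_fin [leRHS]ger0_norm ?mulr_ge0 ?addr_ge0 ?(ltW M0)//.
  by apply: H; rewrite lerDr sqr_ge0.
Qed.

(** Truncate [f] to the points of [box n] where its squared modulus is at most n, and let n grow:
    dominated convergence. *)
Lemma nice_dense f : L2 f -> forall e : R, 0 < e ->
  exists2 g, nice g & sqnorm (fun x => g x - f x) <= e.
Proof.
move=> /LC2P[mf fi] e e0.
pose E (n : nat) : set R3 := box n%:R `&` [set x | normsq (f x) <= n%:R].
have mE n : measurable (E n).
  apply: measurableI; first exact: measurable_box.
  rewrite -[X in measurable X]setTI; apply: measurable_fun_ler => //.
  exact: cmeasurable_normsq.
pose g n x := f x * (\1_(E n) x)%:C.
have mg n : cmeasurable (g n).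
  apply: cmeasurableM => //; apply: cmeasurable_real; exact: measurable_indic.
have gE n x : normsq (g n x - f x) = normsq (f x) * \1_(~` E n) x.
  rewrite /g !indicE in_setC; case: (x \in E n) => /=.
    by rewrite mulr1 subrr mulr0 /normsq /= expr0n /= addr0.
  by rewrite mulr0 sub0r mulr1 /normsq; case: (f x) => ? ?; rewrite /= !sqrrN.
have cvg : (\int[mu3]_x (normsq (g n x - f x))%:E)%E @[n --> \oo] --> (0 : \bar R)%E.
  have [|||||_ _] := @dominated_convergence _ _ _ mu3 setT measurableT
    (fun n x => (normsq (g n x - f x))%:E) (cst 0%E) (fun x => (normsq (f x))%:E).
  - move=> n; apply/measurable_EFinP/cmeasurable_normsq; apply: cmeasurableD => //.
    rewrite (_ : (fun x => - f x) = (fun x => (-1) * f x)); last by apply/funext => x; rewrite mulN1r.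
    by apply: cmeasurableM => //; exact: cmeasurableC.
  - exact: measurable_cst.
  - apply: aeW => x _; apply: cvg_near_cst.
    have [N hN] : exists N : nat, forall n, (N <= n)%N -> E n x.
      pose b := `|x.1.1| + `|x.1.2| + `|x.2| + normsq (f x).
      exists (Num.bound b) => n Nn.
      have bn : b <= n%:R.
        apply: (le_trans (ltW (archi_boundP _))).
          by rewrite /b !addr_ge0// sqr_ge0.
        by rewrite ler_nat.
      have := normr_ge0 x.1.1; have := normr_ge0 x.1.2; have := normr_ge0 x.2.
      have := normsq_ge0 (f x); move: bn; rewrite /b; clear.
      by move=> *; split => /=; [split|]; lra.
    exists N => // n /= Nn; rewrite gE indicE in_setC mem_set ?mulr0//; exact: hN.
  - by [].
  - apply: aeW => x n _; rewrite gE /= lee_fin ger0_norm.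
      rewrite indicE; case: (_ \in _); rewrite ?mulr1 ?mulr0//; exact: normsq_ge0.
    by rewrite mulr_ge0// normsq_ge0.
  by rewrite integral0.
have [N _ hN] : \forall n \near \oo, (\int[mu3]_x (normsq (g n x - f x))%:E < e%:E)%E.
  exact: cvg _ (open_ereal_lt' (e0 : (0%:E < e%:E)%E)).
have g0 (x : R3) : E N x \/ g N x = 0.
  rewrite /g indicE; case: (pselect (E N x)) => [|nE]; [by left|right].
  by rewrite memNset// mulr0.
exists (g N).
  split => //; exists (N%:R + 1) => [|p]; first by rewrite ltr_wpDl.
  split.
    have [[_ /= fN]|->] := g0 p; last first.
      by rewrite /normsq /= expr0n /= addr0 addr_ge0.
    rewrite /g indicE normsqM; case: (_ \in _); rewrite /normsq /= ?expr0n ?expr1n /=.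
      rewrite addr0 mulr1 -/(normsq (f p)); lra.
    by rewrite addr0 mulr0 addr_ge0.
  have [[[b1 b2 b3] _]|//] := g0 p.
  by case; split; [apply: le_trans b1 _|apply: le_trans b2 _|apply: le_trans b3 _]; rewrite lerDl.
have := hN N (leqnn N) => /= lt_e.
rewrite /sqnorm /Rintegral -lee_fin fineK; first exact: ltW.
rewrite ge0_fin_numE; first exact: lt_trans lt_e (ltry _).
by apply: integral_ge0 => x _; rewrite lee_fin normsq_ge0.
Qed.

End operators.

(** * Spacelike hyperplanes, unitarity of W, and regions under generators *)

Section poincare_action.
Context {R : realType}.
Local Notation C := R[i].
Local Notation R3 := (R3 R).
Local Notation R4 := 'cV[R]_4.
Local Notation L2 := (@LC R 2%:E).
Local Notation mu3 := (mu3 R).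

Lemma minkC (a b : R4) : mink a b = mink b a.
Proof. by rewrite /mink; ring. Qed.

Lemma minkDr (a b c : R4) : mink a (b + c) = mink a b + mink a c.
Proof. by rewrite /mink !mxE; ring. Qed.

Lemma minkNr (a b : R4) : mink a (- b) = - mink a b.
Proof. by rewrite /mink !mxE; ring. Qed.

Lemma minkNl (a b : R4) : mink (- a) b = - mink a b.
Proof. by rewrite /mink !mxE; ring. Qed.

Lemma dot3_CS (e d : R3) : dot3 e d ^+ 2 <= dot3 e e * dot3 d d.
Proof.
rewrite /dot3; rewrite -subr_ge0.
have -> : (e.1.1 * e.1.1 + e.1.2 * e.1.2 + e.2 * e.2) * (d.1.1 * d.1.1 + d.1.2 * d.1.2 + d.2 * d.2) - (e.1.1 * d.1.1 + e.1.2 * d.1.2 + e.2 * d.2) ^+ 2 =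
 (e.1.1 * d.1.2 - e.1.2 * d.1.1) ^+ 2 + (e.1.1 * d.2 - e.2 * d.1.1) ^+ 2 + (e.1.2 * d.2 - e.2 * d.1.2) ^+ 2 by ring.
by rewrite !addr_ge0 ?sqr_ge0.
Qed.

Lemma dot3_ge0 (e : R3) : 0 <= dot3 e e.
Proof. rewrite /dot3; nra. Qed.

Lemma dot3_eq0 (e : R3) : dot3 e e = 0 -> e = 0.
Proof.
case: e => [[a b] c]; rewrite /dot3 /= => H.
have [-> [-> ->]] : a = 0 /\ b = 0 /\ c = 0 by split; [|split]; nra.
by [].
Qed.

(** Normal form of a hyperplane as the graph of an affine time function; it is spacelike when the
    slope [e] is shorter than 1, and every spacelike hyperplane arises so. *)
Definition plane (a : R) (e : R3) : set R4 := [set x : R4 | x 0 0 = a + dot3 e (spatial x)].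

Lemma spacelike_plane a e : dot3 e e < 1 -> spacelike_hyperplane (plane a e).
Proof.
move=> e1; split.
  exists (four 1 e), a; split.
    by apply/eqP => /(congr1 (fun v : R4 => v 0 0)) /eqP; rewrite !mxE /= oner_eq0.
  apply/seteqP; split => x; rewrite /plane /mink /dot3 /spatial /= !fourE; lra.
move=> x y; rewrite /plane /= => xs ys xy.
pose d := spatial (x - y).
have d0 : (x - y) 0 0 = dot3 e d.
  by rewrite /d /dot3 /spatial /= !mxE xs ys /dot3 /spatial /=; ring.
have -> : mink (x - y) (x - y) = dot3 e d ^+ 2 - dot3 d d.
  by rewrite -d0 /mink /dot3 /d /spatial /=; ring.
have dpos : 0 < dot3 d d.
  rewrite lt0r dot3_ge0 andbT; apply/eqP => /dot3_eq0 dd0.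
  case/eqP: xy; apply/eqP; rewrite -subr_eq0 -(four_spatial (x - y)) d0 -/d dd0.
  have -> : dot3 e 0 = 0 by rewrite /dot3 /=; ring.
  by apply/eqP/col4P; rewrite !fourE !mxE.
have := dot3_CS e d; nra.
Qed.

(** Let N be the squared length of the spatial part of n. If n were not timelike, d = (N, n_0 n_1,
    n_0 n_2, n_0 n_3) would be a nonzero vector tangent to the hyperplane with mink d d = N (N -
    n_0^2) >= 0. *)
Lemma spacelike_normal (n : R4) tau : n != 0 ->
  (forall x y : R4, mink n x = tau -> mink n y = tau -> x != y ->
     mink (x - y) (x - y) < 0) -> 0 < mink n n.
Proof.
move=> n0 H; rewrite ltNge; apply/negP => nn.
pose N := dot3 (spatial n) (spatial n).
have NE : mink n n = n 0 0 ^+ 2 - N by rewrite /mink /N /dot3 /spatial /=; ring.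
have N0 : 0 < N.
  rewrite lt0r dot3_ge0 andbT; apply/eqP => N0.
  move: nn; rewrite NE N0 => nn; have n00 : n 0 0 = 0 by nra.
  case/eqP: n0; rewrite -(four_spatial n) n00 (dot3_eq0 N0).
  by apply: col4P; rewrite !fourE !mxE.
pose x : R4 := four 0 (- tau / N * n 1 0, - tau / N * n 2 0, - tau / N * n 3 0).
pose d : R4 := four N (n 0 0 * n 1 0, n 0 0 * n 2 0, n 0 0 * n 3 0).
have Nn : N != 0 by exact: lt0r_neq0.
have N2 : N = n 1 0 ^+ 2 + n 2 0 ^+ 2 + n 3 0 ^+ 2 by rewrite /N /dot3 /spatial /=; ring.
have xs : mink n x = tau.
  rewrite /mink /x !fourE /=.
  have -> : n 0 0 * 0 - n 1 0 * (- tau / N * n 1 0) - n 2 0 * (- tau / N * n 2 0) -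
    n 3 0 * (- tau / N * n 3 0) = tau / N * (n 1 0 ^+ 2 + n 2 0 ^+ 2 + n 3 0 ^+ 2) by ring.
  by rewrite -N2 divfK.
have nd : mink n d = 0.
  rewrite /mink /d !fourE /= {1}N2; ring.
have ds : mink n (x + d) = tau by rewrite minkDr xs nd addr0.
have := H _ _ ds xs; rewrite addrAC subrr add0r.
have -> : mink d d = N ^+ 2 - n 0 0 ^+ 2 * N.
  transitivity (N ^+ 2 - n 0 0 ^+ 2 * (n 1 0 ^+ 2 + n 2 0 ^+ 2 + n 3 0 ^+ 2)).
    by rewrite /mink /d !fourE /=; ring.
  by rewrite -N2.
have dn0 : x + d != x.
  rewrite -subr_eq0 addrAC subrr add0r; apply/eqP => /(congr1 (fun v : R4 => v 0 0)).
  by rewrite four0 mxE => /eqP; rewrite (negbTE Nn).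
move=> /(_ dn0); nra.
Qed.

Lemma spacelike_planeP s : spacelike_hyperplane s ->
  exists a e, dot3 e e < 1 /\ s = plane a e.
Proof.
case=> -[n [tau [n0 sE]]] H.
have nn : 0 < mink n n.
  apply: (spacelike_normal n0 (tau := tau)) => x y xs ys.
  by apply: H; rewrite sE.
have n00 : n 0 0 != 0.
  apply/eqP => n00; move: nn; rewrite /mink n00; nra.
have NE : mink n n = n 0 0 ^+ 2 - dot3 (spatial n) (spatial n).
  by rewrite /mink /dot3 /spatial /=; ring.
exists (tau / n 0 0), (n 1 0 / n 0 0, n 2 0 / n 0 0, n 3 0 / n 0 0); split.
  have -> : dot3 (n 1 0 / n 0 0, n 2 0 / n 0 0, n 3 0 / n 0 0)
     (n 1 0 / n 0 0, n 2 0 / n 0 0, n 3 0 / n 0 0) = dot3 (spatial n) (spatial n) / n 0 0 ^+ 2.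
    by rewrite /dot3 /spatial /=; field.
  by rewrite ltr_pdivrMr ?mul1r; [lra|rewrite exprn_even_gt0].
rewrite sE; apply/seteqP; split => x; rewrite /plane /= /mink /dot3 /spatial /=.
  by move=> <-; field.
by move=> ->; field.
Qed.

Lemma plane_inj a e (x y : R4) : plane a e x -> plane a e y ->
  spatial x = spatial y -> x = y.
Proof.
by rewrite /plane /= => xs ys xy; rewrite -(four_spatial x) -(four_spatial y) xs ys xy.
Qed.

Lemma eps_le (p : R3) : [/\ `|p.1.1| <= eps p, `|p.1.2| <= eps p & `|p.2| <= eps p].
Proof.
have e0 := eps_gt0 p; have e2 := sqr_eps p; rewrite /dot3 in e2.
by split; rewrite ler_norml; apply/andP; split; nra.
Qed.

Lemma eps_lact_le (L : 'M[R]_4) : good_lorentz L ->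
  exists2 K : R, 0 < K & forall p, eps (lact L p) <= K * eps p.
Proof.
move=> [[mL _ _] fL _ _]; exists (1 + `|L 0 0| + `|L 0 1| + `|L 0 2| + `|L 0 3|) => [|p].
  by rewrite -!addrA ltr_wpDr// !addr_ge0.
have [p1 p2 p3] := eps_le p; have e0 := eps_gt0 p.
have := onshell_lact p mL fL => /(congr1 (fun v : R4 => v 0 0)).
rewrite four0 mulmx4E !fourE => ->.
have H (x y : R) : `|y| <= eps p -> x * y <= `|x| * eps p.
  move=> ye; apply: le_trans (ler_norm _) _; rewrite normrM.
  by apply: ler_wpM2l => //.
have := H (L 0 1) _ p1; have := H (L 0 2) _ p2; have := H (L 0 3) _ p3.
have := H (L 0 0) (eps p); rewrite gtr0_norm// => /(_ (lexx _)).
rewrite !mulrDl mul1r; lra.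
Qed.

Section generator.
Variables (A A' : 'M[C]_2) (L L' : 'M[R]_4) (a : R4).
Hypothesis gen : generator A A' L L'.

Lemma gen_mulL' : L' *m L = 1%:M. Proof. exact: mulmx1C (gen_mulL gen). Qed.

Lemma gen_mink x y : mink (L *m x) (L *m y) = mink x y.
Proof. by have [[+ _ _] _ _ _] := gen_good gen. Qed.

Lemma gen_mink' x y : mink (L' *m x) (L' *m y) = mink x y.
Proof. by have [[+ _ _] _ _ _] := gen_good' gen. Qed.

Lemma gen_minkl x y : mink (L' *m x) y = mink x (L *m y).
Proof. by rewrite -gen_mink mulmxA (gen_mulL gen) mul1mx. Qed.

Lemma gen_onshell p : onshell (lact L p) = L *m onshell p.
Proof. by have [[? _ _] ? _ _] := gen_good gen; exact: onshell_lact. Qed.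

Lemma gen_onshell' p : onshell (lact L' p) = L' *m onshell p.
Proof. by have [[? _ _] ? _ _] := gen_good' gen; exact: onshell_lact. Qed.

Lemma lactK p : lact L (lact L' p) = p.
Proof.
by rewrite {1}/lact gen_onshell' mulmxA (gen_mulL gen) mul1mx spatial_four.
Qed.

Lemma poincareE x : poincare a A x = a + L *m x.
Proof. by rewrite /poincare (gen_Lambda gen). Qed.

Lemma invmx_eq n (K : comUnitRingType) (B B' : 'M[K]_n) : B *m B' = 1%:M -> invmx B = B'.
Proof.
move=> BB; have [uB _] := mulmx1_unit BB.
by rewrite -[LHS]mulmx1 -BB mulmxA mulVmx// mul1mx.
Qed.

Lemma WE f p : W a A f p = (Num.sqrt (eps (lact L' p) / eps p))%:C *
  cis (mink a (onshell p)) * f (lact L' p).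
Proof. by rewrite /W (gen_Lambda gen) (invmx_eq (gen_mulL gen)). Qed.

Lemma WinvE : Winv a A = W (- (L' *m a)) A'.
Proof.
by rewrite /Winv (invmx_eq (gen_mul gen)) (gen_Lambda' gen).
Qed.

Lemma normsqW f p : normsq (W a A f p) =
  normsq (f (lact L' p)) * (eps (lact L' p) / eps p).
Proof.
rewrite WE !normsqM normsq_cis mulr1 mulrC; congr (_ * _).
by rewrite /normsq /= expr0n /= addr0 sqr_sqrtr// divr_ge0// ltW// eps_gt0.
Qed.

Lemma rdotW f g p : rdot (W a A f p) (W a A g p) =
  rdot (f (lact L' p)) (g (lact L' p)) * (eps (lact L' p) / eps p).
Proof.
rewrite !WE; set r := Num.sqrt _.
have r2 : r ^+ 2 = eps (lact L' p) / eps p.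
  by rewrite sqr_sqrtr// divr_ge0// ltW// eps_gt0.
have := normsq_cis (mink a (onshell p)).
rewrite -r2 /normsq; set z := cis _; case: z => z1 z2 /= zz.
case: (f _) (g _) => u1 u2 [v1 v2]; rewrite /rdot /=.
have z12 : z1 ^+ 2 = 1 - z2 ^+ 2 by rewrite -zz; ring.
by ring: z12.
Qed.

Lemma measurable_lact' : measurable_fun setT (lact L').
Proof. by have [_ _ [+ _ _ _] _] := gen_good' gen. Qed.

Lemma measurable_mink_onshell (b : R4) : measurable_fun setT (fun p : R3 => mink b (onshell p)).
Proof.
have -> : (fun p : R3 => mink b (onshell p)) =
   (fun p => b 0 0 * eps p - b 1 0 * p.1.1 - b 2 0 * p.1.2 - b 3 0 * p.2).
  by apply/funext => p; rewrite /mink !fourE.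
have := @measurable_coord1 R; have := @measurable_coord2 R.
have := @measurable_coord3 R; have := @measurable_eps R => *.
by do ?[apply: measurable_funB|apply: measurable_funM].
Qed.

Lemma cmeasurable_W f : cmeasurable f -> cmeasurable (W a A f).
Proof.
move=> mf; rewrite (_ : W a A f = (fun p => (Num.sqrt (eps (lact L' p) / eps p))%:C *
  cis (mink a (onshell p)) * f (lact L' p))); last by apply/funext => p; rewrite WE.
apply: cmeasurableM; last exact: (cmeasurable_comp mf measurable_lact').
apply: cmeasurableM; last exact: (cmeasurable_cis (measurable_mink_onshell _)).
apply: cmeasurable_real.
apply: (measurableT_comp (continuous_measurable_fun (@sqrt_continuous R))).
apply: measurable_funM; last exact: measurable_eps_inv.
exact: (measurableT_comp (@measurable_eps R) measurable_lact').
Qed.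

Lemma LC2_W f : L2 f -> L2 (W a A f).
Proof.
move=> /LC2P[mf fi]; apply/LC2P; split; first exact: cmeasurable_W.
have [_ _ P _] := gen_good' gen.
have := preserves_integrable P fi; apply: eq_integrable => // p _ /=.
by rewrite normsqW.
Qed.

Lemma rinner_W f g : L2 f -> L2 g -> rinner (W a A f) (W a A g) = rinner f g.
Proof.
move=> /LC2P[mf _] /LC2P[mg _]; rewrite !rinnerE.
have [_ _ P _] := gen_good' gen.
rewrite -(preserves_Rintegral P (cmeasurable_rdot mf mg)).
by apply: eq_Rintegral => p _; rewrite rdotW.
Qed.

End generator.

Lemma box_eps M (p : R3) : 0 <= M -> box M p -> eps p <= 1 + 3 * M.
Proof.
move=> M0 [p1 p2 p3]; have e2 := sqr_eps p; have e0 := eps_gt0 p.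
have H (x : R) : `|x| <= M -> x * x <= M ^+ 2.
  by rewrite ler_norml => /andP[? ?]; nra.
have := H _ p1; have := H _ p2; have := H _ p3; rewrite /dot3 in e2.
nra.
Qed.

Lemma eps_box M (p : R3) : eps p <= M -> box M p.
Proof. by have [p1 p2 p3] := eps_le p => pM; split; apply: le_trans pM. Qed.

Lemma box_le M N (p : R3) : M <= N -> box M p -> box N p.
Proof. by move=> MN [? ? ?]; split; exact: le_trans MN. Qed.

(** A generator changes energies by at most a bounded factor ([eps_lact_le]), so supports stay
    bounded. *)
Lemma nice_W A A' L L' (a : R4) (f : R3 -> C) : generator A A' L L' -> nice f -> nice (W a A f).
Proof.
move=> gen [mf [M M0 fM]]; split; first exact: (cmeasurable_W _ gen).
have [K K0 HK] := eps_lact_le (gen_good gen).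
have [K' K'0 HK'] := eps_lact_le (gen_good' gen).
exists (K' * M + K * (1 + 3 * M)) => [|p].
  by rewrite addr_gt0 ?mulr_gt0//; lra.
split.
  rewrite (normsqW _ gen); have [fp _] := fM (lact L' p).
  have f0 := normsq_ge0 (f (lact L' p)).
  have q : eps (lact L' p) / eps p <= K' by rewrite ler_pdivrMr ?eps_gt0.
  have q0 : 0 < eps (lact L' p) / eps p by rewrite divr_gt0 ?eps_gt0.
  have K3 : 0 <= K * (1 + 3 * M) by rewrite mulr_ge0//; lra.
  apply: le_trans (_ : K' * M <= _); last by rewrite lerDl.
  by rewrite mulrC ler_pM// ltW.
move=> nb; rewrite (WE _ gen); have [_ ->] := fM (lact L' p); first by rewrite mulr0.
move=> bq; apply: nb; apply: eps_box.
rewrite -{1}(lactK gen p).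
apply: le_trans (HK _) _.
apply: le_trans (_ : K * (1 + 3 * M) <= _); last by rewrite lerDr mulr_ge0// ltW.
by rewrite ler_wpM2l ?(ltW K0)//; apply: box_eps => //; exact: ltW.
Qed.

Lemma WK A A' L L' (a : R4) (f : R3 -> C) : generator A A' L L' -> W a A (Winv a A f) = f.
Proof.
move=> gen; apply/funext => p; have gen' := generatorV gen.
rewrite (WE _ gen) (WinvE _ gen) (WE _ gen') (lactK gen).
rewrite (gen_onshell' gen) minkNl (gen_mink' gen).
have e1 := eps_gt0 p; have e2 := eps_gt0 (lact L' p).
have rE : Num.sqrt (eps (lact L' p) / eps p) * Num.sqrt (eps p / eps (lact L' p)) = 1.
  rewrite -sqrtrM ?divr_ge0 ?ltW// -[RHS]sqrtr1; congr Num.sqrt.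
  by field; rewrite !gt_eqF.
have cE x : cis x * cis (- x) = 1 :> C.
  rewrite /cis cosN sinN; simpc; congr (_ +i* _).
    by rewrite -!expr2 cos2Dsin2.
  by ring.
set r1 := Num.sqrt _ in rE *; set r2 := Num.sqrt _ in rE *.
transitivity ((r1 * r2)%:C * (cis (mink a (onshell p)) * cis (- mink a (onshell p))) * f p).
  by rewrite rmorphM /=; ring.
by rewrite rE cE !mul1r.
Qed.

Lemma LC2_Winv A A' L L' (a : R4) (f : R3 -> C) : generator A A' L L' -> L2 f -> L2 (Winv a A f).
Proof.
by move=> gen Lf; rewrite (WinvE _ gen); exact: (LC2_W _ (generatorV gen)).
Qed.

Lemma nice_Winv A A' L L' (a : R4) (f : R3 -> C) : generator A A' L L' -> nice f -> nice (Winv a A f).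
Proof.
by move=> gen Lf; rewrite (WinvE _ gen); exact: (nice_W _ (generatorV gen)).
Qed.

(** Operator covariance in the form used later: unitarity of [W] moves the group element from the
    operator to the state. *)
Lemma quad_op_eq (B D : L2op R) A A' L L' (a : R4) (f : R3 -> C) : generator A A' L L' ->
  op_eq (W a A \o D \o Winv a A) B -> L2 f ->
  quad B f = quad D (Winv a A f).
Proof.
move=> gen E Lf; have Lf' := LC2_Winv a gen Lf.
have [DL _ _ _] := L2opP D; have [BL _ _ _] := L2opP B.
rewrite /quad -(rinner_W a gen Lf' (DL _ Lf')) (WK _ _ gen).
apply: eq_rinner => //; [exact: BL|exact: (LC2_W _ gen (DL _ Lf'))|exact: aeW|].
have := E _ Lf; apply: filterS => x /= H /H ->.
by [].
Qed.

Lemma spacelike_poincare A A' L L' (a : R4) (s : set R4) : generator A A' L L' ->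
  spacelike_hyperplane s -> spacelike_hyperplane (poincare a A @` s).
Proof.
move=> gen [[n [tau [n0 sE]]] H].
have L'L := gen_mulL' gen; have LL' := gen_mulL gen.
split.
  exists (L *m n), (tau + mink (L *m n) a); split.
    apply: contra_neq n0 => Ln0.
    by rewrite -[n]mul1mx -L'L -mulmxA Ln0 mulmx0.
  apply/seteqP; split=> [_ [x sx <-]|y /= ny].
    rewrite (poincareE _ gen) /= minkDr (gen_mink gen) addrC; congr (_ + _).
    by move: sx; rewrite sE.
  exists (L' *m (y - a)).
    rewrite sE /= minkC (gen_minkl gen) minkC minkDr minkNr ny; ring.
  by rewrite (poincareE _ gen) mulmxA LL' mul1mx addrC subrK.
move=> _ _ [x sx <-] [y sy <-] xy.
rewrite !(poincareE _ gen) opprD addrACA subrr add0r -mulmxBr (gen_mink gen).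
by apply: H => //; apply: contra_neq xy => ->.
Qed.

Lemma region_poincare A A' L L' (a : R4) (D : set R4) : generator A A' L L' ->
  region D -> region (poincare a A @` D).
Proof.
move=> gen [s [ss Ds mD]].
have L'L := gen_mulL' gen; have LL' := gen_mulL gen.
have sg := spacelike_poincare a gen ss.
exists (poincare a A @` s); split => //; first exact: image_subset.
have [a1 [e1 [_ sE]]] := spacelike_planeP ss.
have [a2 [e2 [e2lt gE]]] := spacelike_planeP sg.
(* [T] is the inverse Poincare map read in the spatial coordinates of the image plane and of the
   original one, so the projection of the new region is the [T]-preimage of the old projection. *)
pose T y := spatial (L' *m four (a2 + dot3 e2 y) y) + - spatial (L' *m a).
have [J pT] : exists J, preserves T J.
  have [_ _ _ aff] := gen_good' gen; have [J pJ] := aff a2 e2 e2lt.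
  by eexists; apply: preserves_comp (preserves_translation (- spatial (L' *m a))) pJ.
have TE y : T y = spatial (L' *m (four (a2 + dot3 e2 y) y - a)).
  by rewrite /T mulmxBr /spatial !mxE.
have -> : [set spatial y | y in poincare a A @` D] = T @^-1` [set spatial y | y in D]; last first.
  exact: preserves_lebesgue pT mD.
apply/seteqP; split=> [_ [_ [x Dx <-] <-]|y /= [x Dx xy]].
  set z := poincare a A x.
  have : (poincare a A @` s) z by exists x => //; exact: Ds.
  rewrite gE /plane /= => zs; exists x => //; rewrite TE -zs four_spatial.
  by rewrite /z (poincareE _ gen) addrC addKr mulmxA L'L mul1mx.
have : plane a2 e2 (four (a2 + dot3 e2 y) y) by rewrite /plane /= four0 spatial_four.
rewrite -gE => -[x' sx' x'E].
have xx' : x = x'.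
  apply: (@plane_inj a1 e1); rewrite -?sE//; first exact: Ds.
  rewrite xy TE -x'E (poincareE _ gen) [a + _]addrC addrK.
  by rewrite mulmxA L'L mul1mx.
exists (poincare a A x); first by exists x.
by rewrite xx' x'E spatial_four.
Qed.

Lemma roi_poincare A A' L L' (a : R4) (D s : set R4) : generator A A' L L' ->
  region_of_influence (poincare a A @` D) (poincare a A @` s) =
  poincare a A @` region_of_influence D s.
Proof.
move=> gen; have mE x z : mink (poincare a A x - poincare a A z) (poincare a A x - poincare a A z) = mink (x - z) (x - z).
  by rewrite !(poincareE _ gen) opprD addrACA subrr add0r -mulmxBr (gen_mink gen).
apply/seteqP; split=> [_ [[x sx <-] [_ [z Dz <-] xz]]|_ [x [sx [z Dz xz]] <-]].
  by exists x => //; split => //; exists z => //; rewrite -mE.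
by split; [exists x|exists (poincare a A z); [exists z|rewrite mE]].
Qed.

Lemma poincareK A A' L L' (a : R4) (D : set R4) : generator A A' L L' ->
  poincare (- (L' *m a)) A' @` (poincare a A @` D) = D.
Proof.
move=> gen; have K x : poincare (- (L' *m a)) A' (poincare a A x) = x.
  rewrite (poincareE _ gen) (poincareE _ (generatorV gen)) mulmxDr addKr.
  by rewrite mulmxA (gen_mulL' gen) mul1mx.
by apply/seteqP; split=> [_ [_ [x Dx <-] <-]|x Dx]; [rewrite K|exists (poincare a A x); [exists x|]].
Qed.

End poincare_action.

(** * The measure defined by a state *)

Section povm.
Context {R : realType}.
Local Notation C := R[i].
Local Notation R3 := (R3 R).
Local Notation L2 := (@LC R 2%:E).
Variable T : set R3 -> L2op R.
Hypothesis povm : is_POVM T.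

Lemma POVM_measure f : L2 f -> exists nu : {measure set R3 -> \bar R},
  forall D : set R3, measurable D -> nu D = (quad (T D) f)%:E.
Proof.
move=> Lf; have [Tpos _ Tadd] := povm.
have q0 D : measurable D -> 0 <= quad (T D) f.
  by move=> mD; have := Tpos D mD f Lf; rewrite lecE => /andP[].
(* A measure must be nonnegative on all sets, while positivity of [T D] is known for measurable [D]
   only; there the truncation changes nothing. *)
pose m D := (Num.max 0 (quad (T D) f))%:E.
have mE D : measurable D -> m D = (quad (T D) f)%:E.
  by move=> mD; rewrite /m max_r// q0.
have madd : semi_sigma_additive m.
  move=> F mF tF mUF; have := Tadd f Lf F mF tF mUF.
  rewrite mE// [X in _ -> X @ _ --> _](_ : _ =
    (fun n => \sum_(0 <= i < n) (complex.Re (inner f (T (F i) f)))%:E)%E)//.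
  by apply/funext => n; apply: eq_bigr => i _; rewrite mE.
have m_ge0 D : (0 <= m D)%E by rewrite lee_fin le_max lexx.
have m0 : m set0 = 0%E.
  have tF : trivIset setT (fun _ : nat => (set0 : set R3)) by move=> i j _ _ [x []].
  have := madd (fun=> set0) (fun=> measurable0) tF.
  rewrite bigcup0//.
  move=> /(_ measurable0) H.
  have [x xE] : exists x : R, m set0 = x%:E by eexists.
  (* Additivity over empty sets says that the partial sums of the constant x converge to x. Shifting
     the index by one adds x to the limit, so x = x + x. *)
  rewrite xE in H *; pose S n := (\sum_(0 <= i < n) x%:E)%E.
  have H1 : S n.+1 @[n --> \oo] --> x%:E by rewrite (cvg_shiftS S).
  have H2 : (S n + x%:E)%E @[n --> \oo] --> (x%:E + x%:E)%E.
    by apply: cvgeD => //; exact: cvg_cst.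
  have E : (fun n => S n.+1) = (fun n => S n + x%:E)%E.
    by apply/funext => n; rewrite /S big_nat_recr.
  rewrite E in H1; have : x%:E = (x%:E + x%:E)%E :> \bar R.
    by apply: etrans (esym (cvg_lim _ H1)) (cvg_lim _ H2).
  by rewrite -EFinD => -[xx]; congr EFin; lra.
pose mix := isMeasure.Build _ _ _ m m0 m_ge0 madd.
pose nu : {measure set R3 -> \bar R} := HB.pack m mix.
by exists nu.
Qed.

End povm.

(** * A bounded measurable current kernel, valid off a null set of momenta *)

Section current_kernel.
Context {R : realType}.
Local Notation C := R[i].
Local Notation R3 := (R3 R).
Local Notation R4 := 'cV[R]_4.
Local Notation mu3 := (mu3 R).
Variable t : R3 -> R3 -> C.

(** Positivity at the points k, p with coefficients 1 and z, for z = 1, -1, i, -i, shows that t p k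
    is the conjugate of t k p and bounds its real and imaginary parts by 1 in absolute value, whence
    the constant 2. *)
Lemma positive_definite_bound k p : positive_definite t ->
  (forall q, q != 0 -> t q q = 1) -> k != 0 -> p != 0 -> normsq (t k p) <= 2.
Proof.
move=> pd t1 k0 p0.
have H (z : C) : 0 <= 1 + z * t k p + (z^*%C * t p k + z^*%C * z).
  have := pd 2%N (fun i => if i == 0 then 1 else z) (fun i => if i == 0 then k else p).
  rewrite !big_ord_recl !big_ord0 /= !t1// !addr0 !mulr1.
  rewrite (_ : 1 -i* 0 = 1 :> C); last by rewrite oppr0.
  by rewrite !mul1r; apply=> i; case: ifP.
have := H 1; have := H (-1); have := H 'i%C; have := H (- 'i%C).
case: (t k p) (t p k) => a b [c d]; rewrite !lecE /normsq /=.
do 4 (move=> /andP[/eqP ? ?]).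
nra.
Qed.

Lemma measurable_set1_R3 (q : R3) : measurable [set q].
Proof.
case: q => [[a b] c].
rewrite (_ : [set _] = [set a] `*` [set b] `*` [set c]).
  by apply: measurableX => //; exact: measurableX.
by apply/seteqP; split => [_ -> //|[[x y] z] [[/= -> ->] ->]].
Qed.

Lemma negligible_set1_R3 (q : R3) : mu3.-negligible [set q].
Proof.
exists [set q]; split => //; first exact: measurable_set1_R3.
case: q => [[a b] c].
rewrite (_ : [set _] = [set a] `*` [set b] `*` [set c]); last first.
  by apply/seteqP; split => [_ -> //|[[x y] z] [[/= -> ->] ->]].
have ma : measurable ([set a] : set (measurableTypeR R)) by exact: measurable_set1.
have mb : measurable ([set b] : set (measurableTypeR R)) by exact: measurable_set1.
have mc : measurable ([set c] : set (measurableTypeR R)) by exact: measurable_set1.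
transitivity (@sigma_finite_mu2 R ([set a] `*` [set b]) * @lebesgue_measure R [set c])%E.
  exact: (product_measure1E (@sigma_finite_mu2 R) (@lebesgue_measure R) (measurableX ma mb) mc).
by rewrite [X in (_ * X)%E](lebesgue_measure_set1 c) mule0.
Qed.

(** The values of [t] at momentum 0 are arbitrary; resetting them to 0 gives a kernel measurable on
    the whole product. *)
Definition punctured (k p : R3) : C := if (k != 0) && (p != 0) then t k p else 0.

Lemma cmeasurable_punctured : kernel_measurable t ->
  cmeasurable (fun z : R3 * R3 => punctured z.1 z.2).
Proof.
move=> [m1 m2]; set D := [set kp : R3 * R3 | kp.1 != 0 /\ kp.2 != 0] in m1 m2 *.
have mD : measurable D.
  rewrite (_ : D = (~` [set 0]) `*` (~` [set 0])).
    by apply: measurableX; apply: measurableC; exact: measurable_set1_R3.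
  by apply/seteqP; split => -[k p] /= [/eqP ? /eqP ?].
have pE z : punctured z.1 z.2 = if z \in D then t z.1 z.2 else 0.
  rewrite /punctured; case: ifPn => [/andP[k0 p0]|kp]; first by rewrite mem_set.
  by rewrite memNset// => -[k0 p0]; move: kp; rewrite k0 p0.
split.
- move/(measurable_restrictT _ mD) : m1; congr measurable_fun; apply/funext => z.
  by rewrite /= pE /patch; case: ifP.
- move/(measurable_restrictT _ mD) : m2; congr measurable_fun; apply/funext => z.
  by rewrite /= pE /patch; case: ifP.
Qed.

(** The growth of sqrt(eps k eps p) times a bounded kernel, as expected of the components of [v];
    the class is stable under pullback by Lorentz generators. *)
Definition regular (u : R3 -> R3 -> C) : Prop :=
  cmeasurable (fun z : R3 * R3 => u z.1 z.2) /\
  exists2 K, 0 <= K & forall k p, normsq (u k p) <= K * (eps k * eps p).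

Lemma regular_lact L u : good_lorentz L -> regular u ->
  regular (fun k p => u (lact L k) (lact L p)).
Proof.
move=> gL [mu [K K0 uK]].
have [_ _ [mL _ _ _] _] := gL; split.
  apply: (cmeasurable_comp (g := fun z : R3 * R3 => (lact L z.1, lact L z.2)) mu).
  by apply: measurable_fun_pair; apply: (measurableT_comp mL).
have [[minkL _ _] fL _ _] := gL.
have [M M0 LM] : exists2 K : R, 0 < K & forall p, eps (lact L p) <= K * eps p.
  exact: eps_lact_le gL.
exists (K * (M * M)) => [|k p]; first by rewrite !mulr_ge0// ltW.
apply: le_trans (uK _ _) _; rewrite -mulrA; apply: ler_wpM2l => //.
rewrite mulrACA; apply: ler_pM => //; exact: ltW (eps_gt0 _).
Qed.

Lemma regularD u w : regular u -> regular w -> regular (fun k p => u k p + w k p).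
Proof.
move=> [mu [K K0 uK]] [mw [M M0 wM]]; split; first exact: cmeasurableD.
exists (2 * K + 2 * M) => [|k p]; first by rewrite addr_ge0// mulr_ge0.
apply: le_trans (normsqD _ _) _; have := uK k p; have := wM k p; lra.
Qed.

Lemma regularZ c u : regular u -> regular (fun k p => c * u k p).
Proof.
move=> [mu [K K0 uK]]; split.
  by apply: cmeasurableM => //; exact: cmeasurableC.
exists (normsq c * K) => [|k p]; first by rewrite mulr_ge0// normsq_ge0.
by rewrite normsqM -mulrA ler_wpM2l ?normsq_ge0.
Qed.

Lemma mulmx_toC (L : 'M[R]_4) (v : 'cV[C]_4) i : (toC L *m v) i 0 =
  (L i 0)%:C * v 0 0 + (L i 1)%:C * v 1 0 + (L i 2)%:C * v 2 0 + (L i 3)%:C * v 3 0.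
Proof. by rewrite mulmx4E !mxE. Qed.

Lemma exists_current : kernel_measurable t -> positive_definite t ->
  (forall q, q != 0 -> t q q = 1) -> conserved_covariant t ->
  exists (good : set R3) (V : R3 -> R3 -> 'cV[C]_4),
    [/\ mu3.-negligible (~` good),
        forall i, cmeasurable (fun z : R3 * R3 => V z.1 z.2 i 0),
        exists K, forall i k p, normsq (V k p i 0) <= K,
        forall k p, good k -> good p ->
          V k p 0 0 = t k p /\ mink (toC (onshell k - onshell p)) (V k p) = 0
      & forall L k p, proper_orthochronous L ->
          good k -> good p -> good (lact L k) -> good (lact L p) ->
          V (lact L k) (lact L p) =
          (Num.sqrt (eps k * eps p) / Num.sqrt (eps (lact L k) * eps (lact L p)))%:C
            *: (toC L *m V k p)].
Proof.
move=> mt pd t1 [v [v0 vcons vcov]].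
pose h : R := Num.sqrt 2^-1.
have h2 : h ^+ 2 = 2^-1 by rewrite sqr_sqrtr.
have hh : h ^+ 2 + h ^+ 2 = 1 by rewrite h2; field.
have h0 : 0 < h by rewrite sqrtr_gt0.
pose B := Boostz (2 : R); pose Y := Roty h h; pose Z := Rotz h h.
have gB : good_lorentz B by apply: good_Boostz.
have gY : good_lorentz Y by exact: good_Roty.
have gZ : good_lorentz Z by exact: good_Rotz.
pose e k p : C := (Num.sqrt (eps k * eps p))%:C.
pose u0 k p := e k p * punctured k p.
have ru0 : regular u0.
  split.
    apply: cmeasurableM; last exact: cmeasurable_punctured.
    apply: cmeasurable_real.
    apply: (measurableT_comp (continuous_measurable_fun (@sqrt_continuous R))).
    by apply: measurable_funM; apply: (measurableT_comp (@measurable_eps R)).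
  exists 2 => // k p; rewrite /u0 normsqM {1}/normsq /= expr0n /= addr0.
  have ee : 0 <= eps k * eps p by rewrite mulr_ge0// ltW// eps_gt0.
  rewrite sqr_sqrtr// mulrC ler_wpM2r//.
  rewrite /punctured; case: ifPn => [/andP[k0 p0]|_]; first exact: positive_definite_bound.
  by rewrite /normsq /= expr0n /= addr0.
(* For r = 2 the boost has hyperbolic cosine 17/8 and sine 15/8: v_0 at the boosted momenta is 17/8
   v_0 + 15/8 v_3, solved here for v_3. *)
pose u3 k p := (15 / 8)^-1%:C * (u0 (lact B k) (lact B p) + (- (17 / 8))%:C * u0 k p).
have ru3 : regular u3.
  apply: regularZ; apply: regularD; first exact: regular_lact.
  exact: regularZ.
(* As h^2 = 1/2, [Y] and [Z] are quarter turns: [Y] sends the first component to minus the third,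
   and [Z] the second to minus the first. *)
pose u1 k p := (-1) * u3 (lact Y k) (lact Y p).
have ru1 : regular u1 by apply: regularZ; exact: regular_lact.
pose u2 k p := (-1) * u1 (lact Z k) (lact Z p).
have ru2 : regular u2 by apply: regularZ; exact: regular_lact.
pose V k p : 'cV[C]_4 := (e k p)^-1 *: \col_(i < 4) nth 0 [:: u0 k p; u1 k p; u2 k p; u3 k p] i.
have VE : [/\ forall k p, V k p 0 0 = (e k p)^-1 * u0 k p,
   forall k p, V k p 1 0 = (e k p)^-1 * u1 k p,
   forall k p, V k p 2 0 = (e k p)^-1 * u2 k p
   & forall k p, V k p 3 0 = (e k p)^-1 * u3 k p].
  by split => k p; rewrite !mxE.
pose nz (f : R3 -> R3) : set R3 := [set k | f k != 0].
pose l L : R3 -> R3 := lact L.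
(* All momenta visited by the construction must avoid 0, where covariance says nothing. Each
   condition excludes the preimage of a point under Lorentz maps, a null set. *)
pose good : set R3 := nz id `&` nz (l B) `&` nz (l Y) `&` nz (l B \o l Y) `&` nz (l Z)
  `&` nz (l Y \o l Z) `&` nz (l B \o l Y \o l Z).
have e0 k p : e k p != 0.
  by rewrite /e eq_complex /= eqxx andbT gt_eqF// sqrtr_gt0 mulr_gt0// eps_gt0.
have poB : proper_orthochronous B by case: gB.
have poY : proper_orthochronous Y by case: gY.
have poZ : proper_orthochronous Z by case: gZ.
have E0 k p : k != 0 -> p != 0 -> u0 k p = v k p 0 0.
  by move=> k0 p0; rewrite v0// /u0 /punctured k0 p0.
have E3 k p : k != 0 -> p != 0 -> l B k != 0 -> l B p != 0 -> u3 k p = v k p 3 0.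
  move=> k0 p0 Bk Bp.
  have := vcov B k p poB k0 p0 Bk Bp => /(congr1 (fun w : 'cV_4 => w 0 0)).
  rewrite mulmx_toC !mxE /= => H.
  rewrite /u3 !E0//= -H.
  have -> : ((2 : R) ^+ 2 + 2 ^- 2) / 2 = 17 / 8 by field.
  have -> : ((2 : R) ^+ 2 - 2 ^- 2) / 2 = 15 / 8 by field.
  case: (v k p 0 0) (v k p 3 0) (v k p 1 0) (v k p 2 0) => a a' [b b'] [c c'] [d d'].
  by simpc; congr (_ +i* _); field.
have E1 k p : k != 0 -> p != 0 -> l Y k != 0 -> l Y p != 0 ->
    l B (l Y k) != 0 -> l B (l Y p) != 0 -> u1 k p = v k p 1 0.
  move=> k0 p0 Yk Yp BYk BYp.
  have := vcov Y k p poY k0 p0 Yk Yp => /(congr1 (fun w : 'cV_4 => w 3 0)).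
  rewrite mulmx_toC !mxE /= => H.
  rewrite /u1 E3//= -H.
  have -> : h ^+ 2 - h ^+ 2 = 0 by rewrite subrr.
  have -> : 2 * h * h = 1 by rewrite -mulrA -expr2 h2; field.
  case: (v k p 0 0) (v k p 3 0) (v k p 1 0) (v k p 2 0) => a a' [b b'] [c c'] [d d'].
  by simpc; congr (_ +i* _); ring.
have E2 k p : good k -> good p -> u2 k p = v k p 2 0.
  move=> [[[[[[k0 k1] k2] k3] k4] k5] k6] [[[[[[p0 p1] p2] p3] p4] p5] p6].
  have := vcov Z k p poZ k0 p0 k4 p4 => /(congr1 (fun w : 'cV_4 => w 1 0)).
  rewrite mulmx_toC !mxE /= => H.
  rewrite /u2 E1//= -H.
  have -> : h ^+ 2 - h ^+ 2 = 0 by rewrite subrr.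
  have -> : 2 * h * h = 1 by rewrite -mulrA -expr2 h2; field.
  case: (v k p 0 0) (v k p 3 0) (v k p 1 0) (v k p 2 0) => a a' [b b'] [c c'] [d d'].
  by simpc; congr (_ +i* _); ring.
have vV k p : good k -> good p -> v k p = e k p *: V k p.
  move=> gk gp; have := E2 _ _ gk gp; case: VE => V0 V1 V2 V3.
  case: gk gp => [[[[[[k0 k1] k2] k3] k4] k5] k6] [[[[[[p0 p1] p2] p3] p4] p5] p6] E2'.
  apply: col4P; rewrite ![(_ *: V k p) _ _]mxE V0 V1 V2 V3 E0// E1// E2' E3//.
  by split; rewrite mulrA divff// mul1r.
exists good, V; split.
- rewrite /good !setCI.
  have N0 L (f : R3 -> R3) : good_lorentz L -> mu3.-negligible (~` nz f) ->
      mu3.-negligible (~` nz (f \o l L)).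
    by move=> [_ _ PL _] nf; exact: (preserves_negligible PL nf).
  have Nid : mu3.-negligible (~` nz id).
    rewrite (_ : ~` _ = [set 0]); first exact: negligible_set1_R3.
    by apply/seteqP; split => x /=; [move/negP; rewrite negbK => /eqP|move=> ->; apply/negP; rewrite negbK].
  have NB : mu3.-negligible (~` nz (l B)) by exact: (N0 B id).
  have NY : mu3.-negligible (~` nz (l Y)) by exact: (N0 Y id).
  have NZ : mu3.-negligible (~` nz (l Z)) by exact: (N0 Z id).
  have NBY : mu3.-negligible (~` nz (l B \o l Y)) by exact: N0.
  have NYZ : mu3.-negligible (~` nz (l Y \o l Z)) by exact: N0.
  have NBYZ : mu3.-negligible (~` nz (l B \o l Y \o l Z)) by exact: (N0 Z (l B \o l Y)).
  by do ?apply: negligibleU.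
- have me : cmeasurable (fun z : R3 * R3 => (e z.1 z.2)^-1).
    rewrite (_ : (fun z => _) = (fun z : R3 * R3 => (Num.sqrt ((eps z.1)^-1 * (eps z.2)^-1))%:C)).
      apply: cmeasurable_real.
      apply: (measurableT_comp (continuous_measurable_fun (@sqrt_continuous R))).
      by apply: measurable_funM; apply: (measurableT_comp (@measurable_eps_inv R)).
    by apply/funext => z; rewrite /e -fmorphV /= -invfM sqrtrV// mulr_ge0// ltW// eps_gt0.
  case: VE => V0 V1 V2 V3.
  apply: ord4_cases.
  + by under eq_fun do rewrite V0; apply: cmeasurableM => //; case: ru0.
  + by under eq_fun do rewrite V1; apply: cmeasurableM => //; case: ru1.
  + by under eq_fun do rewrite V2; apply: cmeasurableM => //; case: ru2.
  + by under eq_fun do rewrite V3; apply: cmeasurableM => //; case: ru3.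
- have bnd u K k p : normsq (u k p) <= K * (eps k * eps p) -> normsq ((e k p)^-1 * u k p) <= K.
    have ee : 0 < eps k * eps p by rewrite mulr_gt0// eps_gt0.
    move=> uK; rewrite normsqM /e -fmorphV {1}/normsq /= expr0n /= addr0.
    by rewrite exprVn sqr_sqrtr ?(ltW ee)// mulrC ler_pdivrMr.
  case: VE => V0 V1 V2 V3.
  have [_ [K0 K00 uK0]] := ru0; have [_ [K1 K10 uK1]] := ru1.
  have [_ [K2 K20 uK2]] := ru2; have [_ [K3 K30 uK3]] := ru3.
  exists (K0 + K1 + K2 + K3); apply: ord4_cases => k p.
  + by rewrite V0; apply: le_trans (bnd _ _ _ _ (uK0 k p)) _; lra.
  + by rewrite V1; apply: le_trans (bnd _ _ _ _ (uK1 k p)) _; lra.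
  + by rewrite V2; apply: le_trans (bnd _ _ _ _ (uK2 k p)) _; lra.
  + by rewrite V3; apply: le_trans (bnd _ _ _ _ (uK3 k p)) _; lra.
- move=> k p gk gp; have vVkp := vV _ _ gk gp.
  have k0 : k != 0 by case: gk => [[[[[[? _] _] _] _] _] _].
  have p0 : p != 0 by case: gp => [[[[[[? _] _] _] _] _] _].
  split.
    have [-> _ _ _] := VE; rewrite /u0 mulrA mulVf// mul1r.
    by rewrite /punctured k0 p0.
  have := vcons k p k0 p0; rewrite vVkp.
  have -> : mink (toC (onshell k - onshell p)) (e k p *: V k p) =
      e k p * mink (toC (onshell k - onshell p)) (V k p).
    by rewrite /mink ![(_ *: V k p) _ _]mxE; ring.
  by move=> /eqP; rewrite mulf_eq0 (negbTE (e0 _ _)) => /eqP.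
- move=> L k p poL gk gp gLk gLp.
  have nz0 q : good q -> q != 0 by case=> [[[[[[? _] _] _] _] _] _].
  have := vcov L k p poL (nz0 _ gk) (nz0 _ gp) (nz0 _ gLk) (nz0 _ gLp).
  rewrite (vV _ _ gk gp) (vV _ _ gLk gLp) => H.
  rewrite -[LHS]scale1r -(mulVf (e0 (lact L k) (lact L p))) -scalerA -H.
  rewrite -scalemxAr scalerA; congr (_ *: _).
  by rewrite /e rmorphM /= fmorphV mulrC.
Qed.

End current_kernel.

(** * Fubini and change of variables for real integrals on products *)

Section product_lemmas.
Context {R : realType}.
Local Notation R3 := (R3 R).
Local Notation mu3 := (mu3 R).

Definition mu6 : {sigma_finite_measure set (R3 * R3)%type -> \bar R} :=
  sigma_finite_product (@sigma_finite_mu3 R) (@sigma_finite_mu3 R).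

(** For almost every x the inner extended integral is finite, and there [fine] loses nothing. *)
Lemma Rintegral_product d1 d2 (X : measurableType d1) (Y : measurableType d2)
    (m1 : {sigma_finite_measure set X -> \bar R})
    (m2 : {sigma_finite_measure set Y -> \bar R}) (f : X * Y -> R) :
  (sigma_finite_product m1 m2).-integrable setT (EFin \o f) ->
  \int[sigma_finite_product m1 m2]_z f z = \int[m1]_x \int[m2]_y f (x, y).
Proof.
move=> fi; rewrite /Rintegral; congr fine.
have := integral12_prod_meas1 fi; rewrite -/(sigma_finite_product m1 m2) => <-.
apply: ae_eq_integral => //.
- exact: measurable_fubini_F fi.
- apply/measurable_EFinP.
  apply: (measurableT_comp (fine_measurable measurableT)).
  exact: measurable_fubini_F fi.
- have := ae_integrable1 fi; apply: filterS => x ix _.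
  by rewrite /fubini_F fineK//; exact: integrable_fin_num.
Qed.

Lemma Rintegral_product2 d1 d2 (X : measurableType d1) (Y : measurableType d2)
    (m1 : {sigma_finite_measure set X -> \bar R})
    (m2 : {sigma_finite_measure set Y -> \bar R}) (f : X * Y -> R) :
  (sigma_finite_product m1 m2).-integrable setT (EFin \o f) ->
  \int[sigma_finite_product m1 m2]_z f z = \int[m2]_y \int[m1]_x f (x, y).
Proof.
move=> fi; rewrite /Rintegral; congr fine.
have := integral21_prod_meas1 fi; rewrite -/(sigma_finite_product m1 m2) => <-.
apply: ae_eq_integral => //.
- exact: measurable_fubini_G fi.
- apply/measurable_EFinP.
  apply: (measurableT_comp (fine_measurable measurableT)).
  exact: measurable_fubini_G fi.
- have := ae_integrable2 fi; apply: filterS => x ix _.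
  by rewrite /fubini_G fineK//; exact: integrable_fin_num.
Qed.

Lemma measurable_Rintegral d1 d2 (X : measurableType d1) (Y : measurableType d2)
    (m2 : {sigma_finite_measure set Y -> \bar R}) (f : X * Y -> R) :
  measurable_fun setT f ->
  measurable_fun setT (fun x => \int[m2]_y f (x, y)).
Proof.
move=> mf; apply: (measurableT_comp (fine_measurable measurableT)).
have mE : measurable_fun setT (EFin \o f) by exact/measurable_EFinP.
rewrite (_ : (fun x => _) = (fun x => (\int[m2]_y ((EFin \o f)^\+ (x, y)) -
    \int[m2]_y ((EFin \o f)^\- (x, y)))%E)).
  apply: emeasurable_funB.
    exact: (@measurable_fun_fubini_tonelli_F _ _ _ _ _ m2 _ (measurable_funepos mE)
      (fun _ => funepos_ge0 _ _)).
  exact: (@measurable_fun_fubini_tonelli_F _ _ _ _ _ m2 _ (measurable_funeneg mE)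
      (fun _ => funeneg_ge0 _ _)).
apply/funext => x; rewrite [LHS]integralE; congr (_ - _)%E;
  by apply: eq_integral => y _; rewrite ?funeposE ?funenegE.
Qed.

Lemma integrable_add d (X : measurableType d) (m : {measure set X -> \bar R})
    (u v : X -> R) : m.-integrable setT (EFin \o u) -> m.-integrable setT (EFin \o v) ->
  m.-integrable setT (EFin \o (fun z => u z + v z)).
Proof.
move=> iu iv; rewrite (_ : _ \o _ = ((EFin \o u) \+ (EFin \o v))%E)//.
exact: integrableD.
Qed.

Lemma bounded_integrable d (X : measurableType d) (m : {measure set X -> \bar R})
    (f : X -> R) (A : set X) (M : R) : measurable_fun setT f -> measurable A ->
  (m A < +oo)%E -> (forall x, `|f x| <= M * \1_A x) ->
  m.-integrable setT (EFin \o f).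
Proof.
move=> mf mA mAoo fM.
have i1 := integrable_scale M (integrable_indic_lty mA mAoo).
apply: le_integrable i1 => //; first exact/measurable_EFinP.
by move=> x _ /=; rewrite lee_fin; apply: le_trans (fM x) (ler_norm _).
Qed.

Lemma preserves_product T J (g : R3 * R3 -> R) : preserves T J ->
  measurable_fun setT g ->
  \int[mu6]_z (g (T z.1, T z.2) * (J z.1 * J z.2)) = \int[mu6]_z g z.
Proof.
move=> [mT mJ J0 P] mg.
have J0' (z : R3 * R3) : 0 < J z.1 * J z.2 by rewrite mulr_gt0.
have mTT : measurable_fun setT (fun z : R3 * R3 => (T z.1, T z.2)).
  by apply: measurable_fun_pair; apply: (measurableT_comp mT).
have mJJ : measurable_fun setT (fun z : R3 * R3 => J z.1 * J z.2).
  by apply: measurable_funM; apply: (measurableT_comp mJ).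
rewrite /Rintegral; congr fine.
have mg' : measurable_fun setT (EFin \o g) by exact/measurable_EFinP.
rewrite -(weighted_integral_comp J0' (T := fun z => (T z.1, T z.2)) _ mg').
  by apply: eq_integral => z _; rewrite EFinM.
move=> f mf f0.
have mfTJ : measurable_fun setT (fun z : R3 * R3 => f (T z.1, T z.2) * (J z.1 * J z.2)%:E)%E.
  by apply: emeasurable_funM; [exact: (measurableT_comp mf)|exact/measurable_EFinP].
have fTJ0 (z : R3 * R3) : (0 <= f (T z.1, T z.2) * (J z.1 * J z.2)%:E)%E.
  by rewrite mule_ge0// lee_fin ltW.
have -> := @fubini_tonelli1 _ _ _ _ R (@sigma_finite_mu3 R) (@sigma_finite_mu3 R) _ mfTJ fTJ0.
have -> := @fubini_tonelli1 _ _ _ _ R (@sigma_finite_mu3 R) (@sigma_finite_mu3 R) _ mf f0.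
rewrite /fubini_F.
pose h (p : R3) := (\int[mu3]_k f (p, k))%E.
have mh : measurable_fun setT h.
  exact: (@measurable_fun_fubini_tonelli_F _ _ _ _ _ (@sigma_finite_mu3 R) f mf f0).
have h0 p : (0 <= h p)%E by exact: integral_ge0.
transitivity (\int[mu3]_p (h (T p) * (J p)%:E))%E; last exact: P.
apply: eq_integral => p _ /=.
have mfp : measurable_fun setT (fun k => f (T p, k)) by exact: measurable_fun_pair2.
rewrite /h -(P _ mfp)// muleC -ge0_integralZl//.
- apply: eq_integral => k _ /=. by rewrite EFinM muleCA.
- apply: emeasurable_funM; last exact/measurable_EFinP.
  exact: (measurableT_comp mfp).
- by move=> k _; rewrite mule_ge0// lee_fin ltW.
- by rewrite lee_fin ltW.
Qed.

Lemma negligible_product (N : set R3) : mu3.-negligible N ->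
  mu6.-negligible [set z | N z.1 \/ N z.2].
Proof.
move=> [A [mA A0 NA]].
have e1 : mu6 (A `*` setT) = (mu3 A * mu3 setT)%E.
  exact: (product_measure1E (@sigma_finite_mu3 R) (@sigma_finite_mu3 R) mA measurableT).
have e2 : mu6 (setT `*` A) = (mu3 setT * mu3 A)%E.
  exact: (product_measure1E (@sigma_finite_mu3 R) (@sigma_finite_mu3 R) measurableT mA).
rewrite A0 mul0e in e1; rewrite A0 mule0 in e2.
have m1 : measurable (A `*` [set: R3]) by exact: measurableX.
have m2 : measurable ([set: R3] `*` A) by exact: measurableX.
have n1 : mu6.-negligible (A `*` [set: R3]) := ex_intro _ _ (And3 m1 e1 (@subset_refl _ _)).
have n2 : mu6.-negligible ([set: R3] `*` A) := ex_intro _ _ (And3 m2 e2 (@subset_refl _ _)).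
apply: (negligibleS _ (negligibleU n1 n2)).
by move=> z [Nz|Nz]; [left|right]; split => //=; exact: NA.
Qed.

(** Meant for the integrands of the kernel formula, whose values at zero momentum are arbitrary; on
    a singleton every function is measurable. *)
Lemma measurable_fun_off_point (f g : R3 -> R) (q : R3) : measurable_fun setT g ->
  (forall x, x != q -> f x = g x) -> measurable_fun setT f.
Proof.
move=> mg fg; have -> : [set: R3] = [set q] `|` (~` [set q]).
  by rewrite setUv.
apply/measurable_funU; [exact: measurable_set1_R3|apply: measurableC; exact: measurable_set1_R3|].
split.
  move=> _ Y mY; case: (pselect (Y (f q))) => Yq.
    rewrite (_ : _ `&` _ = [set q]); first exact: measurable_set1_R3.
    by apply/seteqP; split => [x [->]|x ->].
  by rewrite (_ : _ `&` _ = set0)//; apply/seteqP; split => [x [-> /= ]|].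
apply: (eq_measurable_fun g); last exact: measurable_funTS.
by move=> x; rewrite inE /= => /eqP xq; rewrite fg.
Qed.

Lemma Rintegral_off_point (f g : R3 -> R) (q : R3) : measurable_fun setT g ->
  (forall x, x != q -> f x = g x) -> \int[mu3]_x f x = \int[mu3]_x g x.
Proof.
move=> mg fg; apply: ae_eq_Rintegral => //; first exact: measurable_fun_off_point fg.
have [A [mA A0 qA]] := negligible_set1_R3 q; exists A; split => //.
apply: subset_trans qA => x /= xE; apply: contrapT => /eqP xq.
by apply: xE => _; exact: fg.
Qed.

End product_lemmas.

(** * The current J of a state and its Poincare covariance *)

Section current.
Context {R : realType}.
Local Notation C := R[i].
Local Notation R3 := (R3 R).
Local Notation R4 := 'cV[R]_4.
Local Notation mu3 := (mu3 R).
Local Notation mu6 := (@mu6 R).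

Definition wave (c : C) (a : R) : R := complex.Re c * cos a - complex.Im c * sin a.

Lemma Re_cis c a : complex.Re (c * cis a) = wave c a.
Proof. by case: c. Qed.

Lemma wave_bound c a : `|wave c a| <= 2 * (1 + normsq c).
Proof.
case: c => x y; rewrite /wave /normsq /=.
have := cos_le1 a; have := cos_geN1 a; have := sin_le1 a; have := sin_geN1 a.
have := sqr_ge0 (x - 1); have := sqr_ge0 (x + 1); have := sqr_ge0 (y - 1); have := sqr_ge0 (y + 1).
move=> h1 h2 h3 h4 s1 s2 c1 c2.
have hx : `|x| <= (1 + x ^+ 2) by rewrite ler_norml; apply/andP; split; nra.
have hy : `|y| <= (1 + y ^+ 2) by rewrite ler_norml; apply/andP; split; nra.
have c1' : `|cos a| <= 1 by rewrite ler_norml c1 c2.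
have s1' : `|sin a| <= 1 by rewrite ler_norml s1 s2.
apply: le_trans (ler_normB _ _) _; rewrite !normrM.
have := ler_pM (normr_ge0 x) (normr_ge0 (cos a)) hx c1'.
have := ler_pM (normr_ge0 y) (normr_ge0 (sin a)) hy s1'.
nra.
Qed.

(** For z = (p, k) this is (k - p) . x; at time zero the signature turns it into the Euclidean (p -
    k) . x of the kernel formula. *)
Definition phase (z : R3 * R3) (x : R4) : R := mink (onshell z.2 - onshell z.1) x.

Record current_kernel (t : R3 -> R3 -> C) (good : set R3) (V : R3 -> R3 -> 'cV[C]_4) : Prop :=
  CurrentKernel {
  ck_negligible : mu3.-negligible (~` good);
  ck_measurable : forall i, cmeasurable (fun z : R3 * R3 => V z.1 z.2 i 0);
  ck_bounded : exists K, forall i k p, normsq (V k p i 0) <= K;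
  ck_density : forall k p, good k -> good p -> V k p 0 0 = t k p;
  ck_conserved : forall k p, good k -> good p ->
    mink (toC (onshell k - onshell p)) (V k p) = 0;
  ck_covariant : forall L k p, proper_orthochronous L ->
    good k -> good p -> good (lact L k) -> good (lact L p) ->
    V (lact L k) (lact L p) =
    (Num.sqrt (eps k * eps p) / Num.sqrt (eps (lact L k) * eps (lact L p)))%:C
      *: (toC L *m V k p) }.

Variables (t : R3 -> R3 -> C) (good : set R3) (V : R3 -> R3 -> 'cV[C]_4).
Hypothesis ck : current_kernel t good V.

(** The pair is (p, k), with p first, in agreement with the order of the iterated integrals in
    [is_kernel]. *)
Definition amplitude (f : R3 -> C) i (z : R3 * R3) : C :=
  V z.2 z.1 i 0 * ((f z.2)^*%C * f z.1).

Definition J (f : R3 -> C) (x : R4) : R4 :=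
  \col_i \int[mu6]_z wave (amplitude f i z) (phase z x).

Lemma cmeasurable_swap (u : R3 -> R3 -> C) : cmeasurable (fun z : R3 * R3 => u z.1 z.2) ->
  cmeasurable (fun z : R3 * R3 => u z.2 z.1).
Proof.
move=> mu; apply: (cmeasurable_comp (g := fun z : R3 * R3 => (z.2, z.1)) mu).
exact: measurable_fun_pair.
Qed.

Lemma cmeasurable_ff (f : R3 -> C) : cmeasurable f ->
  cmeasurable (fun z : R3 * R3 => (f z.2)^*%C * f z.1).
Proof.
move=> mf; apply: cmeasurableM.
  by apply: cmeasurable_conj; exact: (cmeasurable_comp mf measurable_snd).
exact: (cmeasurable_comp mf measurable_fst).
Qed.

Lemma cmeasurable_amplitude f i : cmeasurable f -> cmeasurable (amplitude f i).
Proof.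
move=> mf; apply: cmeasurableM; last exact: cmeasurable_ff.
exact: (cmeasurable_swap (u := fun k p => V k p i 0) (ck_measurable ck i)).
Qed.

Lemma measurable_wave d (X : measurableType d) (c : X -> C) (a : X -> R) :
  cmeasurable c -> measurable_fun setT a -> measurable_fun setT (fun x => wave (c x) (a x)).
Proof.
move=> [m1 m2] ma; have [mc ms] := cmeasurable_cis ma.
apply: measurable_funB; apply: measurable_funM => //.
Qed.

Lemma measurable_onshell i : measurable_fun setT (fun p : R3 => onshell p i 0).
Proof.
have e := @measurable_eps R; have c1 := @measurable_coord1 R.
have c2 := @measurable_coord2 R; have c3 := @measurable_coord3 R.
move: i; apply: ord4_cases.
- by under eq_fun do rewrite four0.
- by under eq_fun do rewrite four1.
- by under eq_fun do rewrite four2.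
- by under eq_fun do rewrite four3.
Qed.

Lemma measurable_phase d (X : measurableType d) (z : X -> R3 * R3) (x : X -> R4) :
  measurable_fun setT z -> (forall i, measurable_fun setT (fun y => x y i 0)) ->
  measurable_fun setT (fun y => phase (z y) (x y)).
Proof.
move=> mz mx.
have m1 i : measurable_fun setT (fun y => (onshell (z y).2 - onshell (z y).1) i 0).
  under eq_fun do rewrite !mxE; apply: measurable_funD.
    have := measurableT_comp (measurable_onshell i) (measurableT_comp measurable_snd mz).
    by under eq_fun do rewrite /= mxE.
  apply: measurable_funN.
  have := measurableT_comp (measurable_onshell i) (measurableT_comp measurable_fst mz).
  by under eq_fun do rewrite /= mxE.
by rewrite /phase /mink; do ?[apply: measurable_funB|apply: measurable_funM].
Qed.

Lemma mu6_box M : (mu6 (box M `*` box M) < +oo)%E.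
Proof.
have e : mu6 (box M `*` box M) = (mu3 (box M) * mu3 (box M))%E.
  exact: (product_measure1E (@sigma_finite_mu3 R) (@sigma_finite_mu3 R) (@measurable_box R M) (@measurable_box R M)).
have := @mu3_box R M; move: e => -> b.
by apply: lte_mul_pinfty => //; rewrite ge0_fin_numE.
Qed.

Lemma amplitude_bound f : nice f -> exists2 M : R, 0 < M &
  forall i z, normsq (amplitude f i z) <= M /\
    (~ (box M `*` box M) z -> amplitude f i z = 0).
Proof.
move=> [mf [M M0 fM]]; have [K HK] := ck_bounded ck.
have K0 : 0 <= K by apply: le_trans (HK 0 0 0); exact: normsq_ge0.
exists (M + K * (M * M)) => [|i z]; first by rewrite ltr_pwDl// mulr_ge0// mulr_ge0// ltW.
have nc (w : C) : normsq w^*%C = normsq w by case: w => a b; rewrite /normsq /= sqrrN.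
have [f1 z1] := fM z.1; have [f2 z2] := fM z.2.
split.
  rewrite /amplitude !normsqM nc.
  have n1 := normsq_ge0 (f z.1); have n2 := normsq_ge0 (f z.2).
  have nV := normsq_ge0 (V z.2 z.1 i 0).
  apply: le_trans (_ : K * (M * M) <= _); last by rewrite lerDr ltW.
  apply: ler_pM => //; first exact: mulr_ge0.
  exact: ler_pM.
move=> nb; rewrite /amplitude.
have MM : M <= M + K * (M * M) by rewrite lerDl mulr_ge0// mulr_ge0// ltW.
case: (pselect (box M z.1)) => b1; last by rewrite z1// !mulr0.
case: (pselect (box M z.2)) => b2; last by rewrite z2// conjc0 mul0r mulr0.
by exfalso; apply: nb; split; apply: box_le MM _.
Qed.

Lemma wave_amplitude_bound f : nice f -> exists2 M : R, 0 < M &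
  forall i z a, `|wave (amplitude f i z) a| <= M * \1_(box M `*` box M) z.
Proof.
move=> nf; have [M M0 HM] := amplitude_bound nf.
exists (2 * (1 + M)) => [|i z a]; first by rewrite mulr_gt0// addr_gt0.
have [nM zM] := HM i z; rewrite indicE.
case: (pselect ((box (2 * (1 + M)) `*` box (2 * (1 + M))) z)) => b.
  rewrite mem_set// mulr1; apply: le_trans (wave_bound _ _) _; lra.
rewrite memNset// mulr0 zM.
  by rewrite /wave /= !mul0r subr0 normr0.
by case=> b1 b2; apply: b; split; apply: (@box_le _ M) => //; lra.
Qed.

Lemma integrable_wave f i x : nice f ->
  mu6.-integrable setT (EFin \o (fun z => wave (amplitude f i z) (phase z x))).
Proof.
move=> nf; have [M M0 HM] := wave_amplitude_bound nf.
apply: (bounded_integrable (A := box M `*` box M) (M := M)) => //.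
- apply: measurable_wave; first by apply: cmeasurable_amplitude; case: nf.
  by apply: measurable_phase => // j; exact: measurable_cst.
- by apply: measurableX; exact: measurable_box.
- exact: mu6_box.
Qed.

Lemma measurable_J d (X : measurableType d) (x : X -> R4) f i : nice f ->
  (forall i, measurable_fun setT (fun y => x y i 0)) ->
  measurable_fun setT (fun y => J f (x y) i 0).
Proof.
move=> [mf _] mx; under eq_fun do rewrite mxE.
apply: (@measurable_Rintegral _ _ _ _ _ mu6
  (fun yz : X * (R3 * R3) => wave (amplitude f i yz.2) (phase yz.2 (x yz.1)))).
apply: measurable_wave.
  exact: (cmeasurable_comp (cmeasurable_amplitude i mf) measurable_snd).
apply: measurable_phase => // j.
exact: (measurableT_comp (mx j) measurable_fst).
Qed.

Lemma cisD (a b : R) : cis (a + b) = cis a * cis b.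
Proof. by rewrite /cis cosD sinD; apply/eqP; rewrite eq_complex /= eqxx /= addrC. Qed.

Lemma cisN (a : R) : cis (- a) = (cis a)^*%C.
Proof. by rewrite /cis cosN sinN. Qed.

Lemma Re_realM (c : R) (w : C) : complex.Re (c%:C * w) = c * complex.Re w.
Proof. by case: w => u v /=; rewrite mul0r subr0. Qed.

(** The phases that [W] puts on the two momenta cancel the translation part of [phase z x]. The two
    square roots from [W] and the one from the covariance of [V] multiply to the Jacobian of the
    momentum change in both variables. *)
Lemma amplitudeW A A' L L' a f x z i : generator A A' L L' ->
  good z.1 -> good z.2 -> good (lact L' z.1) -> good (lact L' z.2) ->
  let z' := (lact L' z.1, lact L' z.2) in
  let y := L' *m (x - a) in
  let F j := amplitude f j z' * cis (phase z' y) in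
  amplitude (W a A f) i z * cis (phase z x) =
  (eps (lact L' z.1) / eps z.1 * (eps (lact L' z.2) / eps z.2))%:C *
  ((L i 0)%:C * F 0 + (L i 1)%:C * F 1 + (L i 2)%:C * F 2 + (L i 3)%:C * F 3).
Proof.
move=> gen g1 g2 q1 q2 z' y F.
have poL : proper_orthochronous L by have [] := gen_good gen.
have := ck_covariant ck poL q2 q1.
rewrite !(lactK gen) => /(_ g2 g1) VE.
have -> : phase z x = phase z' y + phase z a.
  apply/eqP; rewrite -subr_eq; apply/eqP.
  rewrite /phase /= -minkNr -minkDr /y.
  by rewrite -[RHS]minkC (gen_minkl gen) mulmxBr -!(gen_onshell gen) !(lactK gen) minkC.
set m1 := mink a (onshell z.1); set m2 := mink a (onshell z.2).
have -> : phase z a = m2 - m1 by rewrite /phase minkC minkDr minkNr.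
rewrite /F /amplitude VE !(WE _ gen) -/m1 -/m2 (cisD _ (m2 - m1)) (cisD m2) cisN mxE mulmx_toC.
have c1 : cis m1 * (cis m1)^*%C = 1 by rewrite -cisN -cisD subrr /cis cos0 sin0.
have c2 : (cis m2)^*%C * cis m2 = 1 by rewrite -cisN -cisD addNr /cis cos0 sin0.
have P1 := eps_gt0 z.1; have P2 := eps_gt0 z.2.
have P1' := eps_gt0 (lact L' z.1); have P2' := eps_gt0 (lact L' z.2).
have rE : (eps (lact L' z.1) / eps z.1 * (eps (lact L' z.2) / eps z.2))%:C =
   (Num.sqrt (eps (lact L' z.2) * eps (lact L' z.1)) / Num.sqrt (eps z.2 * eps z.1))%:C *
   (Num.sqrt (eps (lact L' z.2) / eps z.2))%:C * (Num.sqrt (eps (lact L' z.1) / eps z.1))%:C.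
  rewrite -!rmorphM; congr (_%:C).
  rewrite !sqrtrM ?ltW// !sqrtrV ?ltW//.
  have h (u : R) : 0 < u -> exists2 v, 0 < v & Num.sqrt u = v /\ u = v ^+ 2.
    by move=> u0; exists (Num.sqrt u); rewrite ?sqrtr_gt0 ?sqr_sqrtr ?ltW.
  have [v1 v10 [-> {1}->]] := h _ P1; have [v2 v20 [-> {1}->]] := h _ P2.
  have [w1 w10 [-> {1}->]] := h _ P1'; have [w2 w20 [-> {1}->]] := h _ P2'.
  by field; rewrite !gt_eqF.
have cM (u v : C) : (u * v)^*%C = u^*%C * v^*%C by exact: rmorphM.
have cR (r : R) : (r%:C)^*%C = r%:C by rewrite /= oppr0.
rewrite rE !cM cR.
move: c1 c2; set u1' := (cis m1)^*%C; set u2' := (cis m2)^*%C; set u1 := cis m1; set u2 := cis m2 => c1 c2.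
set ph := cis (phase z' y); clearbody u1 u2 u1' u2' ph; rewrite /z' /=.
set V0 := V _ _ 0 0; set V1 := V _ _ 1 0; set V2 := V _ _ 2 0; set V3 := V _ _ 3 0.
set s0 := (_ / _)%:C; set s1 := (Num.sqrt _)%:C; set s2 := (Num.sqrt _)%:C.
set f1 := f _; set f2 := (f _)^*%C.
clearbody V0 V1 V2 V3 s0 s1 s2 f1 f2.
by ring: c1 c2.
Qed.

(* With psi = sqrt(eps) f the current is an integral of V sqrt(eps eps) against the
   invariant measure d^3k/eps(k), on which W acts by psi(p) |-> e^(i a.p) psi(L^-1 p). *)
Lemma J_W A A' L L' a f x : generator A A' L L' -> nice f ->
  J (W a A f) x = L *m J f (L' *m (x - a)).
Proof.
move=> gen nf; have nWf := nice_W a gen nf.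
apply/matrixP => i j; rewrite ord1 {j} mulmx4E !mxE.
set y := L' *m (x - a).
have mf : cmeasurable f by case: nf.
have [_ _ PL' _] := gen_good' gen.
have [mL' _ _ _] := PL'.
have poL : proper_orthochronous L by have [] := gen_good gen.
pose g z := L i 0 * wave (amplitude f 0 z) (phase z y) + L i 1 * wave (amplitude f 1 z) (phase z y) +
  L i 2 * wave (amplitude f 2 z) (phase z y) + L i 3 * wave (amplitude f 3 z) (phase z y).
have mw k : measurable_fun setT (fun z => wave (amplitude f k z) (phase z y)).
  apply: measurable_wave; first exact: cmeasurable_amplitude.
  by apply: measurable_phase => // l; exact: measurable_cst.
have mg : measurable_fun setT g.
  rewrite /g; do 3 (apply: measurable_funD; last by [apply: measurable_funM => //; exact: measurable_cst]).
  by apply: measurable_funM => //; exact: measurable_cst.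
transitivity (\int[mu6]_z g z).
  rewrite -(preserves_product PL' mg).
  have mgL : measurable_fun setT (fun z : R3 * R3 => g (lact L' z.1, lact L' z.2) *
      (eps (lact L' z.1) / eps z.1 * (eps (lact L' z.2) / eps z.2))).
    have [_ mJ _ _] := PL'.
    apply: measurable_funM; last first.
      by apply: measurable_funM; apply: (measurableT_comp mJ).
    apply: (measurableT_comp mg).
    by apply: measurable_fun_pair; apply: (measurableT_comp mL').
  apply: ae_eq_Rintegral => //.
    apply: measurable_wave; first by apply: cmeasurable_amplitude; case: nWf.
    by apply: measurable_phase => // l; exact: measurable_cst.
  have Ng := ck_negligible ck.
  have NL : mu3.-negligible (lact L' @^-1` (~` good)) by exact: preserves_negligible PL' Ng.
  have [B [mB B0 NB]] := negligible_product (negligibleU Ng NL).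
  exists B; split => //; apply: subset_trans NB => z /= nz.
  apply: contrapT => /not_orP[/not_orP[/contrapT g1 /contrapT q1] /not_orP[/contrapT g2 /contrapT q2]].
  apply: nz => _.
  rewrite -Re_cis (amplitudeW a f x i gen g1 g2 q1 q2) -/y Re_realM mulrC /g -!Re_cis; congr (_ * _).
  by rewrite -!Re_realM !raddfD.
rewrite /g; have iw k := integrable_wave k y nf.
have iZ c k := integrable_scale c (iw k).
have i1 := integrable_add (iZ (L i 0) 0) (iZ (L i 1) 1).
have i2 := integrable_add i1 (iZ (L i 2) 2).
by rewrite (RintegralD _ i2 (iZ _ _))// (RintegralD _ i1 (iZ _ _))// (RintegralD _ (iZ _ _) (iZ _ _))// !RintegralZl.
Qed.

End current.

(** * Density at time zero, positivity, and flux through tilted planes *)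

Section density.
Context {R : realType}.
Local Notation C := R[i].
Local Notation R3 := (R3 R).
Local Notation R4 := 'cV[R]_4.
Local Notation mu3 := (mu3 R).
Local Notation mu6 := (@mu6 R).

Lemma sin_cos_lipschitz (a b : R) : `|cos a - cos b| <= `|a - b| /\ `|sin a - sin b| <= `|a - b|.
Proof.
wlog ab : a b / b <= a => [H|].
  case: (leP b a) => [/H//|/ltW/H].
  by rewrite (distrC (cos b)) (distrC (sin b)) (distrC b).
have cc (f df : R -> R) : (forall x, is_derive x (1 : R) f (df x)) -> (forall x, `|df x| <= 1) ->
    `|f a - f b| <= `|a - b|.
  move=> fd df1; have [|c _ ->] := @MVT_segment R f df b a ab (fun x _ => fd x).
    by apply: continuous_subspaceT => x; apply/differentiable_continuous/derivable1_diffP;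
       have [] := fd x.
  by rewrite normrM ler_piMl.
split; [apply: (cc _ (fun x => - sin x))|apply: (cc _ cos)] => x.
- by rewrite normrN ler_norml sin_geN1 sin_le1.
- by rewrite ler_norml cos_geN1 cos_le1.
Qed.

Lemma wave_lipschitz (c : C) (a b : R) :
  wave c a <= wave c b + 2 * (1 + normsq c) * `|a - b|.
Proof.
have [] := sin_cos_lipschitz a b; case: c => x y; rewrite /wave /normsq /=.
set d := `|a - b|.
have d0 : 0 <= d by exact: normr_ge0.
have hx : `|x| <= 1 + x ^+ 2.
  have := sqr_ge0 (x - 1); have := sqr_ge0 (x + 1).
  by move=> h1 h2; rewrite ler_norml; apply/andP; split; nra.
have hy : `|y| <= 1 + y ^+ 2.
  have := sqr_ge0 (y - 1); have := sqr_ge0 (y + 1).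
  by move=> h1 h2; rewrite ler_norml; apply/andP; split; nra.
move=> hc hs.
have h1 : x * (cos a - cos b) <= (1 + x ^+ 2) * d.
  by apply: le_trans (ler_norm _) _; rewrite normrM ler_pM.
have h2 : y * (sin b - sin a) <= (1 + y ^+ 2) * d.
  by apply: le_trans (ler_norm _) _; rewrite normrM ler_pM// distrC.
have p1 := mulr_ge0 (sqr_ge0 x) d0; have p2 := mulr_ge0 (sqr_ge0 y) d0.
nra.
Qed.

Variables (T : set R3 -> L2op R) (t : R3 -> R3 -> C) (good : set R3) (V : R3 -> R3 -> 'cV[C]_4).
Hypothesis povm : is_POVM T.
Hypothesis kT : is_kernel T t.
Hypothesis ck : current_kernel t good V.
Local Notation J := (J V).
Local Notation amplitude := (amplitude V).

(** [V] agrees with [t] only at good momenta and [t] is arbitrary at 0, so both sides are compared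
    with [punctured t]; the inner and the outer integrand are changed on null sets separately. *)
Lemma J_density f x : nice f ->
  J f (four 0 x) 0 0 =
  \int[mu3]_p \int[mu3]_k complex.Re (t k p * cis (dot3 (p - k) x) * (f k)^*%C * f p).
Proof.
move=> nf; have [mt _ _ _ _] := kT; have [mf _] := nf.
rewrite mxE (Rintegral_product (integrable_wave ck 0 (four 0 x) nf)).
pose F (u : R3 -> R3 -> C) (p k : R3) := complex.Re (u k p * cis (dot3 (p - k) x) * (f k)^*%C * f p).
have mF u : cmeasurable (fun z : R3 * R3 => u z.1 z.2) ->
    measurable_fun setT (fun z : R3 * R3 => F u z.1 z.2).
  move=> mu; rewrite /F.
  have mfst := @measurable_fst _ _ R3 R3; have msnd := @measurable_snd _ _ R3 R3.
  have md : measurable_fun setT (fun z : R3 * R3 => dot3 (z.1 - z.2) x).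
    have c1 := @measurable_coord1 R; have c2 := @measurable_coord2 R; have c3 := @measurable_coord3 R.
    rewrite /dot3 /=; do ?apply: measurable_funD; apply: measurable_funM => //;
    apply: measurable_funB; by [apply: (measurableT_comp c1)|apply: (measurableT_comp c2)|apply: (measurableT_comp c3)].
  have [] // : cmeasurable (fun z : R3 * R3 => u z.2 z.1 * cis (dot3 (z.1 - z.2) x) * (f z.2)^*%C * f z.1).
  apply: cmeasurableM; last exact: (cmeasurable_comp mf mfst).
  apply: cmeasurableM; last by apply: cmeasurable_conj; exact: (cmeasurable_comp mf msnd).
  apply: cmeasurableM; last exact: cmeasurable_cis.
  exact: cmeasurable_swap.
have mpt := cmeasurable_punctured mt.
have mI u : cmeasurable (fun z : R3 * R3 => u z.1 z.2) ->
    measurable_fun setT (fun p => \int[mu3]_k F u p k).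
  move=> mu; exact: (@measurable_Rintegral _ _ _ _ _ (@sigma_finite_mu3 R) _ (mF _ mu)).
transitivity (\int[mu3]_p \int[mu3]_k F (punctured t) p k); last first.
  apply/esym/(@Rintegral_off_point R _ _ (0 : R3)); first exact: mI.
  move=> p p0; apply: (@Rintegral_off_point R _ _ (0 : R3)).
    exact: (measurableT_comp (mF _ mpt) (measurable_pair1 p)).
  by move=> k k0; rewrite /F /punctured k0 p0.
have mV : cmeasurable (fun z : R3 * R3 => V z.1 z.2 0 0) := ck_measurable ck 0.
have E p k : wave (amplitude f 0 (p, k)) (phase (p, k) (four 0 x)) = F (fun k p => V k p 0 0) p k.
  rewrite -Re_cis /F /amplitude /= /phase; congr complex.Re.
  have -> : mink (onshell k - onshell p) (four 0 x) = dot3 (p - k) x.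
    by rewrite /mink /dot3 !mxE /=; ring.
  by rewrite !mulrA; ring.
have N := negligibleU (ck_negligible ck) (negligible_set1_R3 (0 : R3)).
apply: ae_eq_Rintegral.
- under eq_fun do under eq_Rintegral do rewrite E.
  exact: (mI _ mV).
- exact: mI.
have [A [mA A0 NA]] := N; exists A; split => //; apply: subset_trans NA => p /= pE.
apply: contrapT => /not_orP[/contrapT gp /eqP p0]; apply: pE => _.
apply: ae_eq_Rintegral.
- under eq_fun do rewrite E.
  exact: (measurableT_comp (mF _ mV) (measurable_pair1 p)).
- exact: (measurableT_comp (mF _ mpt) (measurable_pair1 p)).
have [B [mB B0 NB]] := N; exists B; split => //; apply: subset_trans NB => k /= kE.
apply: contrapT => /not_orP[/contrapT gk /eqP k0]; apply: kE => _.
by rewrite E /F /punctured k0 p0 (ck_density ck).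
Qed.

Lemma quad_density f D : nice f -> measurable D ->
  quad (T D) f = (2 * pi) ^- 3 * \int[mu3]_(x in D) J f (four 0 x) 0 0.
Proof.
move=> nf mD; have [_ _ _ _ K] := kT.
rewrite /quad /rinner (K _ _ (nice_LC1 nf) (nice_LC2 nf) mD) Re_realM; congr (_ * _).
by apply: eq_Rintegral => x _; rewrite J_density.
Qed.

Lemma J_bounded f : nice f -> exists2 K : R, 0 < K & forall x i, `|J f x i 0| <= K.
Proof.
move=> nf; have [M M0 HM] := wave_amplitude_bound ck nf.
have mB : measurable (box M `*` box M : set (R3 * R3)) by apply: measurableX; exact: measurable_box.
have iB := integrable_scale M (integrable_indic_lty mB (mu6_box M)).
exists (1 + \int[mu6]_z (M * \1_(box M `*` box M) z)).
  by apply: ltr_pwDl => //; apply: Rintegral_ge0 => z _; rewrite mulr_ge0// ltW.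
move=> x i; rewrite mxE.
have iw := integrable_wave ck i x nf.
apply: le_trans (le_normr_Rintegral measurableT iw) _.
apply: le_trans (_ : \int[mu6]_z (M * \1_(box M `*` box M) z) <= _); last by rewrite lerDr.
by apply: le_Rintegral => //; exact: (integrable_norm iw).
Qed.

(** A one-sided Lipschitz bound at the origin; it spreads a negative value of the density to a whole
    box. *)
Lemma J_continuous0 f : nice f -> exists2 K : R, 0 <= K & forall (r : R) (x : R3), 0 <= r -> box r x ->
  J f (four 0 x) 0 0 <= J f 0 0 0 + K * r.
Proof.
move=> nf; have [M M0 HM] := amplitude_bound ck nf.
have mB : measurable (box M `*` box M : set (R3 * R3)) by apply: measurableX; exact: measurable_box.
have iB := integrable_indic_lty mB (mu6_box M).
exists (\int[mu6]_z (2 * (1 + M) * (6 * M) * \1_(box M `*` box M) z)).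
  by apply: Rintegral_ge0 => z _; rewrite mulr_ge0// mulr_ge0//; lra.
move=> r x r0 bx.
rewrite !mxE -RintegralZr//; last by apply: integrable_scale.
rewrite -RintegralD//; last 2 first.
- exact: (integrable_wave ck).
- under eq_fun do rewrite mulrC. exact/integrable_scale/integrable_scale.
apply: le_Rintegral => //.
- exact: (integrable_wave ck).
- apply: integrable_add; first exact: (integrable_wave ck).
  under eq_fun do rewrite mulrC. exact/integrable_scale/integrable_scale.
move=> z _.
have [nM zM] := HM 0 z; rewrite indicE.
case: (pselect ((box M `*` box M) z)) => [b|b].
  rewrite mem_set// mulr1; apply: le_trans (wave_lipschitz _ _ (phase z 0)) _.
  rewrite lerD2l.
  (* Each of the three coordinates contributes at most 2 M r, since both momenta lie in [box M]. *)
  have ph : `|phase z (four 0 x) - phase z 0| <= 6 * M * r.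
    case: b bx => -[a1 a2 a3] [b1 b2 b3] [x1 x2 x3].
    rewrite /phase /mink !fourE !mxE /= .
    have H (u v w : R) : `|u| <= M -> `|v| <= M -> `|w| <= r -> `|(v - u) * w| <= 2 * M * r.
      move=> hu hv hw; rewrite normrM ler_pM//.
      by apply: le_trans (ler_normB _ _) _; lra.
    have := H _ _ _ a1 b1 x1; have := H _ _ _ a2 b2 x2; have := H _ _ _ a3 b3 x3.
    set s1 := (_ * x.1.1); set s2 := (_ * x.1.2); set s3 := (_ * x.2) => h3 h2 h1.
    rewrite (_ : _ - _ = - (s1 + s2 + s3)); last by rewrite /s1 /s2 /s3; ring.
    rewrite normrN; apply: le_trans (ler_normD _ _) _.
    by have := ler_normD s1 s2; move: h1 h2 h3; clear; lra.
  rewrite -[leRHS]mulrA; apply: ler_pM => //.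
    by rewrite mulr_ge0// addr_ge0// normsq_ge0.
  by rewrite ler_wpM2l// lerD2l.
rewrite memNset// mulr0 mul0r addr0 zM//.
by rewrite /wave /= !mul0r.
Qed.

Lemma mu3_box_gt0 (r : R) : 0 < r -> (0 < mu3 (box r))%E.
Proof.
move=> r0; pose I : set (measurableTypeR R) := `[- r, r]%classic.
have mI : measurable I by exact: measurable_itv.
have lpos : (0 < @lebesgue_measure R I)%E.
  rewrite lebesgue_measure_itv /= lte_fin gtrN// -EFinB lte_fin; lra.
have f2 : @sigma_finite_mu2 R (I `*` I) = (@lebesgue_measure R I * @lebesgue_measure R I)%E.
  exact: (product_measure1E (@lebesgue_measure R) (@lebesgue_measure R) mI mI).
have -> : mu3 (box r) = (@sigma_finite_mu2 R (I `*` I) * @lebesgue_measure R I)%E.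
  rewrite boxE.
  exact: (product_measure1E (@sigma_finite_mu2 R) (@lebesgue_measure R) (measurableX mI mI) mI).
by rewrite f2; do ?apply: mule_gt0.
Qed.

Lemma quad_ge0 f D : LC 2%:E f -> measurable D -> 0 <= quad (T D) f.
Proof.
move=> Lf mD; have [/(_ _ mD _ Lf) + _ _] := povm.
by rewrite lecE => /andP[_].
Qed.

Lemma measurable_four d (X : measurableType d) (h : X -> R) (x : X -> R3) i :
  measurable_fun setT h -> measurable_fun setT x ->
  measurable_fun setT (fun y => four (h y) (x y) i 0).
Proof.
move=> mh mx; move: i; apply: ord4_cases.
- by under eq_fun do rewrite four0.
- by under eq_fun do rewrite four1; exact: (measurableT_comp (@measurable_coord1 R) mx).
- by under eq_fun do rewrite four2; exact: (measurableT_comp (@measurable_coord2 R) mx).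
- by under eq_fun do rewrite four3; exact: (measurableT_comp (@measurable_coord3 R) mx).
Qed.

(** A spacetime translation moves x to the origin. A negative value there would persist on a small
    box and make the expectation of [T] of that box negative. *)
Lemma J0_ge0 f x : nice f -> 0 <= J f x 0 0.
Proof.
suff H g : nice g -> 0 <= J g 0 0 0.
  move=> nf; have := H _ (nice_W (- x) (@generator1 R) nf).
  by rewrite (J_W ck _ _ (@generator1 R) nf) !mul1mx sub0r opprK.
move=> ng; rewrite leNgt; apply/negP => neg.
have [K K0 HK] := J_continuous0 ng.
pose m := - J g 0 0 0; have m0 : 0 < m by rewrite oppr_gt0.
(* So small that K r <= m / 2: the density stays below - m / 2 on [box r]. *)
pose r := m / (2 * (K + 1)).
have r0 : 0 < r by rewrite divr_gt0// mulr_gt0// ltr_wpDl.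
have Kr : K * r <= m / 2.
  rewrite /r mulrA ler_pdivrMr ?mulr_gt0 ?ltr_wpDl//.
  have : m / 2 * (2 * (K + 1)) = m * K + m by field.
  by move=> ->; rewrite mulrC lerDl ltW.
have mb := @measurable_box R r; have bfin := @mu3_box R r.
have := quad_ge0 (nice_LC2 ng) mb; rewrite quad_density//.
have pi3 : 0 < (2 * pi) ^- 3 :> R by rewrite invr_gt0 exprn_gt0// mulr_gt0// pi_gt0.
rewrite pmulr_rge0// leNgt => /negP; apply.
have iJ : mu3.-integrable (box r) (EFin \o (fun x => J g (four 0 x) 0 0)).
  apply: measurable_bounded_integrable => //.
    apply: measurable_funTS.
    by apply: (measurable_J ck) => // i; apply: measurable_four => //; exact: measurable_cst.
  have [M M0 HM] := J_bounded ng.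
  by exists M; split; [exact: num_real|move=> z zM y _; apply: le_trans (HM _ _) (ltW zM)].
apply: le_lt_trans (_ : \int[mu3]_(x in box r) (- (m / 2)) < 0).
  apply: le_Rintegral => //.
    apply: measurable_bounded_integrable => //.
    by exists `|m / 2|; split; [exact: num_real|move=> z zM y _; rewrite normrN ltW].
  move=> y bx; apply: le_trans (HK r y (ltW r0) _) _ => //.
  rewrite -[J g 0 0 0]opprK -/m; lra.
rewrite Rintegral_cst// pmulr_llt0 ?oppr_lt0 ?divr_gt0//.
by rewrite fine_gt0// bfin mu3_box_gt0.
Qed.

Lemma J_future f x n : nice f -> future n -> 0 <= mink n (J f x).
Proof.
(* The state is generalized because every generator replaces it by its image under [W]. *)
move=> nf fn; move: n fn f nf x; apply: future_reduction => [A A' L L' n gen IH f nf x|m m0 f nf x].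
  have := IH _ (nice_W 0 gen nf) (L *m x).
  by rewrite (J_W ck _ _ gen nf) subr0 mulmxA (gen_mulL' gen) mul1mx (gen_mink gen).
by rewrite /mink !fourE /= !mul0r !subr0 mulr_ge0 ?(ltW m0)// J0_ge0.
Qed.

Lemma boost_exists (b : R) : `|b| < 1 -> exists r : R, [/\ r != 0,
  0 < (r ^+ 2 + r ^- 2) / 2 & (r ^+ 2 - r ^- 2) / 2 = b * ((r ^+ 2 + r ^- 2) / 2)].
Proof.
rewrite ltr_norml => /andP[b1 b2].
have q0 : 0 < (1 + b) / (1 - b) by rewrite divr_gt0; lra.
(* The velocity of the boost is (r^4 - 1) / (r^4 + 1), which has to equal b. *)
set r := Num.sqrt (Num.sqrt ((1 + b) / (1 - b))).
have rgt0 : 0 < r by rewrite !sqrtr_gt0.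
have r0 : r != 0 by exact: lt0r_neq0.
have r4 : r ^+ 4 = (1 + b) / (1 - b).
  by rewrite (exprM r 2 2) !sqr_sqrtr ?sqrtr_ge0// ltW.
have E : r ^+ 4 * (1 - b) = 1 + b by rewrite r4 divfK//; lra.
exists r; split => //.
  have : 0 < r ^+ 2 by rewrite exprn_gt0.
  have : 0 < r ^- 2 by rewrite invr_gt0 exprn_gt0.
  lra.
apply/eqP; rewrite -subr_eq0; apply/eqP.
have -> : (r ^+ 2 - r ^- 2) / 2 - b * ((r ^+ 2 + r ^- 2) / 2) =
  (r ^+ 4 * (1 - b) - (1 + b)) / 2 / r ^+ 2 by field.
by rewrite E subrr !mul0r.
Qed.

(** The tilt is along the third axis, the direction of [Boostz]; a general plane is rotated into
    this position in [causal_pair_plane0]. *)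
Definition graph (a b : R) (S : set R3) : set R4 := [set four (a + b * x.2) x | x in S].

Lemma region_graph (a b : R) S : `|b| < 1 -> lebesgue_measurable3 S -> region (graph a b S).
Proof.
move=> b1 mS; exists (plane a (0, 0, b)); split.
- apply: spacelike_plane; rewrite /dot3 /= !mul0r !add0r.
  by move: b1; rewrite ltr_norml => /andP[? ?]; nra.
- by move=> _ [x Sx <-]; rewrite /plane /= four0 spatial_four /dot3 /= !mul0r !add0r.
- suff -> : [set spatial y | y in graph a b S] = S by [].
  apply/seteqP; split => [_ [_ [x Sx <-] <-]|x Sx].
    by rewrite spatial_four.
  by exists (four (a + b * x.2) x); [exists x|rewrite spatial_four].
Qed.

Lemma graph0 S : graph 0 0 S = [set four 0 x | x in S].
Proof.
apply/seteqP; split => [_ [x Sx <-]|_ [x Sx <-]]; exists x => //.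
  by rewrite mul0r addr0.
by rewrite mul0r addr0.
Qed.

Lemma op_eq_quad (A B : L2op R) f : op_eq A B -> LC 2%:E f -> quad A f = quad B f.
Proof.
move=> AB Lf; have [AL _ _ _] := L2opP A; have [BL _ _ _] := L2opP B.
apply: eq_rinner => //; [exact: AL|exact: BL|exact: aeW|].
by have := AB _ Lf; apply: filterS => x H /H ->.
Qed.

(* A boost along the third axis carries the time zero plane to the plane of the graph. *)
Lemma quad_graph (Tx : set R4 -> L2op R) (a b : R) : is_covariant_extension T Tx ->
  `|b| < 1 -> exists r : R, let ch := (r ^+ 2 + r ^- 2) / 2 in
  [/\ r != 0, 0 < ch, (r ^+ 2 - r ^- 2) / 2 = b * ch &
  forall A N f, measurable A -> mu3.-negligible N -> LC 2%:E f ->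
  quad (Tx (graph a b (A `|` N))) f =
  quad (T ((fun x : R3 => (x.1, ch * x.2)) @^-1` A)) (Winv (four a 0) (boostz r) f)].
Proof.
move=> [Tx1 Tx2] b1; have [r [r0 ch0 shE]] := boost_exists b1.
exists r; move: ch0 shE => /=; set ch := (r ^+ 2 + r ^- 2) / 2.
set sh := (r ^+ 2 - r ^- 2) / 2 => ch0 shE; split => // A N f mA nN Lf.
have gen := generator_boostz r0.
have pT : preserves (fun x : R3 => (x.1, ch * x.2) : R3) (cst ch).
  apply: eq_preserves (preserves_affine3 0 0 0 ch0) => // x.
  by rewrite !mul0r !addr0.
set F := (fun x : R3 => _) in pT *; have [mF _ _ _] := pT.
have mA0 : measurable (F @^-1` A) by rewrite -[_ @^-1` _]setTI; exact: mF.
have nN0 : mu3.-negligible (F @^-1` N) by exact: preserves_negligible pT nN.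
have LF y : four a 0 + Boostz r *m four 0 y = four (a + b * (F y).2) (F y).
  have addE (u v : R4) i : (u + v) i 0 = u i 0 + v i 0 by rewrite mxE.
  apply: col4P; rewrite !addE !mulmx4E !fourE !mxE /= -/ch -/sh shE; split; ring.
have DE : graph a b (A `|` N) =
    poincare (four a 0) (boostz r) @` graph 0 0 (F @^-1` A `|` F @^-1` N).
  rewrite graph0; apply/seteqP; split => [_ [x Sx <-]|_ [_ [y Sy <-] <-]].
    have Fx : F (x.1, x.2 / ch) = x.
      by rewrite /F /= mulrC divfK ?gt_eqF//; case: x {Sx}.
    exists (four 0 (x.1, x.2 / ch)); last by rewrite (poincareE _ gen) LF Fx.
    by exists (x.1, x.2 / ch) => //; case: Sx => ?; [left|right]; rewrite /= Fx.
  by exists (F y) => //; rewrite (poincareE _ gen) LF.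
have R0 : region (graph 0 0 (F @^-1` A `|` F @^-1` N)).
  by apply: region_graph; [rewrite normr0|exists (F @^-1` A) => //; exists (F @^-1` N)].
rewrite DE (quad_op_eq gen (Tx2 _ _ _ (gen_det gen) R0) Lf) graph0.
exact: op_eq_quad (Tx1 _ _ mA0 nN0) (LC2_Winv _ gen Lf).
Qed.

(** The integrand is the flux n . J for the normal n = (1, 0, 0, b). The pulled back state has
    density ch (J_0 - b J_3) at time zero, and ch is the Jacobian of the stretch from time zero
    coordinates to those of the graph. *)
Lemma quad_boost (Tx : set R4 -> L2op R) (a b : R) f S : is_covariant_extension T Tx ->
  `|b| < 1 -> nice f -> measurable S ->
  quad (Tx (graph a b S)) f = (2 * pi) ^- 3 *
  \int[mu3]_(x in S) (J f (four (a + b * x.2) x) 0 0 - b * J f (four (a + b * x.2) x) 3 0).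
Proof.
move=> ext b1 nf mS; have [r [r0 ch0 shE quadE]] := quad_graph a ext b1.
move: ch0 shE quadE; set ch := (r ^+ 2 + r ^- 2) / 2; set sh := (r ^+ 2 - r ^- 2) / 2.
move=> ch0 shE quadE; have gen := generator_boostz r0.
have pT : preserves (fun x : R3 => (x.1, ch * x.2) : R3) (cst ch).
  apply: eq_preserves (preserves_affine3 0 0 0 ch0) => // x.
  by rewrite !mul0r !addr0.
have := quadE S set0 f mS (negligible_set0 _) (nice_LC2 nf); rewrite setU0 => ->.
set F := (fun x : R3 => _) in pT *; have [mF _ _ _] := pT.
pose S0 := F @^-1` S.
have mS0 : measurable S0 by rewrite -[S0]setTI; exact: mF.
have LF y : four a 0 + Boostz r *m four 0 y = four (a + b * (F y).2) (F y).
  have addE (u v : R4) i : (u + v) i 0 = u i 0 + v i 0 by rewrite mxE.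
  apply: col4P; rewrite !addE !mulmx4E !fourE !mxE /= -/ch -/sh shE; split; ring.
have nf' := nice_Winv (four a 0) gen nf.
rewrite (quad_density nf' mS0); congr (_ * _).
have JE y : J (Winv (four a 0) (boostz r) f) (four 0 y) 0 0 =
    ch * (J f (four (a + b * (F y).2) (F y)) 0 0 - b * J f (four (a + b * (F y).2) (F y)) 3 0).
  have := J_W ck (four a 0) (four a 0 + Boostz r *m four 0 y) gen nf'.
  rewrite (WK _ _ gen) [four a 0 + _ - _]addrC addKr mulmxA (gen_mulL' gen) mul1mx => JfE.
  have -> : J (Winv (four a 0) (boostz r) f) (four 0 y) =
      Boostz r^-1 *m J f (four (a + b * (F y).2) (F y)).
    by rewrite -LF JfE mulmxA (gen_mulL' gen) mul1mx.
  move: (J f _) => j; rewrite mulmx4E !mxE /= !exprVn invrK.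
  have -> : (r ^- 2 + r ^+ 2) / 2 = ch by rewrite addrC.
  have -> : (r ^- 2 - r ^+ 2) / 2 = - sh by rewrite -opprB mulNr.
  by rewrite shE; ring.
rewrite [LHS]Rintegral_mkcond [RHS]Rintegral_mkcond.
set G := (X in _ = \int[_]_x X x).
have mG : measurable_fun setT G.
  have mJ i : measurable_fun setT (fun x : R3 => J f (four (a + b * x.2) x) i 0).
    apply: (measurable_J ck) => // j; apply: measurable_four => //.
    apply: measurable_funD; first exact: measurable_cst.
    apply: measurable_funM; first exact: measurable_cst.
    exact: measurable_coord3.
  apply/(measurable_restrictT _ mS); apply: measurable_funTS.
  exact: (measurable_funB (mJ 0) (measurable_funM (measurable_cst b) (mJ 3))).
rewrite -(preserves_Rintegral pT mG); apply: eq_Rintegral => y _.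
rewrite /G !patchE -/(F y).
have -> : (y \in S0) = (F y \in S) by apply/idP/idP; rewrite !inE.
by case: ifP => _; rewrite ?mul0r// JE mulrC.
Qed.

End density.

(** * Functions with a gradient along lines: waves, cutoffs, saturation *)

Section smooth.
Context {R : realType}.
Local Notation C := R[i].
Local Notation R3 := (R3 R).
Local Notation R4 := 'cV[R]_4.
Local Notation mu3 := (mu3 R).
Local Notation mu6 := (@mu6 R).

(** The squared positive part, a cutoff with continuous derivative that is positive exactly where
    its argument is. *)
Definition sqp (t : R) : R := Num.max t 0 ^+ 2.

Lemma eq_is_derive (f : R -> R) (t a b : R) :
  is_derive t (1 : R) f a -> a = b -> is_derive t (1 : R) f b.
Proof. by move=> ? <-. Qed.

Lemma is_deriveM_fun (f g : R -> R) (t a b : R) :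
  is_derive t (1 : R) f a -> is_derive t (1 : R) g b ->
  is_derive t (1 : R) (fun s => f s * g s) (a * g t + f t * b).
Proof.
move=> df dg; apply: eq_is_derive (is_deriveM df dg) _.
by rewrite /GRing.scale /=; ring.
Qed.

Lemma is_deriveD_fun (f g : R -> R) (t a b : R) :
  is_derive t (1 : R) f a -> is_derive t (1 : R) g b ->
  is_derive t (1 : R) (fun s => f s + g s) (a + b).
Proof. by move=> df dg; exact: (is_deriveD df dg). Qed.

Lemma is_derive_comp_fun (f g : R -> R) (t a b : R) :
  is_derive (g t) (1 : R) f a -> is_derive t (1 : R) g b ->
  is_derive t (1 : R) (fun s => f (g s)) (a * b).
Proof.
by move=> df dg; exact: (is_derive1_comp df dg).
Qed.

Lemma is_derive_affine (p q t : R) : is_derive t (1 : R) (fun s => p + q * s) q.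
Proof.
by apply: is_derive_eq; rewrite /GRing.scale /=; ring.
Qed.

Lemma is_derive_continuous (f df : R -> R) : (forall t, is_derive t (1 : R) f (df t)) ->
  continuous f.
Proof.
by move=> H t; apply/differentiable_continuous/derivable1_diffP; have [] := H t.
Qed.

Lemma is_derive_sqp (t : R) : is_derive t (1 : R) sqp (2 * Num.max t 0).
Proof.
have [t0|t0|->] := ltgtP t 0.
- apply: (@near_eq_is_derive _ _ _ (cst (0 : R))).
  + near=> s; rewrite /sqp max_r ?expr0n//.
    by apply: ltW; near: s; exact: lt_nbhsl.
  + rewrite mulr0; exact: is_derive_cst.
- apply: (@near_eq_is_derive _ _ _ (fun s : R => s * s)).
  + near=> s; rewrite /sqp max_l ?expr2//.
    by apply: ltW; near: s; exact: lt_nbhsr.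
  + by apply: is_derive_eq; rewrite /GRing.scale /=; ring.
- have m0 : Num.max 0 0 = 0 :> R by rewrite max_l.
  have H : (fun h : R => h^-1 *: ((sqp \o shift 0) (h *: (1 : R)) - sqp 0)) @ 0^' --> (0 : R).
    apply: cvg_trans (_ : (fun h : R => Num.max h 0) @ 0^' `=>` _).
      apply: near_eq_cvg; near=> h.
      have h0 : h != 0 by near: h; exact: nbhs_dnbhs_neq.
      rewrite /= /sqp m0 addr0 expr0n subr0 /GRing.scale /= mulr1.
      case: (leP h 0) => hh; first by rewrite expr0n mulr0.
      by rewrite expr2 mulrA mulVf// mul1r.
    apply/cvgr0Pnorm_lt => e e0; near=> h.
    have he : `|h| < e by near: h; apply: dnbhs0_lt.
    by case: (leP h 0) => hh; rewrite ?normr0.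
  rewrite mulr0; apply: DeriveDef; [by apply/cvg_ex; exists 0|exact: cvg_lim].
Unshelve. all: by end_near. Qed.

Definition line (x d : R4) (t : R) : R4 := x + t *: d.

(** Exactly what the divergence theorem below consumes, with [P] as gradient: derivatives and
    continuity along lines for the fundamental theorem of calculus, joint measurability and local
    bounds for Fubini. *)
Definition smooth (w : R4 -> R) (P : 'I_4 -> R4 -> R) : Prop :=
 [/\ forall x d t, is_derive t (1 : R) (fun s => w (line x d s))
       (d 0 0 * P 0 (line x d t) + d 1 0 * P 1 (line x d t) +
        d 2 0 * P 2 (line x d t) + d 3 0 * P 3 (line x d t)),
     forall i x d, continuous (fun s : R => P i (line x d s)),
     measurable_fun setT (fun s : R * R3 => w (four s.1 s.2)) /\
     forall i, measurable_fun setT (fun s : R * R3 => P i (four s.1 s.2))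
   & forall M : R, exists2 K : R, 0 < K & forall s x, `|s| <= M -> box M x ->
      `|w (four s x)| <= K /\ forall i, `|P i (four s x)| <= K].

Lemma smooth_line_continuous w P x d : smooth w P -> continuous (fun s : R => w (line x d s)).
Proof. by move=> [H _ _ _]; apply: is_derive_continuous (H x d). Qed.

Lemma smoothD w P u Q : smooth w P -> smooth u Q ->
  smooth (fun x => w x + u x) (fun i x => P i x + Q i x).
Proof.
move=> sw su; have [w1 w2 [w3 w3'] w4] := sw; have [u1 u2 [u3 u3'] u4] := su; split.
- move=> x d t; apply: eq_is_derive (is_deriveD_fun (w1 x d t) (u1 x d t)) _.
  ring.
- by move=> i x d t; apply: cvgD; [exact: w2|exact: u2].
- by split=> [|i]; apply: measurable_funD.
- move=> M; have [K K0 HK] := w4 M; have [L L0 HL] := u4 M; exists (K + L); first exact: addr_gt0.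
  move=> s x sM xM; have [a1 a2] := HK s x sM xM; have [b1 b2] := HL s x sM xM.
  by split=> [|i]; apply: le_trans (ler_normD _ _) _; rewrite lerD.
Qed.

Lemma smoothM w P u Q : smooth w P -> smooth u Q ->
  smooth (fun x => w x * u x) (fun i x => P i x * u x + w x * Q i x).
Proof.
move=> sw su; have [w1 w2 [w3 w3'] w4] := sw; have [u1 u2 [u3 u3'] u4] := su; split.
- move=> x d t; apply: eq_is_derive (is_deriveM_fun (w1 x d t) (u1 x d t)) _.
  rewrite /=; ring.
- move=> i x d t; apply: cvgD; apply: cvgM; by [exact: w2|exact: u2|exact: smooth_line_continuous sw _|exact: smooth_line_continuous su _].
- by split=> [|i]; [|apply: measurable_funD]; apply: measurable_funM.
- move=> M; have [K K0 HK] := w4 M; have [L L0 HL] := u4 M; exists (2 * (K * L)); first by rewrite !mulr_gt0.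
  have KL : 0 < K * L by exact: mulr_gt0.
  move=> s x sM xM; have [a1 a2] := HK s x sM xM; have [b1 b2] := HL s x sM xM.
  split=> [|i]; first by rewrite normrM; apply: le_trans (ler_pM _ _ a1 b1) _ => //; lra.
  apply: le_trans (ler_normD _ _) _; rewrite !normrM.
  have := ler_pM (normr_ge0 _) (normr_ge0 _) (a2 i) b1.
  have := ler_pM (normr_ge0 _) (normr_ge0 _) a1 (b2 i).
  lra.
Qed.

Lemma smooth_cst (c : R) : smooth (fun=> c) (fun _ _ => 0).
Proof.
split.
- by move=> x d t; apply: eq_is_derive (is_derive_cst _ _ _) _; ring.
- by move=> i x d t; exact: cvg_cst.
- by split => *; exact: measurable_cst.
- move=> M; exists (`|c| + 1); first by rewrite ltr_pwDr.
  by move=> s x _ _; split=> *; rewrite ?normr0 ?lerDl ?addr_ge0.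
Qed.

Lemma smooth_comp (f df : R -> R) w P : (forall t, is_derive t (1 : R) f (df t)) ->
  continuous df -> (forall M : R, exists2 K : R, 0 < K & forall t, `|t| <= M -> `|f t| <= K /\ `|df t| <= K) ->
  smooth w P -> smooth (fun x => f (w x)) (fun i x => df (w x) * P i x).
Proof.
move=> fd cdf fb sw; have [w1 w2 [w3 w3'] w4] := sw.
have cf := is_derive_continuous fd.
have mf : measurable_fun setT f by exact: continuous_measurable_fun.
have mdf : measurable_fun setT df by exact: continuous_measurable_fun.
split.
- move=> x d t; apply: eq_is_derive (is_derive_comp_fun (fd _) (w1 x d t)) _.
  rewrite /=; ring.
- move=> i x d t; apply: cvgM; last exact: w2.
  apply: (@continuous_comp _ _ _ (fun s => w (line x d s)) df); last exact: cdf.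
  exact: (smooth_line_continuous sw).
- split=> [|i]; first exact: (measurableT_comp mf w3).
  by apply: measurable_funM => //; exact: (measurableT_comp mdf w3).
- move=> M; have [K K0 HK] := w4 M; have [L L0 HL] := fb K; exists (L + L * K).
    by rewrite addr_gt0// mulr_gt0.
  move=> s x sM xM; have [a1 a2] := HK s x sM xM; have [b1 b2] := HL _ a1.
  split=> [|i]; first by rewrite ler_wpDr// ltW// mulr_gt0.
  by rewrite normrM ler_wpDl ?(ltW L0)// ler_pM.
Qed.

Lemma smooth_coord (j : 'I_4) : smooth (fun x : R4 => x j 0) (fun i _ => (i == j)%:R).
Proof.
split.
- move=> x d t; have -> : (fun s => line x d s j 0) = (fun s => x j 0 + d j 0 * s).
    by apply/funext => s; rewrite !mxE mulrC.
  apply: eq_is_derive (is_derive_affine _ _ _) _.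
  by move: j; apply: ord4_cases => /=; rewrite ?eqxx /=; ring.
- by move=> i x d t; exact: cvg_cst.
- split => [|i]; last exact: measurable_cst.
  apply: (@measurable_four _ _ _ (fun s : R * R3 => s.1) (fun s => s.2)).
    exact: measurable_fst.
  exact: measurable_snd.
- move=> M; exists (`|M| + 1); first by rewrite ltr_pwDr.
  move=> s x sM [x1 x2 x3]; split.
    apply: (@le_trans _ _ M); last by apply: le_trans (ler_norm _) _; rewrite lerDl.
    by move: j; apply: ord4_cases; rewrite ?four0 ?four1 ?four2 ?four3.
  by move=> i; case: (i == j); rewrite ?normr1 ?normr0 ?lerDr// addr_ge0.
Qed.

Lemma smooth_sum_coord (c : 'I_4 -> R) :
  smooth (fun x : R4 => c 0 * x 0 0 + c 1 * x 1 0 + c 2 * x 2 0 + c 3 * x 3 0) (fun i _ => c i).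
Proof.
have Z j := smoothM (smooth_cst (c j)) (smooth_coord j).
have := smoothD (smoothD (smoothD (Z 0) (Z 1)) (Z 2)) (Z 3).
congr smooth; apply/funext => i; apply/funext => x.
by move: i; apply: ord4_cases; rewrite !mul0r !add0r /= ?eqxx /=; ring.
Qed.

Lemma eq_smooth w P w' P' : smooth w P -> w =1 w' -> (forall i, P i =1 P' i) -> smooth w' P'.
Proof.
move=> s /funext <- PP; rewrite (_ : P' = P)//.
by apply/funext => i; apply/funext => x; rewrite PP.
Qed.

Definition dwave (c : C) (a : R) : R := - (complex.Re c * sin a) - complex.Im c * cos a.

Lemma smooth_phase (z : R3 * R3) : smooth (phase z)
  (fun i _ => let d := onshell z.2 - onshell z.1 in if i == 0 then d 0 0 else - d i 0).
Proof.
set d := onshell z.2 - onshell z.1.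
apply: eq_smooth (smooth_sum_coord (fun i => if i == 0 then d 0 0 else - d i 0)) _ _ => //.
by move=> x; rewrite /phase /mink -/d /=; ring.
Qed.

Lemma smooth_wave (c : C) (z : R3 * R3) : smooth (fun x => wave c (phase z x))
  (fun i x => let d := onshell z.2 - onshell z.1 in
    dwave c (phase z x) * (if i == 0 then d 0 0 else - d i 0)).
Proof.
apply: (smooth_comp (f := wave c) (df := dwave c) _ _ _ (smooth_phase z)).
- move=> t; have h1 := is_deriveM_fun (is_derive_cst (complex.Re c) t 1) (is_derive_cos t).
  have h2 := is_deriveM_fun (is_derive_cst (- complex.Im c) t 1) (is_derive_sin t).
  have -> : wave c = (fun s => cst (complex.Re c) s * cos s + cst (- complex.Im c) s * sin s).
    by apply/funext => s; rewrite /wave /= mulNr.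
  by apply: eq_is_derive (is_deriveD_fun h1 h2) _; rewrite /dwave /=; ring.
- move=> t; apply: cvgB; first apply: cvgN; apply: cvgM; try exact: cvg_cst.
    exact: continuous_sin.
  exact: continuous_cos.
- move=> M; exists (2 * (1 + normsq c)); first by rewrite mulr_gt0// ltr_pwDl// normsq_ge0.
  move=> t _; split; first exact: wave_bound.
  (* The derivative is again a wave, with reflected phase, so the bound for waves applies to it. *)
  have -> : dwave c t = wave (- c^*%C) (pi / 2 - t).
    by rewrite /dwave /wave cosB sinB cos_pihalf sin_pihalf; case: c => x y /=; ring.
  by apply: le_trans (wave_bound _ _) _; case: c => x y; rewrite /normsq /= !sqrrN.
Qed.

(** [dwave] is linear over the reals in the amplitude, so the divergence of a plane wave is [dwave]
    of the contraction of d with v, which conservation annihilates. *)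
Lemma dwave_sum0 (z : R3 * R3) (v : 'cV[C]_4) (b : C) s : let d := onshell z.2 - onshell z.1 in
  mink (toC d) v = 0 ->
  dwave (v 0 0 * b) s * d 0 0 + dwave (v 1 0 * b) s * - d 1 0 +
  dwave (v 2 0 * b) s * - d 2 0 + dwave (v 3 0 * b) s * - d 3 0 = 0.
Proof.
move=> d H.
transitivity (dwave (mink (toC d) v * b) s); last by rewrite H mul0r /dwave /= !mul0r subr0 oppr0.
rewrite /mink ![toC d _ _]mxE /dwave; move: (v 0 0) (v 1 0) (v 2 0) (v 3 0) b.
by move=> [? ?] [? ?] [? ?] [? ?] [? ?] /=; ring.
Qed.

Lemma smooth_sqp w P : smooth w P ->
  smooth (fun x => sqp (w x)) (fun i x => 2 * Num.max (w x) 0 * P i x).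
Proof.
apply: (@smooth_comp sqp (fun t => 2 * Num.max t 0)).
- exact: is_derive_sqp.
- have cm : continuous (fun t : R => (t + `|t|) / 2).
    by move=> u; apply: cvgM; [apply: cvgD; [exact: cvg_id|exact: norm_continuous]|exact: cvg_cst].
  have {}cm : continuous (fun t : R => Num.max t 0).
    rewrite (_ : (fun t : R => Num.max t 0) = (fun t => (t + `|t|) / 2))//.
    apply/funext => u; case: (leP u 0) => u0; first by rewrite ler0_norm// subrr mul0r.
    by rewrite gtr0_norm//; field.
  by move=> t; apply: cvgM; [exact: cvg_cst|exact: cm].
- move=> M; exists (M ^+ 2 + 2 * `|M| + 1).
    by rewrite ltr_pwDr// addr_ge0// ?sqr_ge0// mulr_ge0.
  move=> t tM; have M0 : 0 <= M by apply: le_trans tM.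
  rewrite (ger0_norm M0); have M2 := sqr_ge0 M.
  have [h0 h1] : 0 <= Num.max t 0 /\ Num.max t 0 <= M.
    by move: tM; rewrite ler_norml => /andP[? ?]; case: (leP t 0) => ?; split => //; lra.
  rewrite /sqp !ger0_norm ?mulr_ge0 ?sqr_ge0//; split; last lra.
  have : Num.max t 0 ^+ 2 <= M ^+ 2 by rewrite ler_sqr.
  lra.
Qed.

Lemma smooth_saturate w P : smooth w P ->
  smooth (fun x => 1 - expR (- w x)) (fun i x => expR (- w x) * P i x).
Proof.
apply: (@smooth_comp (fun t => 1 - expR (- t)) (fun t => expR (- t))).
- move=> t; apply: is_derive_eq; rewrite /GRing.scale /=; ring.
- move=> t; apply: continuous_comp; last exact: continuous_expR.
  by apply: cvgN; exact: cvg_id.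
- move=> M; exists (1 + expR M); first by rewrite addr_gt0// expR_gt0.
  move=> t; rewrite ler_norml => /andP[tM _].
  have e0 := expR_gt0 (- t); have eM : expR (- t) <= expR M by rewrite ler_expR lerNl.
  split; rewrite ler_norml; apply/andP; split; lra.
Qed.

End smooth.

(** * The divergence theorem in the wedge between two hyperplanes *)

Section gauss.
Context {R : realType}.
Local Notation C := R[i].
Local Notation R3 := (R3 R).
Local Notation R4 := 'cV[R]_4.
Local Notation mu3 := (mu3 R).
Local Notation mu6 := (@mu6 R).
Local Notation leb := (@lebesgue_measure R).

Definition seg (c d : R) : set (measurableTypeR R) := `[c, d]%classic.

Lemma measurable_seg c d : measurable (seg c d).
Proof. exact: measurable_itv. Qed.

Lemma leb_seg c d : (leb (seg c d) < +oo)%E.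
Proof. by rewrite lebesgue_measure_itv; case: ifP => _; rewrite ltry. Qed.

Lemma ftc_seg (F f : R -> R) c d : c < d -> (forall t, is_derive t (1 : R) F (f t)) ->
  continuous f -> \int[leb]_t (f t * \1_(seg c d) t) = F d - F c.
Proof.
move=> cd Ff cf; have cF := is_derive_continuous Ff.
transitivity (\int[leb]_(t in `[c, d]) f t).
  rewrite [RHS]Rintegral_mkcond; apply: eq_Rintegral => t _; rewrite patchE indicE /seg.
  by case: ifP => _; rewrite ?mulr1 ?mulr0.
rewrite /Rintegral (@continuous_FTC2 _ f F c d cd)//.
- by apply: continuous_subspaceT.
- split => [x _||]; first by have [] := Ff x.
    by apply: cvg_at_right_filter; exact: cF.
  by apply: cvg_at_left_filter; exact: cF.
- by move=> x _; rewrite derive1E; apply: derive_val.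
Qed.

Lemma ftc_seg0 (F f : R -> R) c d (k : R) : c < d -> (forall t, is_derive t (1 : R) F (f t)) ->
  continuous f -> k = 0 \/ k = 1 /\ F d = F c ->
  \int[leb]_t (f t * (\1_(seg c d) t * k)) = 0.
Proof.
move=> cd Ff cf [->|[-> FF]].
  under eq_Rintegral do rewrite !mulr0.
  by rewrite Rintegral_cst// mul0r.
under eq_Rintegral do rewrite mulr1.
by rewrite (ftc_seg cd Ff cf) FF subrr.
Qed.

Lemma line_coord1 (s x1 x2 x3 t : R) : line (four s (x1, x2, x3)) (four 0 (1, 0, 0)) t = four s (x1 + t, x2, x3).
Proof. by apply: col4P; rewrite /line !fourE !mxE /=; split; ring. Qed.

Lemma line_coord2 (s x1 x2 x3 t : R) : line (four s (x1, x2, x3)) (four 0 (0, 1, 0)) t = four s (x1, x2 + t, x3).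
Proof. by apply: col4P; rewrite /line !fourE !mxE /=; split; ring. Qed.

Lemma line_coord3 (s b x1 x2 x3 t : R) : line (four s (x1, x2, x3)) (four b (0, 0, 1)) t =
  four (s + b * t) (x1, x2, x3 + t).
Proof. by apply: col4P; rewrite /line !fourE !mxE /=; split; ring. Qed.

Lemma indic_cases (T : Type) (D : set T) x : (\1_D x = 0 :> R) \/ (\1_D x = 1 :> R) /\ D x.
Proof.
by rewrite indicE; case: (pselect (D x)) => Dx; [right; rewrite mem_set|left; rewrite memNset].
Qed.

Lemma seg_l c d : c < d -> seg c d c. Proof. by move=> cd; rewrite /seg /= in_itv /= lexx ltW. Qed.
Lemma seg_r c d : c < d -> seg c d d. Proof. by move=> cd; rewrite /seg /= in_itv /= lexx ltW. Qed.

Section bounded_on.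
Context d (X : measurableType d).

Definition bounded_on (D : set X) (f : X -> R) : Prop :=
  measurable_fun setT f /\ exists K : R, forall x, D x -> `|f x| <= K.

Lemma bounded_onD D f g : bounded_on D f -> bounded_on D g -> bounded_on D (fun x => f x + g x).
Proof.
move=> [mf [K HK]] [mg [L HL]]; split; first exact: measurable_funD.
by exists (K + L) => x Dx; apply: le_trans (ler_normD _ _) _; rewrite lerD ?HK ?HL.
Qed.

Lemma bounded_onB D f g : bounded_on D f -> bounded_on D g -> bounded_on D (fun x => f x - g x).
Proof.
move=> [mf [K HK]] [mg [L HL]]; split; first exact: measurable_funB.
by exists (K + L) => x Dx; apply: le_trans (ler_normB _ _) _; rewrite lerD ?HK ?HL.
Qed.

Lemma bounded_onM D f g : bounded_on D f -> bounded_on D g -> bounded_on D (fun x => f x * g x).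
Proof.
move=> [mf [K HK]] [mg [L HL]]; split; first exact: measurable_funM.
by exists (K * L) => x Dx; rewrite normrM ler_pM ?HK ?HL.
Qed.

Lemma bounded_on_cst D c : bounded_on D (fun=> c).
Proof. by split; [exact: measurable_cst|exists `|c|]. Qed.

Lemma integrable_bounded_on (m : {measure set X -> \bar R}) D f : measurable D ->
  (m D < +oo)%E -> bounded_on D f -> m.-integrable setT (EFin \o (fun x => f x * \1_D x)).
Proof.
move=> mD fD [mf [K HK]].
apply: (bounded_integrable (A := D) (M := K)) => //.
  by apply: measurable_funM => //; exact: measurable_indic.
move=> x; rewrite indicE; case: (pselect (D x)) => Dx.
  by rewrite mem_set// !mulr1 HK.
by rewrite memNset// !mulr0 normr0.
Qed.

End bounded_on.

Lemma Rintegral_zero3 (g : R3 -> R) : mu3.-integrable setT (EFin \o g) ->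
  (forall u, \int[leb]_y g (u, y) = 0) -> \int[mu3]_x g x = 0.
Proof.
move=> ig g0; rewrite (@Rintegral_product _ _ _ _ _ (@sigma_finite_mu2 R) leb g ig).
under eq_Rintegral do rewrite g0.
by rewrite Rintegral_cst// mul0r.
Qed.

Lemma Rintegral_zero1 (g : R3 -> R) : mu3.-integrable setT (EFin \o g) ->
  (forall x2 x3, \int[leb]_y g (y, x2, x3) = 0) -> \int[mu3]_x g x = 0.
Proof.
move=> ig g0; have mg : measurable_fun setT g by case/integrableP: ig => /measurable_EFinP.
rewrite -(preserves_Rintegral (@preserves_swap13 R) mg).
apply: Rintegral_zero3; first exact: (preserves_integrable (@preserves_swap13 R) ig).
by move=> [u1 u2]; rewrite -[RHS](g0 u2 u1); apply: eq_Rintegral => y _; rewrite mulr1.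
Qed.

Lemma Rintegral_zero2 (g : R3 -> R) : mu3.-integrable setT (EFin \o g) ->
  (forall x1 x3, \int[leb]_y g (x1, y, x3) = 0) -> \int[mu3]_x g x = 0.
Proof.
move=> ig g0; have mg : measurable_fun setT g by case/integrableP: ig => /measurable_EFinP.
rewrite -(preserves_Rintegral (@preserves_swap12 R) mg).
apply: Rintegral_zero1; first exact: (preserves_integrable (@preserves_swap12 R) ig).
by move=> x2 x3; rewrite -[RHS](g0 x2 x3); apply: eq_Rintegral => y _; rewrite mulr1.
Qed.

Section wedge.
Variables (a b M alpha beta : R).
Hypothesis M0 : 0 < M.
Hypothesis ab : alpha < beta.

Definition height (x : R3) : R := a + b * x.2.
(** Coordinates on the wedge, from time zero (theta = 0) to the tilted plane (theta = 1). Their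
    Jacobian is [height x], kept with its sign so that wedges above and below time zero are treated
    together. *)
Definition slab (theta : R) (x : R3) : R4 := four (theta * height x) x.
Definition brick : set R3 := seg (- M) M `*` seg (- M) M `*` seg alpha beta.

Lemma brickE x1 x2 x3 : \1_brick (x1, x2, x3) =
  \1_(seg (- M) M) x1 * \1_(seg (- M) M) x2 * \1_(seg alpha beta) x3 :> R.
Proof.
rewrite !indicE -!natrM !mulnb; congr (nat_of_bool _)%:R.
apply/idP/idP => [|/andP[/andP[]]].
  by rewrite inE => -[[h1 h2] h3]; rewrite !mem_set.
by rewrite !inE.
Qed.

Definition mu4 := sigma_finite_product (@sigma_finite_mu3 R) leb.
Local Notation unit := (seg 0 1).
Local Notation wedge := (brick `*` unit).

Lemma measurable_brick : measurable brick.
Proof. by apply: measurableX; [apply: measurableX|]; exact: measurable_seg. Qed.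

Lemma brick_box : exists N, brick `<=` box N.
Proof.
exists (M + `|alpha| + `|beta|) => -[[x1 x2] x3] [[/=]].
rewrite /seg /= !in_itv /= => /andP[? ?] /andP[? ?] /andP[? ?].
have := ler_norm alpha; have := ler_norm beta.
have := ler_norm (- alpha); have := ler_norm (- beta).
rewrite !normrN => ? ? ? ?; have := normr_ge0 alpha; have := normr_ge0 beta => ? ?.
by split; rewrite /= ler_norml; apply/andP; split; lra.
Qed.

Lemma mu3_brick : (mu3 brick < +oo)%E.
Proof.
have [N BN] := brick_box; apply: le_lt_trans (mu3_box N).
by apply: le_measure => //; rewrite inE; [exact: measurable_brick|exact: measurable_box].
Qed.

Lemma measurable_wedge : measurable wedge.
Proof. by apply: measurableX; [exact: measurable_brick|exact: measurable_seg]. Qed.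

Lemma mu4_wedge : (mu4 wedge < +oo)%E.
Proof.
have -> : mu4 wedge = (mu3 brick * leb unit)%E.
  exact: (product_measure1E (@sigma_finite_mu3 R) leb measurable_brick (@measurable_seg 0 1)).
apply: lte_mul_pinfty => //; first by rewrite ge0_fin_numE//; exact: mu3_brick.
exact: leb_seg.
Qed.

Lemma measurable_height : measurable_fun setT height.
Proof.
apply: measurable_funD; first exact: measurable_cst.
by apply: measurable_funM; [exact: measurable_cst|exact: measurable_coord3].
Qed.

Lemma slab_bounded : exists N, forall theta x, brick x -> unit theta ->
  [/\ `|theta| <= N, `|height x| <= N, `|theta * height x| <= N & box N x].
Proof.
have [N BN] := brick_box; exists (1 + `|a| + `|b| * `|N| + `|N|).
move=> theta x Bx; rewrite /seg /= in_itv /= => /andP[t0 t1].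
have bx := BN _ Bx; have [_ _ x3] := bx.
have a0 := normr_ge0 a; have N0 := normr_ge0 N.
have bN : 0 <= `|b| * `|N| by rewrite mulr_ge0.
have hx : `|height x| <= `|a| + `|b| * `|N|.
  apply: le_trans (ler_normD _ _) _; rewrite lerD2l normrM ler_wpM2l//.
  exact: le_trans (ler_norm _).
split.
- by rewrite ger0_norm//; lra.
- lra.
- rewrite normrM ger0_norm//; have := ler_pM t0 (normr_ge0 _) t1 (lexx `|height x|); lra.
- apply: box_le bx; have := ler_norm N; lra.
Qed.

Lemma smooth_bounded_on w P : smooth w P ->
  bounded_on wedge (fun y => w (slab y.2 y.1)) /\
  forall i, bounded_on wedge (fun y => P i (slab y.2 y.1)).
Proof.
move=> [_ _ [mw mP] bw]; have [N HN] := slab_bounded; have [K _ HK] := bw N.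
have ms : measurable_fun setT (fun y : R3 * measurableTypeR R => ((y.2 * height y.1 : measurableTypeR R), y.1)).
  apply: measurable_fun_pair => //; apply: measurable_funM => //.
  exact: (measurableT_comp measurable_height).
split=> [|i]; split.
- exact: (measurableT_comp mw ms).
- by exists K => -[x t] [Bx It]; have [_ _ ? ?] := HN _ _ Bx It; have [] := HK (t * height x) x.
- exact: (measurableT_comp (mP i) ms).
- by exists K => -[x t] [Bx It]; have [_ _ ? ?] := HN _ _ Bx It; have [//|//|_ /(_ i)] := HK (t * height x) x.
Qed.

Lemma bounded_on_height : bounded_on wedge (fun y => height y.1).
Proof.
split; first exact: (measurableT_comp measurable_height).
by have [N HN] := slab_bounded; exists N => -[x t] [Bx It]; have [] := HN _ _ Bx It.
Qed.

Lemma bounded_on_theta : bounded_on wedge (fun y => y.2 : R).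
Proof.
split; first exact: measurable_snd.
by have [N HN] := slab_bounded; exists N => -[x t] [Bx It]; have [] := HN _ _ Bx It.
Qed.

Lemma bounded_on_section f t : bounded_on wedge f -> unit t ->
  bounded_on brick (fun x => f (x, t)).
Proof.
move=> [mf [K HK]] It; split; first exact: (measurableT_comp mf (measurable_pair2 t)).
by exists K => x Bx; apply: HK.
Qed.

Variables (G : 'I_4 -> R4 -> R) (Q : 'I_4 -> 'I_4 -> R4 -> R).
Hypothesis sG : forall i, smooth (G i) (Q i).
Hypothesis G1_0 : forall theta x, brick x -> unit theta -> `|x.1.1| = M -> G 1 (slab theta x) = 0.
Hypothesis G2_0 : forall theta x, brick x -> unit theta -> `|x.1.2| = M -> G 2 (slab theta x) = 0.
(** The product covers both kinds of ends: the edge of the wedge, where the height vanishes, and an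
    end beyond the support of the field. *)
Hypothesis G3_0 : forall theta x, brick x -> unit theta -> x.2 = alpha \/ x.2 = beta ->
  height x * G 3 (slab theta x) = 0.

Lemma zero_wedge (f : R3 * R -> R) : bounded_on wedge f ->
  (forall t, unit t -> \int[mu3]_x (f (x, t) * \1_brick x) = 0) ->
  \int[mu4]_y (f y * \1_wedge y) = 0.
Proof.
move=> bf H.
have iF := integrable_bounded_on measurable_wedge mu4_wedge bf.
rewrite (Rintegral_product2 iF).
rewrite (_ : (fun _ => _) = fun=> 0); first by rewrite Rintegral_cst// mul0r.
apply/funext => t; case: (pselect (unit t)) => It.
  rewrite -[RHS](H t It); apply: eq_Rintegral => x _; congr (_ * _).
  rewrite !indicE; congr (nat_of_bool _)%:R; apply/idP/idP; rewrite !inE /=; tauto.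
under eq_Rintegral => x _.
  rewrite indicE memNset ?mulr0; last by case. over.
by rewrite Rintegral_cst// mul0r.
Qed.

Lemma flux1 : \int[mu4]_y (height y.1 * Q 1 1 (slab y.2 y.1) * \1_wedge y) = 0.
Proof.
have bf : bounded_on wedge (fun y => height y.1 * Q 1 1 (slab y.2 y.1)).
  by apply: bounded_onM; [exact: bounded_on_height|have [_] := smooth_bounded_on (sG 1)].
apply: zero_wedge => // t It /=.
apply: Rintegral_zero1.
  apply: integrable_bounded_on; [exact: measurable_brick|exact: mu3_brick|].
  exact: (bounded_on_section bf It).
move=> x2 x3.
have MM : - M < M by rewrite gtrN.
pose F y := height (y, x2, x3) * G 1 (slab t (y, x2, x3)).
pose f y := height (y, x2, x3) * Q 1 1 (slab t (y, x2, x3)).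
have sE y : slab t (y, x2, x3) = line (four (t * (a + b * x3)) (0, x2, x3)) (four 0 (1, 0, 0)) y.
  by rewrite line_coord1 add0r.
have [G1d G1c _ _] := sG 1.
rewrite (eq_Rintegral _ (g := fun y => f y * (\1_(seg (- M) M) y * (\1_(seg (- M) M) x2 * \1_(seg alpha beta) x3)))); last first.
  by move=> y _; rewrite brickE !mulrA.
apply: (@ftc_seg0 F f) => //.
- move=> y; rewrite /F /f /height /=; under eq_fun do rewrite sE.
  have hk : is_derive y (1 : R) (fun _ : R => a + b * x3) 0 by exact: is_derive_cst.
  rewrite sE; apply: eq_is_derive (is_deriveM_fun hk (G1d _ _ _)) _.
  by rewrite !fourE /=; ring.
- rewrite /f /height /=; under eq_fun do rewrite sE.
  by move=> y; apply: cvgM; [exact: cvg_cst|exact: G1c].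
- have [->|[-> I2]] := indic_cases (seg (- M) M) x2; first by left; rewrite mul0r.
  have [->|[-> I3]] := indic_cases (seg alpha beta) x3; first by left; rewrite mulr0.
  right; split; first by rewrite mulr1.
  rewrite /F !G1_0 ?mulr0//=; [by split => //; split => //; exact: seg_l|by rewrite normrN gtr0_norm|
    by split => //; split => //; exact: seg_r|by rewrite gtr0_norm].
Qed.

Lemma flux2 : \int[mu4]_y (height y.1 * Q 2 2 (slab y.2 y.1) * \1_wedge y) = 0.
Proof.
have bf : bounded_on wedge (fun y => height y.1 * Q 2 2 (slab y.2 y.1)).
  by apply: bounded_onM; [exact: bounded_on_height|have [_] := smooth_bounded_on (sG 2)].
apply: zero_wedge => // t It /=.
apply: Rintegral_zero2.
  apply: integrable_bounded_on; [exact: measurable_brick|exact: mu3_brick|].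
  exact: (bounded_on_section bf It).
move=> x1 x3.
have MM : - M < M by rewrite gtrN.
pose F y := height (x1, y, x3) * G 2 (slab t (x1, y, x3)).
pose f y := height (x1, y, x3) * Q 2 2 (slab t (x1, y, x3)).
have sE y : slab t (x1, y, x3) = line (four (t * (a + b * x3)) (x1, 0, x3)) (four 0 (0, 1, 0)) y.
  by rewrite line_coord2 add0r.
have [G1d G1c _ _] := sG 2.
rewrite (eq_Rintegral _ (g := fun y => f y * (\1_(seg (- M) M) y * (\1_(seg (- M) M) x1 * \1_(seg alpha beta) x3)))); last first.
  by move=> y _; rewrite brickE /f /=; ring.
apply: (@ftc_seg0 F f) => //.
- move=> y; rewrite /F /f /height /=; under eq_fun do rewrite sE.
  have hk : is_derive y (1 : R) (fun _ : R => a + b * x3) 0 by exact: is_derive_cst.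
  rewrite sE; apply: eq_is_derive (is_deriveM_fun hk (G1d _ _ _)) _.
  by rewrite !fourE /=; ring.
- rewrite /f /height /=; under eq_fun do rewrite sE.
  by move=> y; apply: cvgM; [exact: cvg_cst|exact: G1c].
- have [->|[-> I2]] := indic_cases (seg (- M) M) x1; first by left; rewrite mul0r.
  have [->|[-> I3]] := indic_cases (seg alpha beta) x3; first by left; rewrite mulr0.
  right; split; first by rewrite mulr1.
  rewrite /F !G2_0 ?mulr0//=; [by split => //; split => //; exact: seg_l|by rewrite normrN gtr0_norm|
    by split => //; split => //; exact: seg_r|by rewrite gtr0_norm].
Qed.

(** Moving in the third direction also changes the height, whence the terms with b; they cancel
    those of [flux0] in the sum. *)
Lemma flux3 : \int[mu4]_y ((b * G 3 (slab y.2 y.1) +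
  height y.1 * (Q 3 3 (slab y.2 y.1) + y.2 * b * Q 3 0 (slab y.2 y.1))) * \1_wedge y) = 0.
Proof.
have [b3 b3'] := smooth_bounded_on (sG 3).
have bf : bounded_on wedge (fun y => b * G 3 (slab y.2 y.1) +
  height y.1 * (Q 3 3 (slab y.2 y.1) + y.2 * b * Q 3 0 (slab y.2 y.1))).
  apply: bounded_onD; first by apply: bounded_onM => //; exact: bounded_on_cst.
  apply: bounded_onM; first exact: bounded_on_height.
  apply: bounded_onD => //; apply: bounded_onM => //.
  by apply: bounded_onM; [exact: bounded_on_theta|exact: bounded_on_cst].
apply: zero_wedge => // t It /=.
apply: Rintegral_zero3.
  apply: integrable_bounded_on; [exact: measurable_brick|exact: mu3_brick|].
  exact: (bounded_on_section bf It).
move=> [x1 x2].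
pose F y := height (x1, x2, y) * G 3 (slab t (x1, x2, y)).
pose f y := b * G 3 (slab t (x1, x2, y)) +
  height (x1, x2, y) * (Q 3 3 (slab t (x1, x2, y)) + t * b * Q 3 0 (slab t (x1, x2, y))).
have sE y : slab t (x1, x2, y) = line (four (t * a) (x1, x2, 0)) (four (t * b) (0, 0, 1)) y.
  by rewrite line_coord3 add0r /slab /height /=; congr four; ring.
have [G1d G1c _ _] := sG 3; have cG x0 d0 := smooth_line_continuous (x := x0) (d := d0) (sG 3).
rewrite (eq_Rintegral _ (g := fun y => f y * (\1_(seg alpha beta) y * (\1_(seg (- M) M) x1 * \1_(seg (- M) M) x2)))); last first.
  by move=> y _; rewrite brickE /f /=; ring.
apply: (@ftc_seg0 F f) => //.
- move=> y; rewrite /F /f /height /=; under eq_fun do rewrite sE.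
  rewrite sE; apply: eq_is_derive (is_deriveM_fun (is_derive_affine _ _ _) (G1d _ _ _)) _.
  by rewrite !fourE /=; ring.
- rewrite /f /height /=; under eq_fun do rewrite sE.
  move=> y; apply: cvgD; first by apply: cvgM; [exact: cvg_cst|exact: cG].
  apply: cvgM.
    by apply: cvgD; [exact: cvg_cst|apply: cvgM; [exact: cvg_cst|exact: cvg_id]].
  apply: cvgD; first exact: G1c.
  by apply: cvgM; [exact: cvg_cst|exact: G1c].
- have [->|[-> I2]] := indic_cases (seg (- M) M) x1; first by left; rewrite mul0r.
  have [->|[-> I3]] := indic_cases (seg (- M) M) x2; first by left; rewrite mulr0.
  right; split; first by rewrite mulr1.
  rewrite /F !G3_0//=; [by split => //; exact: seg_l|by left|
    by split => //; exact: seg_r|by right].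
Qed.

Lemma flux0 : \int[mu4]_y ((height y.1 * (Q 0 0 (slab y.2 y.1) - y.2 * b * Q 3 0 (slab y.2 y.1)) -
    b * G 3 (slab y.2 y.1)) * \1_wedge y) =
  \int[mu3]_x ((G 0 (slab 1 x) - b * G 3 (slab 1 x) - G 0 (slab 0 x)) * \1_brick x).
Proof.
have [b0 b0'] := smooth_bounded_on (sG 0).
have [b3 b3'] := smooth_bounded_on (sG 3).
pose f0 (y : R3 * R) := height y.1 * (Q 0 0 (slab y.2 y.1) - y.2 * b * Q 3 0 (slab y.2 y.1)) -
    b * G 3 (slab y.2 y.1).
have bf : bounded_on wedge f0.
  apply: bounded_onB; last by apply: bounded_onM => //; exact: bounded_on_cst.
  apply: bounded_onM; first exact: bounded_on_height.
  apply: bounded_onB => //; apply: bounded_onM => //.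
  by apply: bounded_onM; [exact: bounded_on_theta|exact: bounded_on_cst].
rewrite (Rintegral_product (integrable_bounded_on measurable_wedge mu4_wedge bf)).
apply: eq_Rintegral => x _ /=.
have [B0|[B1 Bx]] := indic_cases brick x.
  rewrite B0 mulr0 (_ : (fun _ => _) = fun=> 0); first by rewrite Rintegral_cst// mul0r.
  apply/funext => t; rewrite indicE memNset ?mulr0// => -[Bx _].
  by move: B0; rewrite indicE mem_set//; apply/eqP; rewrite oner_eq0.
rewrite B1 mulr1.
(* The flux density through the leaf at parameter t, a plane of slope t b. *)
pose F t := G 0 (slab t x) - t * b * G 3 (slab t x).
have sE t : slab t x = line (four 0 x) (four (height x) 0) t.
  by apply: col4P; rewrite /slab /line !fourE !mxE /=; split; ring.
have [G0d G0c _ _] := sG 0; have [G3d G3c _ _] := sG 3.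
have cG x0 d0 := smooth_line_continuous (x := x0) (d := d0) (sG 3).
transitivity (\int[leb]_t (f0 (x, t) * \1_(seg 0 1) t)).
  apply: eq_Rintegral => t _; congr (_ * _); rewrite !indicE; congr (nat_of_bool _)%:R.
  by apply/idP/idP; rewrite !inE /=; tauto.
have Fd t : is_derive t (1 : R) F (f0 (x, t)).
  rewrite /F /f0 /=; under eq_fun do rewrite sE.
  rewrite sE.
  have h1 := is_deriveM_fun (is_derive_affine 0 (- b) t) (G3d (four 0 x) (four (height x) 0) t).
  have H := is_deriveD_fun (G0d (four 0 x) (four (height x) 0) t) h1.
  rewrite (_ : (fun s => _) = (fun s => G 0 (line (four 0 x) (four (height x) 0) s) +
    (0 + - b * s) * G 3 (line (four 0 x) (four (height x) 0) s))).
    by apply: eq_is_derive H _; rewrite !fourE /=; ring.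
  by apply/funext => s; ring.
have cf : continuous (fun t : R => f0 (x, t)).
  rewrite /f0 /=; under eq_fun do rewrite sE.
  move=> y; apply: cvgB; last by apply: cvgM; [exact: cvg_cst|exact: cG].
  apply: cvgM; first exact: cvg_cst.
  apply: cvgB; first exact: G0c.
  by apply: cvgM; [apply: cvgM; [exact: cvg_id|exact: cvg_cst]|exact: G3c].
by rewrite (ftc_seg ltr01 Fd cf) /F; ring.
Qed.

Lemma divergence_theorem :
  \int[mu3]_x ((G 0 (slab 1 x) - b * G 3 (slab 1 x) - G 0 (slab 0 x)) * \1_brick x) =
  \int[mu4]_y (height y.1 * (Q 0 0 (slab y.2 y.1) + Q 1 1 (slab y.2 y.1) +
    Q 2 2 (slab y.2 y.1) + Q 3 3 (slab y.2 y.1)) * \1_wedge y).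
Proof.
have [b0 b0'] := smooth_bounded_on (sG 0); have [b1 b1'] := smooth_bounded_on (sG 1).
have [b2 b2'] := smooth_bounded_on (sG 2); have [b3 b3'] := smooth_bounded_on (sG 3).
have bh := bounded_on_height; have bt := bounded_on_theta.
have bc c := @bounded_on_cst _ (R3 * measurableTypeR R)%type wedge c.
pose f0 (y : R3 * R) := height y.1 * (Q 0 0 (slab y.2 y.1) - y.2 * b * Q 3 0 (slab y.2 y.1)) -
    b * G 3 (slab y.2 y.1).
pose f1 (y : R3 * R) := height y.1 * Q 1 1 (slab y.2 y.1).
pose f2 (y : R3 * R) := height y.1 * Q 2 2 (slab y.2 y.1).
pose f3 (y : R3 * R) := b * G 3 (slab y.2 y.1) +
  height y.1 * (Q 3 3 (slab y.2 y.1) + y.2 * b * Q 3 0 (slab y.2 y.1)).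
have int f (bf : bounded_on wedge f) := integrable_bounded_on measurable_wedge mu4_wedge bf.
have bb i : bounded_on wedge (fun y => y.2 * b * Q 3 i (slab y.2 y.1)).
  by apply: bounded_onM => //; apply: bounded_onM.
have i0 : mu4.-integrable setT (EFin \o (fun y => f0 y * \1_wedge y)).
  apply: int; apply: bounded_onB; last exact: bounded_onM.
  by apply: bounded_onM => //; exact: bounded_onB.
have i1 : mu4.-integrable setT (EFin \o (fun y => f1 y * \1_wedge y)).
  by apply: int; apply: bounded_onM.
have i2 : mu4.-integrable setT (EFin \o (fun y => f2 y * \1_wedge y)).
  by apply: int; apply: bounded_onM.
have i3 : mu4.-integrable setT (EFin \o (fun y => f3 y * \1_wedge y)).
  apply: int; apply: bounded_onD; first exact: bounded_onM.
  by apply: bounded_onM => //; exact: bounded_onD.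
rewrite -flux0.
transitivity (\int[mu4]_y (f0 y * \1_wedge y + f1 y * \1_wedge y + f2 y * \1_wedge y + f3 y * \1_wedge y)).
  have i01 := integrable_add i0 i1; have i012 := integrable_add i01 i2.
  rewrite (RintegralD _ i012 i3)// (RintegralD _ i01 i2)// (RintegralD _ i0 i1)//.
  by rewrite flux1 flux2 flux3 !addr0.
by apply: eq_Rintegral => y _; rewrite /f0 /f1 /f2 /f3; ring.
Qed.

End wedge.
End gauss.

(** * The weighted flux of J through the two faces of the wedge *)

Section wedge_flux.
Context {R : realType}.
Local Notation C := R[i].
Local Notation R3 := (R3 R).
Local Notation R4 := 'cV[R]_4.
Local Notation mu3 := (mu3 R).
Local Notation mu6 := (@mu6 R).
Local Notation leb := (@lebesgue_measure R).

Variables (t : R3 -> R3 -> C) (good : set R3) (V : R3 -> R3 -> 'cV[C]_4).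
Hypothesis ck : current_kernel t good V.
Local Notation J := (J V).
Local Notation amplitude := (amplitude V).
Variable f : R3 -> C.
Hypothesis nf : nice f.

Lemma integrable_wave_prod d (X : measurableType d) (m : {sigma_finite_measure set X -> \bar R})
    (D : set X) (c : X -> R) (g : X -> R4) i : measurable D -> (m D < +oo)%E ->
  bounded_on D c -> (forall i, measurable_fun setT (fun x => g x i 0)) ->
  (sigma_finite_product mu6 m).-integrable setT (EFin \o
    (fun y => c y.2 * \1_D y.2 * wave (amplitude f i y.1) (phase y.1 (g y.2)))).
Proof.
move=> mD Dfin [mc [K HK]] mg; have [M M0 HM] := wave_amplitude_bound ck nf.
have mf : cmeasurable f by case: nf.
have mB : measurable (box M `*` box M : set (R3 * R3)) by apply: measurableX; exact: measurable_box.
apply: (bounded_integrable (A := (box M `*` box M) `*` D) (M := `|K| * M)).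
- apply: measurable_funM.
    apply: (measurableT_comp (f := fun x => c x * \1_D x)); last exact: measurable_snd.
    by apply: measurable_funM => //; exact: measurable_indic.
  apply: measurable_wave.
    exact: (cmeasurable_comp (cmeasurable_amplitude ck i mf) measurable_fst).
  apply: measurable_phase; first exact: measurable_fst.
  by move=> j; exact: (measurableT_comp (mg j) measurable_snd).
- exact: measurableX.
- have e : sigma_finite_product mu6 m ((box M `*` box M) `*` D) = (mu6 (box M `*` box M) * m D)%E.
    exact: (product_measure1E mu6 m mB mD).
  have : (mu6 (box M `*` box M) * m D < +oo)%E.
    by apply: lte_mul_pinfty => //; rewrite ge0_fin_numE//; exact: mu6_box.
  by rewrite -e.
- move=> [z x] /=.
  have -> : \1_((box M `*` box M) `*` D) (z, x) = \1_(box M `*` box M) z * \1_D x :> R.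
    rewrite !indicE -natrM mulnb; congr (nat_of_bool _)%:R.
    by apply/idP/idP => [|/andP[]]; rewrite !inE; [case=> ? ?; rewrite !mem_set|].
  rewrite !indicE; case: (pselect (D x)) => Dx; last first.
    by rewrite [x \in D]memNset// !mulr0 mul0r normr0.
  rewrite [x \in D]mem_set// !mulr1 normrM -mulrA ler_pM//.
  exact: le_trans (HK _ Dx) (ler_norm _).
Qed.

Variables (a b M alpha beta : R).
Hypothesis M0 : 0 < M.
Hypothesis ab : alpha < beta.
Local Notation height := (height a b).
Local Notation slab := (slab a b).
Local Notation brick := (brick M alpha beta).
Local Notation unit := (seg 0 1).
Local Notation wedge := (brick `*` unit).
Local Notation mu4 := (@mu4 R).

Variables (w : R4 -> R) (P : 'I_4 -> R4 -> R).
Hypothesis sw : smooth w P.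
Hypothesis w_side : forall theta x, brick x -> unit theta ->
  `|x.1.1| = M \/ `|x.1.2| = M -> w (slab theta x) = 0.
Hypothesis w_end : forall theta x, brick x -> unit theta -> x.2 = alpha \/ x.2 = beta ->
  height x * w (slab theta x) = 0.
Hypothesis w_sign : forall theta x, brick x -> unit theta ->
  height x * (P 0 (slab theta x) * J f (slab theta x) 0 0 + P 1 (slab theta x) * J f (slab theta x) 1 0 +
    P 2 (slab theta x) * J f (slab theta x) 2 0 + P 3 (slab theta x) * J f (slab theta x) 3 0) <= 0.

Lemma measurable_slab i : measurable_fun setT (fun y : R3 * measurableTypeR R => slab y.2 y.1 i 0).
Proof.
apply: measurable_four; last exact: measurable_fst.
apply: measurable_funM => //.
exact: (measurableT_comp (measurable_height a b) measurable_fst).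
Qed.

Lemma measurable_slab_fix theta i : measurable_fun setT (fun x : R3 => slab theta x i 0).
Proof.
exact: (measurableT_comp (measurable_slab i) (measurable_pair2 (theta : measurableTypeR R))).
Qed.

(** Both fluxes become integrals over momenta and position. The divergence identity holds for each
    pair of momenta, whereas the sign is available only after the momentum integral has reassembled
    [J]; Fubini in both orders connects the two. *)
Lemma wedge_flux :
  \int[mu3]_x (w (slab 1 x) * (J f (slab 1 x) 0 0 - b * J f (slab 1 x) 3 0) * \1_brick x) <=
  \int[mu3]_x (w (slab 0 x) * J f (slab 0 x) 0 0 * \1_brick x).
Proof.
pose g i (z : R3 * R3) (x : R4) := wave (amplitude f i z) (phase z x).
have u0 : unit (0 : R) by exact: (@seg_l R 0 1 ltr01).
have u1 : unit (1 : R) by exact: (@seg_r R 0 1 ltr01).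
have [bw bP] := smooth_bounded_on a b M alpha beta sw.
have mB := measurable_brick M alpha beta; have fB := @mu3_brick R M alpha beta.
have mW := measurable_wedge M alpha beta; have fW := @mu4_wedge R M alpha beta.
pose c1 x := w (slab 1 x); pose c0 x := w (slab 0 x).
have bc1 : bounded_on brick c1 by exact: (bounded_on_section bw u1).
have bc0 : bounded_on brick c0 by exact: (bounded_on_section bw u0).
pose mu9 := sigma_finite_product mu6 (@sigma_finite_mu3 R).
pose mu10 := sigma_finite_product mu6 mu4.
pose Phi (y : (R3 * R3) * R3) := c1 y.2 * \1_brick y.2 * g 0 y.1 (slab 1 y.2) +
  (- b * c1 y.2) * \1_brick y.2 * g 3 y.1 (slab 1 y.2) + (-1 * c0 y.2) * \1_brick y.2 * g 0 y.1 (slab 0 y.2).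
have iPhi : mu9.-integrable setT (EFin \o Phi).
  have mS th := measurable_slab_fix th.
  have bc c := @bounded_on_cst R _ R3 brick c.
  have j1 := integrable_wave_prod (m := @sigma_finite_mu3 R) 0 mB fB bc1 (mS 1).
  have j2 := integrable_wave_prod (m := @sigma_finite_mu3 R) 3 mB fB (bounded_onM (bc (- b)) bc1) (mS 1).
  have j3 := integrable_wave_prod (m := @sigma_finite_mu3 R) 0 mB fB (bounded_onM (bc (-1)) bc0) (mS 0).
  exact: (integrable_add (integrable_add j1 j2) j3).
pose k i (y : R3 * R) := height y.1 * P i (slab y.2 y.1).
have bk i : bounded_on wedge (k i).
  by apply: bounded_onM => //; exact: bounded_on_height.
pose Xi (y : (R3 * R3) * (R3 * measurableTypeR R)) := k 0 y.2 * \1_wedge y.2 * g 0 y.1 (slab y.2.2 y.2.1) +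
  k 1 y.2 * \1_wedge y.2 * g 1 y.1 (slab y.2.2 y.2.1) + k 2 y.2 * \1_wedge y.2 * g 2 y.1 (slab y.2.2 y.2.1) +
  k 3 y.2 * \1_wedge y.2 * g 3 y.1 (slab y.2.2 y.2.1).
have iXi : mu10.-integrable setT (EFin \o Xi).
  have j i := integrable_wave_prod (m := mu4) i mW fW (bk i) measurable_slab.
  exact: (integrable_add (integrable_add (integrable_add (j 0) (j 1)) (j 2)) (j 3)).
have ig i x := integrable_wave ck i x nf.
have E1 : \int[mu9]_y Phi y = \int[mu3]_x (c1 x * (J f (slab 1 x) 0 0 - b * J f (slab 1 x) 3 0) * \1_brick x -
   c0 x * J f (slab 0 x) 0 0 * \1_brick x).
  rewrite (Rintegral_product2 iPhi); apply: eq_Rintegral => x _ /=.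
  have iZ c i y := integrable_scale c (ig i y).
  have i1 := integrable_add (iZ (c1 x * \1_brick x) 0 (slab 1 x)) (iZ (- b * c1 x * \1_brick x) 3 (slab 1 x)).
  rewrite /Phi /= (RintegralD _ i1 (iZ _ _ _))// (RintegralD _ (iZ _ _ _) (iZ _ _ _))// !RintegralZl//.
  rewrite ![J _ _ _ _]mxE /g; ring.
have E2 : \int[mu10]_y Xi y <= 0.
  rewrite (Rintegral_product2 iXi).
  have bJ i : bounded_on wedge (fun y => J f (slab y.2 y.1) i 0).
    have [K K0 HK] := J_bounded ck nf; split; last by exists K.
    by apply: (measurable_J ck) => // j; exact: measurable_slab.
  pose S (y : R3 * R) := k 0 y * J f (slab y.2 y.1) 0 0 + k 1 y * J f (slab y.2 y.1) 1 0 +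
    k 2 y * J f (slab y.2 y.1) 2 0 + k 3 y * J f (slab y.2 y.1) 3 0.
  have bS : bounded_on wedge S by do 3 (apply: bounded_onD; last exact: bounded_onM); exact: bounded_onM.
  have -> : \int[mu4]_y \int[mu6]_z Xi (z, y) = \int[mu4]_y (S y * \1_wedge y).
    apply: eq_Rintegral => -[x th] _.
    have iZ c i y := integrable_scale c (ig i y).
    have i1 := integrable_add (iZ (k 0 (x, th) * \1_wedge (x, th)) 0 (slab th x))
                            (iZ (k 1 (x, th) * \1_wedge (x, th)) 1 (slab th x)).
    have i2 := integrable_add i1 (iZ (k 2 (x, th) * \1_wedge (x, th)) 2 (slab th x)).
    rewrite /Xi /= (RintegralD _ i2 (iZ _ _ _))// (RintegralD _ i1 (iZ _ _ _))//.
    rewrite (RintegralD _ (iZ _ _ _) (iZ _ _ _))// !RintegralZl//.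
    by rewrite /S ![J _ _ _ _]mxE /k /g /=; ring.
  have z0 : \int[mu4]_y (0 : R) = 0 by rewrite Rintegral_cst// mul0r.
  rewrite -[leRHS]z0.
  apply: le_Rintegral => //; [exact: (integrable_bounded_on mW fW bS)|exact: integrable0|].
  move=> -[x th] _.
  have [->|[-> [Bx It]]] := @indic_cases R _ wedge (x, th); first by rewrite mulr0.
  have := w_sign Bx It; rewrite mulr1 /S /k /=; apply: le_trans.
  by rewrite le_eqVlt; apply/orP; left; apply/eqP; ring.
(* For good momenta the wave is divergence free, so only derivatives of [w] survive in the bulk;
   pairs with a bad momentum form a null set. *)
have E3 : \int[mu9]_y Phi y = \int[mu10]_y Xi y.
  have mPhi : measurable_fun setT Phi by case/integrableP: iPhi => /measurable_EFinP.
  have mXi : measurable_fun setT Xi by case/integrableP: iXi => /measurable_EFinP.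
  rewrite (Rintegral_product iPhi) (Rintegral_product iXi).
  apply: ae_eq_Rintegral.
  - exact: (@measurable_Rintegral _ _ _ _ _ (@sigma_finite_mu3 R) Phi mPhi).
  - exact: (@measurable_Rintegral _ _ _ _ _ mu4 Xi mXi).
  have [A [mA A0 NA]] := negligible_product (ck_negligible ck).
  exists A; split => //; apply: subset_trans NA => z /= nz.
  apply: contrapT => /not_orP[/contrapT g1 /contrapT g2]; apply: nz => _.
  have sG i := smoothM sw (smooth_wave (amplitude f i z) z).
  rewrite (_ : (fun x => Phi (z, x)) = (fun x => (w (slab 1 x) * g 0 z (slab 1 x) -
      b * (w (slab 1 x) * g 3 z (slab 1 x)) - w (slab 0 x) * g 0 z (slab 0 x)) * \1_brick x)); last first.
    by apply/funext => x; rewrite /Phi /c1 /c0 /=; ring.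
  apply: etrans (@divergence_theorem R a b M alpha beta M0 ab _ _ sG _ _ _) _.
  - by move=> th x Bx It e; rewrite w_side ?mul0r//; left.
  - by move=> th x Bx It e; rewrite w_side ?mul0r//; right.
  - by move=> th x Bx It e; rewrite mulrA w_end ?mul0r.
  - apply: eq_Rintegral => -[x th] _; rewrite /Xi /k /g /=.
    have H := dwave_sum0 ((f z.2)^*%C * f z.1) (phase z (slab th x)) (ck_conserved ck g2 g1).
    rewrite -!/(amplitude f _ z) in H.
    move: H; set d0 := dwave _ _ * _; set d1 := dwave _ _ * _; set d2 := dwave _ _ * _; set d3 := dwave _ _ * _.
    move: d0 d1 d2 d3 => d0 d1 d2 d3 H.
    have -> : d0 = - d1 - d2 - d3 by rewrite -[LHS]addr0 -oppr0 -H; ring.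
    ring.
have bJ th i : bounded_on brick (fun x => J f (slab th x) i 0).
  have [K K0 HK] := J_bounded ck nf; split; last by exists K.
  by apply: (measurable_J ck) => // j; exact: measurable_slab_fix.
have : \int[mu9]_y Phi y <= 0 by rewrite E3.
rewrite E1 RintegralB//; first by rewrite subr_le0.
  apply: integrable_bounded_on => //; apply: bounded_onM => //; apply: bounded_onB => //.
  by apply: bounded_onM => //; exact: bounded_on_cst.
by apply: integrable_bounded_on => //; apply: bounded_onM.
Qed.

End wedge_flux.

(** * Weights built from light cones, monotone along J *)

Section cone_weights.
Context {R : realType}.
Local Notation C := R[i].
Local Notation R3 := (R3 R).
Local Notation R4 := 'cV[R]_4.
Local Notation mu3 := (mu3 R).

(** Positive exactly when x is in the open past cone of r (eta = 1) or the open future cone (eta =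
    -1); the positive part of the time difference discards the opposite cone. *)
Definition cone_gap (eta : R) (r x : R4) : R :=
  sqp (eta * (r 0 0 - x 0 0)) - ((x 1 0 - r 1 0) ^+ 2 + (x 2 0 - r 2 0) ^+ 2 + (x 3 0 - r 3 0) ^+ 2).

Definition cone_weight eta r x := sqp (cone_gap eta r x).

Definition cone_weight_partial eta (r : R4) (i : 'I_4) (x : R4) : R :=
  2 * Num.max (cone_gap eta r x) 0 *
  (if i == 0 then 2 * Num.max (eta * (r 0 0 - x 0 0)) 0 * - eta else -2 * (x i 0 - r i 0)).

Lemma smooth_cone_weight eta r : smooth (cone_weight eta r) (cone_weight_partial eta r).
Proof.
have sc i := smoothD (smooth_coord i) (smooth_cst (- r i 0)).
have s2 i := smoothM (sc i) (sc i).
have st := smooth_sqp (smoothM (smooth_cst (- eta)) (sc 0)).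
have sp := smoothD (smoothD (s2 1) (s2 2)) (s2 3).
have := smooth_sqp (smoothD st (smoothM (smooth_cst (-1)) sp)).
have gE (x : R4) : sqp (- eta * (x 0 0 + - r 0 0)) + -1 * ((x 1 0 + - r 1 0) * (x 1 0 + - r 1 0) +
  (x 2 0 + - r 2 0) * (x 2 0 + - r 2 0) + (x 3 0 + - r 3 0) * (x 3 0 + - r 3 0)) = cone_gap eta r x.
  rewrite /cone_gap; have -> : - eta * (x 0 0 + - r 0 0) = eta * (r 0 0 - x 0 0) by ring.
  ring.
move=> H; apply: eq_smooth H _ _.
- by move=> x; rewrite gE.
- move=> i x; rewrite gE /cone_weight_partial; congr (_ * _).
  have -> : - eta * (x 0 0 + - r 0 0) = eta * (r 0 0 - x 0 0) by ring.
  by move: i; apply: ord4_cases => /=; ring.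
Qed.

Lemma sqp_ge0 (t : R) : 0 <= sqp t. Proof. exact: sqr_ge0. Qed.

Lemma sqp_gt0 (t : R) : (0 < sqp t) = (0 < t).
Proof.
rewrite /sqp; case: (leP t 0) => t0; last by rewrite exprn_gt0.
by rewrite expr0n ltxx.
Qed.

Lemma sqp_le (t c : R) : 0 <= c -> t <= c -> sqp t <= c ^+ 2.
Proof. by move=> c0 tc; rewrite /sqp; case: (leP t 0) => t0; rewrite ?expr0n ?sqr_ge0// ler_sqr// ?nnegrE// ltW. Qed.

Lemma cone_weight_gt0 eta r x : (0 < cone_weight eta r x) = (0 < cone_gap eta r x).
Proof. exact: sqp_gt0. Qed.

Section decreasing.
Variables (t : R3 -> R3 -> C) (good : set R3) (V : R3 -> R3 -> 'cV[C]_4).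
Variables (T : set R3 -> L2op R).
Hypothesis povm : is_POVM T.
Hypothesis kT : is_kernel T t.
Hypothesis ck : current_kernel t good V.
Local Notation J := (J V).
Variable f : R3 -> C.
Hypothesis nf : nice f.
Variable eta : R.
Hypothesis eta2 : eta ^+ 2 = 1.

(** [eta] is the sign of the Jacobian [height] on the side of time zero under study, so the bulk
    term of the divergence theorem is nonpositive on either side. *)
Definition decreasing (w : R4 -> R) (P : 'I_4 -> R4 -> R) : Prop := [/\ smooth w P,
  forall x, 0 <= w x &
  forall x, eta * (P 0 x * J f x 0 0 + P 1 x * J f x 1 0 + P 2 x * J f x 2 0 + P 3 x * J f x 3 0) <= 0].

(* Along the future cone the gradient of the weight is, up to sign, a future vector. *)
Lemma decreasing_cone_weight r : decreasing (cone_weight eta r) (cone_weight_partial eta r).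
Proof.
split; [exact: smooth_cone_weight|by move=> x; exact: sqp_ge0|move=> x].
rewrite /cone_weight_partial /=; set A := cone_gap eta r x; set tau := Num.max (eta * _) 0.
pose n : R4 := four tau (- eta * (x 1 0 - r 1 0), - eta * (x 2 0 - r 2 0), - eta * (x 3 0 - r 3 0)).
have -> : forall j0 j1 j2 j3 : R, eta * (2 * Num.max A 0 * (2 * tau * - eta) * j0 + 2 * Num.max A 0 * (-2 * (x 1 0 - r 1 0)) * j1 +
   2 * Num.max A 0 * (-2 * (x 2 0 - r 2 0)) * j2 + 2 * Num.max A 0 * (-2 * (x 3 0 - r 3 0)) * j3) =
   - (4 * Num.max A 0 * (eta ^+ 2 * tau * j0 + eta * (x 1 0 - r 1 0) * j1 + eta * (x 2 0 - r 2 0) * j2 + eta * (x 3 0 - r 3 0) * j3)).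
  by move=> *; ring.
rewrite eta2 mul1r oppr_le0.
case: (leP A 0) => A0; first by rewrite mulr0 mul0r.
rewrite mulr_ge0//; first by rewrite mulr_ge0// ltW.
have tau0 : 0 <= tau by rewrite le_max lexx orbT.
have tau2 : (x 1 0 - r 1 0) ^+ 2 + (x 2 0 - r 2 0) ^+ 2 + (x 3 0 - r 3 0) ^+ 2 < tau ^+ 2.
  by move: A0; rewrite /A /cone_gap subr_gt0.
have fn : future n.
  split; first rewrite four0 lt0r tau0 andbT.
    apply: contraTN tau2 => /eqP ->; rewrite expr0n /= -leNgt.
    by rewrite !addr_ge0 ?sqr_ge0.
  rewrite /mink !fourE /=.
  have -> : tau * tau - - eta * (x 1 0 - r 1 0) * (- eta * (x 1 0 - r 1 0)) - - eta * (x 2 0 - r 2 0) * (- eta * (x 2 0 - r 2 0)) -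
    - eta * (x 3 0 - r 3 0) * (- eta * (x 3 0 - r 3 0)) =
    tau ^+ 2 - eta ^+ 2 * ((x 1 0 - r 1 0) ^+ 2 + (x 2 0 - r 2 0) ^+ 2 + (x 3 0 - r 3 0) ^+ 2) by ring.
  by rewrite eta2 mul1r subr_gt0.
by have := J_future povm kT ck x nf fn; rewrite /mink !fourE /=; lra.
Qed.

Lemma decreasingD w P u Q : decreasing w P -> decreasing u Q ->
  decreasing (fun x => w x + u x) (fun i x => P i x + Q i x).
Proof.
move=> [sw w0 wJ] [su u0 uJ]; split; [exact: smoothD|by move=> x; rewrite addr_ge0|].
by move=> x; have := wJ x; have := uJ x; nra.
Qed.

Lemma decreasing0 : decreasing (fun=> 0) (fun _ _ => 0).
Proof. by split; [exact: smooth_cst|by []|move=> x; rewrite !mul0r !addr0 mulr0]. Qed.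

Lemma decreasingZ c w P : 0 <= c -> decreasing w P ->
  decreasing (fun x => c * w x) (fun i x => c * P i x).
Proof.
move=> c0 [sw w0 wJ]; split; [|by move=> x; rewrite mulr_ge0|].
  apply: eq_smooth (smoothM (smooth_cst c) sw) _ _ => // i x.
  by rewrite mul0r add0r.
move=> x; have := mulr_ge0_le0 c0 (wJ x); apply: le_trans.
by rewrite le_eqVlt; apply/orP; left; apply/eqP; ring.
Qed.

Lemma decreasing_saturate w P : decreasing w P ->
  decreasing (fun x => 1 - expR (- w x)) (fun i x => expR (- w x) * P i x).
Proof.
move=> [sw w0 wJ]; split; [exact: smooth_saturate| |].
  by move=> x; rewrite subr_ge0 -[leRHS]expR0 ler_expR oppr_le0.
move=> x; have := mulr_ge0_le0 (expR_ge0 (- w x)) (wJ x); apply: le_trans.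
by rewrite le_eqVlt; apply/orP; left; apply/eqP; ring.
Qed.

Variable r : nat -> R4.

Fixpoint weight_sum n (x : R4) : R :=
  if n is n'.+1 then weight_sum n' x + cone_weight eta (r n') x else 0.

(** The growing factor drives the weight to 1 wherever one cone weight is positive, while the finite
    sum keeps its support in the wedge bounded. *)
Definition weight n (x : R4) : R := 1 - expR (- (n.+1%:R * weight_sum n x)).

Lemma decreasing_weight_sum n : exists P, decreasing (weight_sum n) P.
Proof.
elim: n => [|n [P IH]]; first by exists (fun _ _ => 0); exact: decreasing0.
by eexists; exact: decreasingD IH (decreasing_cone_weight (r n)).
Qed.

Lemma decreasing_weight n : exists P, decreasing (weight n) P.
Proof.
have [P dP] := decreasing_weight_sum n.
by eexists; exact: decreasing_saturate (decreasingZ (ler0n R n.+1) dP).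
Qed.

Lemma weight_sum_ge0 n x : 0 <= weight_sum n x.
Proof. by elim: n => //= n IH; rewrite addr_ge0 ?sqp_ge0. Qed.

Lemma weight_sum_le m n x : (m <= n)%N -> weight_sum m x <= weight_sum n x.
Proof.
by move=> mn; rewrite -(subnK mn); elim: (n - m)%N => //= k IH; rewrite ler_wpDr ?sqp_ge0.
Qed.

Lemma weight_ge0 n x : 0 <= weight n x.
Proof.
by rewrite /weight subr_ge0 -[leRHS]expR0 ler_expR oppr_le0 mulr_ge0 ?weight_sum_ge0.
Qed.

Lemma weight_le1 n x : weight n x <= 1.
Proof. by rewrite /weight lerBlDr lerDl expR_ge0. Qed.

Lemma weight_le m n x : (m <= n)%N -> weight m x <= weight n x.
Proof.
move=> mn; rewrite /weight lerD2l lerN2 ler_expR lerN2 ler_pM ?weight_sum_ge0 ?ler_nat//.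
exact: weight_sum_le.
Qed.

Lemma weight_eq0 n x : (forall k, cone_weight eta (r k) x = 0) -> weight n x = 0.
Proof.
move=> H; rewrite /weight (_ : weight_sum n x = 0); first by rewrite mulr0 oppr0 expR0 subrr.
by elim: n => //= n ->; rewrite H addr0.
Qed.

Lemma weight_cvg x k : 0 < cone_weight eta (r k) x -> weight ^~ x @ \oo --> (1 : R).
Proof.
move=> c0; rewrite -[X in _ --> X]subr0; apply: cvgB; first exact: cvg_cst.
apply: (squeeze_cvgr (f := fun=> 0) (h := fun n => harmonic n * (cone_weight eta (r k) x)^-1)).
(* Since exp u >= 1 + u, the defect from 1 is at most 1 / ((n + 1) c) with c the k-th cone weight,
   once n > k. *)
- near=> n; rewrite expR_ge0 /= expRN -invfM.
  have cn : 0 < n.+1%:R * cone_weight eta (r k) x by rewrite mulr_gt0// ltr0n.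
  rewrite lef_pV2 ?posrE ?expR_gt0//.
  apply: le_trans (_ : n.+1%:R * weight_sum n x <= _); last first.
    by apply: le_trans (expR_ge1Dx _); rewrite lerDr.
  rewrite ler_wpM2l//; have kn : (k.+1 <= n)%N by near: n; exists k.+1.
  by apply: le_trans (weight_sum_le x kn); rewrite /= lerDr weight_sum_ge0.
- exact: cvg_cst.
- rewrite -[X in _ --> X](mul0r (cone_weight eta (r k) x)^-1); apply: cvgM; last exact: cvg_cst.
  exact: cvg_harmonic.
Unshelve. all: by end_near. Qed.

(** On the side where eta height >= 0 the time gap to an apex r is at most |r_0|, so its cone
    reaches no farther than |r_0| from the spatial position of r. *)
Lemma weight_support n : exists N : R, forall theta a b x, 0 <= theta ->
  0 <= eta * height a b x -> N <= `|x.1.1| \/ N <= `|x.1.2| \/ N <= `|x.2| ->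
  weight n (slab a b theta x) = 0.
Proof.
suff [N HN] : exists N : R, forall theta a b x, 0 <= theta ->
    0 <= eta * height a b x -> N <= `|x.1.1| \/ N <= `|x.1.2| \/ N <= `|x.2| ->
    weight_sum n (slab a b theta x) = 0.
  exists N => th a b x th0 h0 xN; rewrite /weight HN//.
  by rewrite mulr0 oppr0 expR0 subrr.
elim: n => [|n [N IH]]; first by exists 0.
pose c := `|r n 0 0|.
exists (`|N| + (c + `|r n 1 0| + `|r n 2 0| + `|r n 3 0|)) => th a b x th0 h0 H /=.
have p0 := normr_ge0 (r n 0 0); have p1 := normr_ge0 (r n 1 0); have p2 := normr_ge0 (r n 2 0).
have p3 := normr_ge0 (r n 3 0); have pN := ler_norm N; have pN' := normr_ge0 N.
rewrite IH//; last by rewrite /c in H; case: H => [H|[H|H]]; [left|right; left|right; right]; lra.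
rewrite add0r; apply/eqP; rewrite eq_le sqp_ge0 andbT leNgt cone_weight_gt0 -leNgt.
rewrite /cone_gap /slab !fourE subr_le0.
apply: le_trans (_ : c ^+ 2 <= _).
  apply: sqp_le => //.
  apply: le_trans (_ : eta * r n 0 0 <= _).
    rewrite mulrBr lerBlDr lerDl mulrCA mulr_ge0//.
  apply: le_trans (ler_norm _) _; rewrite normrM.
  by rewrite (_ : `|eta| = 1) ?mul1r//; apply/eqP; rewrite -sqrp_eq1// real_normK ?num_real// eta2.
have K (u v : R) : c + `|v| <= `|u| -> c ^+ 2 <= (u - v) ^+ 2.
  move=> uv; rewrite -[leRHS]real_normK ?num_real// ler_sqr ?nnegrE//.
  have := ler_normB (u - v) (- v); rewrite normrN opprK subrK; lra.
have s1 := sqr_ge0 (x.1.1 - r n 1 0); have s2 := sqr_ge0 (x.1.2 - r n 2 0).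
have s3 := sqr_ge0 (x.2 - r n 3 0).
rewrite -/c in p0; case: H => [H|[H|H]].
- have : c ^+ 2 <= (x.1.1 - r n 1 0) ^+ 2 by apply: K; lra.
  lra.
- have : c ^+ 2 <= (x.1.2 - r n 2 0) ^+ 2 by apply: K; lra.
  lra.
- have : c ^+ 2 <= (x.2 - r n 3 0) ^+ 2 by apply: K; lra.
  lra.
Qed.

(** The range of the third coordinate on one side of time zero. Each end is either the edge of the
    wedge or at distance at least M, beyond the support of the weight. *)
Lemma strip_exists (a b M : R) : (exists2 y, `|y| <= M & 0 < a + b * y) ->
  exists alpha beta : R, [/\ alpha < beta, forall y, alpha <= y <= beta -> 0 <= a + b * y,
    forall y, `|y| <= M -> 0 <= a + b * y -> alpha <= y <= beta,
    a + b * alpha = 0 \/ M <= `|alpha| & a + b * beta = 0 \/ M <= `|beta| ].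
Proof.
move=> [y yM hy]; have M0 : 0 <= M by apply: le_trans yM.
have [b0|b0|b0] := ltgtP b 0; last first.
(* For a parallel plane there is no edge; the margin 1 keeps the interval nondegenerate when M =
   0. *)
- move: hy; rewrite b0 => hy; exists (- M - 1), (M + 1); split; first lra.
  + by move=> z _; move: hy; rewrite !mul0r !addr0 => /ltW.
  + by move=> z; rewrite ler_norml => /andP[? ?] _; apply/andP; split; lra.
  + by right; rewrite -opprD normrN ger0_norm; lra.
  + by right; rewrite ger0_norm; lra.
- pose rho := - a / b.
  have hE z : a + b * z = b * (z - rho) by rewrite /rho; field; rewrite gt_eqF.
  move: hy yM; rewrite hE pmulr_rgt0// subr_gt0 ler_norml => ry /andP[yM1 yM2].
  exists rho, M; split; first lra.
  + by move=> z /andP[? ?]; rewrite hE mulr_ge0 ?(ltW b0)// subr_ge0.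
  + by move=> z; rewrite ler_norml hE pmulr_rge0// subr_ge0 => /andP[_ ->] ->.
  + by left; rewrite hE subrr mulr0.
  + by right; exact: ler_norm.
- pose rho := - a / b.
  have hE z : a + b * z = b * (z - rho) by rewrite /rho; field; rewrite lt_eqF.
  move: hy yM; rewrite hE nmulr_rgt0// subr_lt0 ler_norml => ry /andP[yM1 yM2].
  exists (- M), rho; split; first lra.
  + by move=> z /andP[? ?]; rewrite hE mulr_le0 ?(ltW b0)// subr_le0.
  + by move=> z; rewrite ler_norml hE nmulr_rge0// subr_le0 => /andP[-> _] ->.
  + by right; rewrite normrN; exact: ler_norm.
  + by left; rewrite hE subrr mulr0.
Qed.

End decreasing.
End cone_weights.

(** * Comparison of a tilted region with the union of cones at time zero *)

Section graph_flux.
Context {R : realType}.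
Local Notation C := R[i].
Local Notation R3 := (R3 R).
Local Notation R4 := 'cV[R]_4.
Local Notation mu3 := (mu3 R).
Variables (T : set R3 -> L2op R) (Tx : set R4 -> L2op R).
Variables (t : R3 -> R3 -> C) (good : set R3) (V : R3 -> R3 -> 'cV[C]_4).
Hypothesis povm : is_POVM T.
Hypothesis kT : is_kernel T t.
Hypothesis ck : current_kernel t good V.
Hypothesis ext : is_covariant_extension T Tx.
Local Notation J := (J V).

Lemma quad_POVM_le f A B : LC 2%:E f -> measurable A -> measurable B -> A `<=` B ->
  quad (T A) f <= quad (T B) f.
Proof.
move=> Lf mA mB AB; have [nu nuE] := POVM_measure povm Lf.
rewrite -lee_fin -!nuE//; apply: le_measure => //; by rewrite inE.
Qed.

Variable f : R3 -> C.
Hypothesis nf : nice f.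
Variables (eta a b : R).
Hypothesis eta2 : eta ^+ 2 = 1.
Hypothesis b1 : `|b| < 1.
Variable r : nat -> R4.
Local Notation weight := (weight eta r).
Local Notation slab := (slab a b).
Local Notation height := (height a b).

Definition cones_at0 : set R3 := [set x | exists k, 0 < cone_weight eta (r k) (four 0 x)].

Lemma measurable_cones_at0 : measurable cones_at0.
Proof.
rewrite (_ : cones_at0 = \bigcup_k [set x | 0 < cone_weight eta (r k) (four 0 x)]); last first.
  by apply/seteqP; split => [x [k H]|x [k _ H]]; exists k.
apply: bigcupT_measurable => k; have [_ _ [mw _] _] := smooth_cone_weight eta (r k).
have m0 : measurable_fun setT (fun x : R3 => cone_weight eta (r k) (four 0 x)).
  exact: (measurableT_comp mw (measurable_pair1 (0 : R))).
have := @measurable_fun_ltr _ _ _ setT (cst 0) _ (measurable_cst _) m0.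
by move=> /(_ measurableT [set true] I); rewrite setTI; congr measurable; apply/seteqP; split.
Qed.

Definition density0 x := J f (slab 0 x) 0 0.
Definition density1 x := J f (slab 1 x) 0 0 - b * J f (slab 1 x) 3 0.

Lemma density0_ge0 x : 0 <= density0 x.
Proof. exact: (J0_ge0 povm kT ck). Qed.

Lemma density1_ge0 x : 0 <= density1 x.
Proof.
have fn : future (four 1 (0, 0, b) : R4).
  rewrite /future /mink !fourE /= ltr01; split => //.
  by move: b1; rewrite ltr_norml => /andP[? ?]; nra.
have := J_future povm kT ck (slab 1 x) nf fn.
by rewrite /mink !fourE /= !mul0r mul1r !subr0.
Qed.

Lemma bounded_density D : bounded_on D density0 /\ bounded_on D density1.
Proof.
have [K K0 HK] := J_bounded ck nf.
have bJ th i : bounded_on D (fun x => J f (slab th x) i 0).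
  split; last by exists K.
  by apply: (measurable_J ck) => // j; exact: measurable_slab_fix.
split; first exact: bJ.
by apply: bounded_onB => //; apply: bounded_onM => //; exact: bounded_on_cst.
Qed.

Lemma measurable_weight n th : measurable_fun setT (fun x : R3 => weight n (slab th x)).
Proof.
have [P [[_ _ [mw _] _] _ _]] := decreasing_weight povm kT ck nf eta2 r n.
have := measurableT_comp mw (_ : measurable_fun setT (fun x : R3 => (th * height x, x))).
apply; apply: measurable_fun_pair => //.
by apply: measurable_funM; [exact: measurable_cst|exact: measurable_height].
Qed.

Lemma bounded_weight D n th : bounded_on D (fun x : R3 => weight n (slab th x)).
Proof.
split; first exact: measurable_weight.
by exists 1 => x _; rewrite ger0_norm ?weight_ge0 ?weight_le1.
Qed.

Variables (S : set R3) (N0 : R).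
Hypothesis mS : measurable S.
Hypothesis SN : S `<=` box N0.
Hypothesis Sh : forall x, S x -> 0 < eta * height x.
Hypothesis Sr : forall x, S x -> exists k, 0 < cone_weight eta (r k) (slab 1 x).

Lemma mu3_S : (mu3 S < +oo)%E.
Proof.
apply: le_lt_trans (mu3_box N0).
by apply: le_measure => //; rewrite inE//; exact: measurable_box.
Qed.

(** [wedge_flux] on a brick whose outer faces avoid the support of the weight. Positivity of the
    densities allows enlarging [S] to the brick on the tilted plane; at time zero the weight is at
    most 1 and vanishes off the cones. *)
Lemma weighted_flux_le n : S !=set0 ->
  \int[mu3]_x (weight n (slab 1 x) * density1 x * \1_S x) <= (2 * pi) ^+ 3 * quad (T cones_at0) f.
Proof.
move=> [x0 Sx0].
have [P [sw w0 wJ]] := decreasing_weight povm kT ck nf eta2 r n.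
have [N HN] := weight_support eta2 r n.
(* Large enough for the support radius [N] of the weight and for the box containing [S]. *)
pose M := 1 + `|N| + `|N0|.
have MN : N <= M by rewrite /M; have := ler_norm N; have := normr_ge0 N0; lra.
have MN0 : N0 <= M by rewrite /M; have := ler_norm N0; have := normr_ge0 N; lra.
have M0 : 0 < M by rewrite /M; have := normr_ge0 N0; have := normr_ge0 N; lra.
have hE x : eta * height x = eta * a + eta * b * x.2 by rewrite /height; ring.
have [alpha [beta [ab strip1 strip2 enda endb]]] : exists alpha beta : R, [/\ alpha < beta,
    forall y, alpha <= y <= beta -> 0 <= eta * a + eta * b * y,
    forall y, `|y| <= M -> 0 <= eta * a + eta * b * y -> alpha <= y <= beta,
    eta * a + eta * b * alpha = 0 \/ M <= `|alpha| & eta * a + eta * b * beta = 0 \/ M <= `|beta| ].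
  apply: strip_exists; exists x0.2; last by rewrite -hE; exact: Sh.
  by have [_ _ h3] := box_le MN0 (SN Sx0).
pose B := brick M alpha beta.
have mB : measurable B := measurable_brick M alpha beta.
have fB : (mu3 B < +oo)%E := mu3_brick M alpha beta.
have hB x : B x -> 0 <= eta * height x.
  by case=> _; rewrite /seg /= in_itv /= => /strip1; rewrite hE.
have SB : S `<=` B.
  move=> x Sx; have [h1 h2 h3] := box_le MN0 (SN Sx).
  have := strip2 _ h3; rewrite -hE => /(_ (ltW (Sh Sx))) h4.
  by split; [split|]; rewrite /seg /= in_itv /= -?ler_norml.
have th0 (th : R) : seg 0 1 th -> 0 <= th by rewrite /seg /= in_itv /= => /andP[].
have eta0 : eta != 0 by apply/eqP => e; move: eta2; rewrite e expr0n => /eqP; rewrite eq_sym oner_eq0.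
have side th x : B x -> seg 0 1 th -> `|x.1.1| = M \/ `|x.1.2| = M -> weight n (slab th x) = 0.
  by move=> Bx It H; apply: HN; [exact: th0|exact: hB|case: H => ->; [left|right; left]].
have ends th x : B x -> seg 0 1 th -> x.2 = alpha \/ x.2 = beta -> height x * weight n (slab th x) = 0.
  move=> Bx It H.
  have [h0|h0] : eta * height x = 0 \/ M <= `|x.2|.
    by rewrite hE; case: H => ->.
  - by move/eqP: h0; rewrite mulf_eq0 (negbTE eta0) /= => /eqP ->; rewrite mul0r.
  - rewrite HN ?mulr0//; [exact: th0|exact: hB|right; right; exact: le_trans MN h0].
have sign th x : B x -> seg 0 1 th ->
  height x * (P 0 (slab th x) * J f (slab th x) 0 0 + P 1 (slab th x) * J f (slab th x) 1 0 +
    P 2 (slab th x) * J f (slab th x) 2 0 + P 3 (slab th x) * J f (slab th x) 3 0) <= 0.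
  move=> Bx It; have := mulr_ge0_le0 (hB _ Bx) (wJ (slab th x)).
  by rewrite mulrACA -expr2 eta2 mul1r.
have flux := wedge_flux ck nf M0 ab sw side ends sign.
have [bd0 bd1] := bounded_density B.
have step1 : \int[mu3]_x (weight n (slab 1 x) * density1 x * \1_S x) <=
    \int[mu3]_x (weight n (slab 1 x) * density1 x * \1_B x).
  apply: le_Rintegral => //.
  - apply: integrable_bounded_on => //; first exact: mu3_S.
    by apply: bounded_onM; [exact: bounded_weight|have [] := bounded_density S].
  - by apply: integrable_bounded_on => //; apply: bounded_onM => //; exact: bounded_weight.
  - move=> x _; rewrite ler_wpM2l//; first by rewrite mulr_ge0 ?weight_ge0 ?density1_ge0.
    rewrite !indicE ler_nat; case: (boolP (x \in S)) => // /set_mem Sx.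
    by rewrite mem_set//; exact: SB.
apply: le_trans step1 _; apply: le_trans flux _.
have mU := measurable_cones_at0.
have mUB : measurable (cones_at0 `&` B) by exact: measurableI.
have step2 : \int[mu3]_x (weight n (slab 0 x) * density0 x * \1_B x) <=
    \int[mu3]_(x in cones_at0 `&` B) density0 x.
  rewrite [leRHS]Rintegral_mkcond.
  rewrite (_ : density0 \_ _ = fun x => density0 x * \1_(cones_at0 `&` B) x); last first.
    by apply/funext => x; rewrite patchE indicE; case: ifP; rewrite ?mulr1 ?mulr0.
  apply: le_Rintegral => //.
  - by apply: integrable_bounded_on => //; apply: bounded_onM => //; exact: bounded_weight.
  - apply: integrable_bounded_on => //; last by have [] := bounded_density (cones_at0 `&` B).
    by apply: le_lt_trans fB; apply: le_measure; rewrite ?inE// => x [].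
  - move=> x _.
    have [->|[-> Bx]] := @indic_cases R _ B x.
      by rewrite mulr0 mulr_ge0// density0_ge0.
    case: (pselect (cones_at0 x)) => Ux.
      rewrite indicE mem_set// !mulr1 -[leRHS]mul1r ler_wpM2r ?density0_ge0//.
      exact: weight_le1.
    rewrite weight_eq0 ?mul0r ?mulr_ge0 ?density0_ge0//.
    move=> k; apply/eqP; rewrite eq_le sqp_ge0 andbT leNgt; apply/negP => H.
    by apply: Ux; exists k; move: H; rewrite /slab mul0r.
apply: le_trans step2 _.
have -> : \int[mu3]_(x in cones_at0 `&` B) density0 x = (2 * pi) ^+ 3 * quad (T (cones_at0 `&` B)) f.
  rewrite (quad_density kT ck nf mUB) mulrA divff ?mul1r.
    by apply: eq_Rintegral => x _; rewrite /density0 /slab mul0r.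
  by rewrite expf_neq0// mulf_neq0// gt_eqF// pi_gt0.
rewrite ler_wpM2l//; first by rewrite exprn_ge0// mulr_ge0// pi_ge0.
by apply: quad_POVM_le => //; exact: nice_LC2.
Qed.

(** Monotone convergence in [weighted_flux_le]: on [S] the weights increase to 1, because every
    point of its graph lies in one of the cones. *)
Lemma graph_flux_le : quad (Tx (graph a b S)) f <= quad (T cones_at0) f.
Proof.
have Lf := nice_LC2 nf; have mU := measurable_cones_at0.
have pi3 : 0 < (2 * pi) ^+ 3 :> R by rewrite exprn_gt0// mulr_gt0// pi_gt0.
rewrite (quad_boost kT ck a ext b1 nf mS).
have [[x0 Sx0]|S0] := pselect (S !=set0); last first.
  have -> : S = set0 by apply/seteqP; split => // x Sx; apply: S0; exists x.
  by rewrite Rintegral_set0 mulr0; exact: (quad_ge0 povm).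
rewrite mulrC ler_pdivrMr// mulrC.
have -> : \int[mu3]_(x in S) (J f (four (a + b * x.2) x) 0 0 - b * J f (four (a + b * x.2) x) 3 0) =
   \int[mu3]_x (density1 x * \1_S x).
  rewrite Rintegral_mkcond; apply: eq_Rintegral => x _.
  rewrite patchE indicE /density1 /slab /height mul1r; case: ifP; rewrite ?mulr1 ?mulr0//.
have [_ bd1] := bounded_density S; have fS := mu3_S.
have bw n : bounded_on S (fun x => weight n (slab 1 x) * density1 x).
  by apply: bounded_onM => //; exact: bounded_weight.
have id1 := integrable_bounded_on mS fS bd1.
have idw n := integrable_bounded_on mS fS (bw n).
set K := _ * quad _ _.
pose g n x := (weight n (slab 1 x) * density1 x * \1_S x)%:E.
have gK n : (\int[mu3]_x g n x <= K%:E)%E.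
  have := weighted_flux_le n (ex_intro _ _ Sx0); rewrite -lee_fin.
  have fn := integrable_fin_num measurableT (idw n).
  by rewrite -[X in _ -> (X <= _)%E](fineK fn).
have fin1 := integrable_fin_num measurableT id1.
suff : (\int[mu3]_x (density1 x * \1_S x)%:E <= K%:E)%E.
  by rewrite -[X in (X <= _)%E -> _](fineK fin1) lee_fin.
have -> : (\int[mu3]_x (density1 x * \1_S x)%:E = \int[mu3]_x limn (g ^~ x))%E.
  apply: eq_integral => x _; apply/esym/cvg_lim => //; rewrite /g.
  have [e|[_ Sx]] := @indic_cases R _ S x.
    by rewrite e mulr0; under eq_fun do rewrite mulr0; exact: cvg_cst.
  have [k Hk] := Sr Sx.
  apply: cvg_EFin; first by near=> n.
  rewrite -[X in _ --> X](mul1r) mulrA.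
  apply: cvgM; last exact: cvg_cst.
  by apply: cvgM; [exact: (weight_cvg Hk)|exact: cvg_cst].
have mg n : measurable_fun setT (g n) by have /integrableP[] := idw n.
have g0 n x : setT x -> (0 <= g n x)%E.
  by move=> _; rewrite lee_fin mulr_ge0// mulr_ge0 ?weight_ge0 ?density1_ge0.
have gnd x : setT x -> {homo g ^~ x : n m / (n <= m)%N >-> (n <= m)%E}.
  move=> _ m n mn; rewrite lee_fin ler_wpM2r// ler_wpM2r ?density1_ge0//.
  exact: weight_le.
have C := @cvg_monotone_convergence _ _ _ mu3 setT measurableT g mg g0 gnd.
rewrite -(cvg_lim _ C)//; apply: lime_le; first exact: cvgP C.
by near=> n.
Unshelve. all: by end_near.
Qed.

End graph_flux.

(** * Chronological order and rational points *)

Section chronology.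
Context {R : realType}.
Local Notation R3 := (R3 R).
Local Notation R4 := 'cV[R]_4.

Definition norm3 (x : R3) : R := Num.sqrt (dot3 x x).

Lemma norm3_ge0 x : 0 <= norm3 x. Proof. exact: sqrtr_ge0. Qed.

Lemma sqr_norm3 x : norm3 x ^+ 2 = dot3 x x.
Proof. by rewrite sqr_sqrtr ?dot3_ge0. Qed.

Lemma norm3_lt x c : 0 <= c -> (norm3 x < c) = (dot3 x x < c ^+ 2).
Proof. by move=> c0; rewrite -sqr_norm3 ltr_sqr ?nnegrE ?norm3_ge0. Qed.

Lemma norm3_le x c : 0 <= c -> (norm3 x <= c) = (dot3 x x <= c ^+ 2).
Proof. by move=> c0; rewrite -sqr_norm3 ler_sqr ?nnegrE ?norm3_ge0. Qed.

Lemma norm3D x y : norm3 (x + y) <= norm3 x + norm3 y.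
Proof.
rewrite norm3_le ?addr_ge0 ?norm3_ge0//.
have xy : dot3 x y <= norm3 x * norm3 y.
  have := dot3_CS x y; rewrite -!sqr_norm3 -exprMn => h.
  have n0 : 0 <= norm3 x * norm3 y by rewrite mulr_ge0 ?norm3_ge0.
  by apply: le_trans (ler_norm _) _; rewrite -ler_sqr ?nnegrE// real_normK ?num_real.
rewrite (_ : dot3 (x + y) (x + y) = dot3 x x + dot3 y y + 2 * dot3 x y); last by rewrite /dot3 /=; ring.
by rewrite -!sqr_norm3 sqrrD; lra.
Qed.

Lemma norm3N x : norm3 (- x) = norm3 x.
Proof. by rewrite /norm3; congr Num.sqrt; rewrite /dot3 /=; ring. Qed.

Lemma norm3_coord x : [/\ `|x.1.1| <= norm3 x, `|x.1.2| <= norm3 x & `|x.2| <= norm3 x].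
Proof.
have K (u : R) : u ^+ 2 <= dot3 x x -> `|u| <= norm3 x.
  by move=> ?; rewrite -ler_sqr ?nnegrE ?norm3_ge0// real_normK ?num_real// sqr_norm3.
by split; apply: K; rewrite /dot3; nra.
Qed.

Lemma norm3_sum x : norm3 x <= `|x.1.1| + `|x.1.2| + `|x.2|.
Proof.
have a := normr_ge0 x.1.1; have b := normr_ge0 x.1.2; have c := normr_ge0 x.2.
rewrite norm3_le ?addr_ge0// /dot3 -!expr2.
rewrite -[x.1.1 ^+ 2]real_normK ?num_real// -[x.1.2 ^+ 2]real_normK ?num_real//.
rewrite -[x.2 ^+ 2]real_normK ?num_real//; nra.
Qed.

(* [eta = 1] is the chronological past, [eta = -1] the chronological future. *)
Definition precedes (eta : R) (x y : R4) : Prop :=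
  norm3 (spatial y - spatial x) < eta * (y 0 0 - x 0 0).

Lemma precedes_trans eta x y z : precedes eta x y -> precedes eta y z -> precedes eta x z.
Proof.
rewrite /precedes => xy yz.
have -> : spatial z - spatial x = (spatial z - spatial y) + (spatial y - spatial x) by rewrite addrA subrK.
by apply: le_lt_trans (norm3D _ _) _; rewrite !mulrBr in xy yz *; lra.
Qed.

Lemma cone_weight_precedes eta r x : 0 < cone_weight eta r x <-> precedes eta x r.
Proof.
rewrite cone_weight_gt0 /cone_gap subr_gt0 /precedes.
have E : (x 1 0 - r 1 0) ^+ 2 + (x 2 0 - r 2 0) ^+ 2 + (x 3 0 - r 3 0) ^+ 2 = norm3 (spatial r - spatial x) ^+ 2.
  by rewrite sqr_norm3 /dot3 /=; ring.
have n0 := norm3_ge0 (spatial r - spatial x).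
rewrite E /sqp; case: (leP (eta * (r 0 0 - x 0 0)) 0) => h; split=> H.
- by move: H; rewrite expr0n /= ltNge sqr_ge0.
- by exfalso; lra.
- by rewrite -ltr_sqr ?nnegrE// ltW.
- by rewrite ltr_sqr ?nnegrE// ltW.
Qed.

Definition rational_point (q : rat * rat * rat * rat) : R4 :=
  four (ratr q.1.1.1) (ratr q.1.1.2, ratr q.1.2, ratr q.2).

Lemma rat_near (u e : R) : 0 < e -> exists q : rat, `|ratr q - u| < e.
Proof.
move=> e0; have [q] : exists q : rat, ratr q \in `]u - e, u + e[ by apply: rat_in_itvoo; lra.
rewrite in_itv /= => /andP[h1 h2]; exists q; rewrite ltr_norml; apply/andP; split; lra.
Qed.

Lemma rational_between eta x y : eta ^+ 2 = 1 -> precedes eta x y ->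
  exists q, precedes eta x (rational_point q) /\ precedes eta (rational_point q) y.
Proof.
move=> eta2 xy.
pose tau := eta * (y 0 0 - x 0 0); pose d := norm3 (spatial y - spatial x).
have dt : d < tau by [].
(* The midpoint has slack (tau - d) / 2 = 4.5 e on either side; rounding costs at most 3 e in space
   and e in time. *)
pose e := (tau - d) / 9; have e0 : 0 < e by rewrite divr_gt0// subr_gt0.
have [q0 h0] := rat_near ((x 0 0 + y 0 0) / 2) e0.
have [q1 h1] := rat_near ((x 1 0 + y 1 0) / 2) e0.
have [q2 h2] := rat_near ((x 2 0 + y 2 0) / 2) e0.
have [q3 h3] := rat_near ((x 3 0 + y 3 0) / 2) e0.
exists (q0, q1, q2, q3).
pose v : R3 := (ratr q1 - (x 1 0 + y 1 0) / 2, ratr q2 - (x 2 0 + y 2 0) / 2, ratr q3 - (x 3 0 + y 3 0) / 2).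
have nv : norm3 v <= 3 * e by apply: le_trans (norm3_sum v) _; rewrite /v /=; lra.
pose m : R3 := ((y 1 0 - x 1 0) / 2, (y 2 0 - x 2 0) / 2, (y 3 0 - x 3 0) / 2).
have nm : norm3 m = d / 2.
  apply/eqP; rewrite -(eqrXn2 (n := 2)) ?norm3_ge0 ?divr_ge0 ?norm3_ge0//.
  by rewrite sqr_norm3 exprMn sqr_norm3 /dot3 /=; apply/eqP; field.
have eta1 : `|eta| = 1 by apply/eqP; rewrite -sqrp_eq1// real_normK ?num_real// eta2.
have k0 : `|eta * (ratr q0 - (x 0 0 + y 0 0) / 2)| < e by rewrite normrM eta1 mul1r.
have ee : 9 * e = tau - d by rewrite /e; field.
move: k0; rewrite ltr_norml => /andP[k1 k2].
split; rewrite /precedes /rational_point !fourE /= spatial_four.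
- have -> : (ratr q1, ratr q2, ratr q3) - spatial x = m + v :> R3.
    by rewrite /m /v /spatial /=; congr ((_, _), _); rewrite /=; field.
  apply: le_lt_trans (norm3D _ _) _; rewrite nm.
  have -> : eta * (ratr q0 - x 0 0) = eta * (ratr q0 - (x 0 0 + y 0 0) / 2) + tau / 2 by rewrite /tau; field.
  lra.
- have -> : spatial y - (ratr q1, ratr q2, ratr q3) = m + - v :> R3.
    by rewrite /m /v /spatial /=; congr ((_, _), _); rewrite /=; field.
  apply: le_lt_trans (norm3D _ _) _; rewrite nm norm3N.
  have -> : eta * (y 0 0 - ratr q0) = tau / 2 - eta * (ratr q0 - (x 0 0 + y 0 0) / 2) by rewrite /tau; field.
  lra.
Qed.

(** Decode the index to a rational point; [q0] fills in where decoding fails or leaves [Q]. *)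
Lemma rational_sequence (Q : set R4) q0 : Q (rational_point q0) ->
  exists r : nat -> R4, (forall k, Q (r k)) /\
    forall q, Q (rational_point q) -> exists k, r k = rational_point q.
Proof.
move=> Q0.
pose r k := if unpickle k is Some q then
  (if `[< Q (rational_point q) >] then rational_point q else rational_point q0) else rational_point q0.
exists r; split => [k|q Qq].
  by rewrite /r; case: (unpickle k) => // q; case: ifPn => // /asboolP.
by exists (pickle q); rewrite /r pickleK; case: ifPn => // /asboolP.
Qed.

End chronology.

(** * One-sided influence of a tilted region on the time zero plane *)

Section graph_influence.
Context {R : realType}.
Local Notation C := R[i].
Local Notation R3 := (R3 R).
Local Notation R4 := 'cV[R]_4.
Local Notation mu3 := (mu3 R).
Local Notation L2 := (@LC R 2%:E).
Variables (T : set R3 -> L2op R) (Tx : set R4 -> L2op R).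
Variables (t : R3 -> R3 -> C) (good : set R3) (V : R3 -> R3 -> 'cV[C]_4).
Hypothesis povm : is_POVM T.
Hypothesis kT : is_kernel T t.
Hypothesis ck : current_kernel t good V.
Hypothesis ext : is_covariant_extension T Tx.

(** Gives monotonicity and continuity from below on the tilted plane. The measure is that of the
    boosted state at time zero, hence the preimages under the stretch [F]. *)
Lemma graph_measure a b f : `|b| < 1 -> L2 f ->
  exists (nu : {measure set R3 -> \bar R}) (F : R3 -> R3), measurable_fun setT F /\
    forall A N, measurable A -> mu3.-negligible N ->
      nu (F @^-1` A) = (quad (Tx (graph a b (A `|` N))) f)%:E.
Proof.
move=> b1 Lf; have [r [r0 ch0 shE quadE]] := quad_graph a ext b1.
have [nu nuE] := POVM_measure povm (LC2_Winv (four a 0) (generator_boostz r0) Lf).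
have [mF _ _ _] : preserves (fun x : R3 => (x.1, (r ^+ 2 + r ^- 2) / 2 * x.2) : R3) (cst ((r ^+ 2 + r ^- 2) / 2)).
  apply: eq_preserves (preserves_affine3 0 0 0 ch0) => // x.
  by rewrite !mul0r !addr0.
exists nu, (fun x : R3 => (x.1, (r ^+ 2 + r ^- 2) / 2 * x.2)); split => // A N mA nN.
rewrite quadE// nuE//.
by rewrite -[_ @^-1` _]setTI; exact: mF.
Qed.

Lemma WE_translation c (f : R3 -> C) : W (four c 0) 1%:M f = fun p => cis (c * eps p) * f p.
Proof.
apply/funext => p; rewrite (WE _ (@generator1 R)).
have -> : lact 1%:M p = p by rewrite /lact mul1mx /onshell spatial_four.
rewrite divff ?gt_eqF ?eps_gt0// sqrtr1 mul1r; congr (cis _ * _).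
by rewrite /mink !fourE /= !mul0r !subr0.
Qed.

Lemma normsq_cis_sub1 (x : R) : normsq (cis x - 1) <= 2 * x ^+ 2.
Proof.
have [h1 h2] := sin_cos_lipschitz x 0; rewrite cos0 sin0 !subr0 in h1 h2.
rewrite /normsq /cis /= subr0.
have K (u v : R) : `|u| <= `|v| -> u ^+ 2 <= v ^+ 2.
  by move=> uv; rewrite -[u ^+ 2]real_normK ?num_real// -[v ^+ 2]real_normK ?num_real// ler_sqr ?nnegrE.
have := K _ _ h1; have := K _ _ h2; lra.
Qed.

Lemma sqnorm_translation f : nice f -> exists2 K : R, 0 < K & forall c,
  sqnorm (fun p => W (four c 0) 1%:M f p - f p) <= K * c ^+ 2.
Proof.
move=> nf; have [mf [M M0 fM]] := nf.
have iB := integrable_indic_lty (@measurable_box R M) (mu3_box M).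
(* The phase c eps(p) changes [f] by at most 2 (c eps(p))^2 times its squared modulus; on the
   support eps <= 1 + 3 M, and the squared modulus is at most M. *)
pose k := 2 * (1 + 3 * M) ^+ 2 * M.
have k0 : 0 <= k by rewrite mulr_ge0 ?(ltW M0)// mulr_ge0 ?sqr_ge0.
exists (1 + k * \int[mu3]_p \1_(box M) p) => [|c].
  by rewrite ltr_pwDl// mulr_ge0//; apply: Rintegral_ge0 => p _; rewrite indicE.
apply: le_trans (_ : \int[mu3]_p (k * c ^+ 2 * \1_(box M) p) <= _); last first.
  by rewrite RintegralZl// mulrDl mul1r [k * _ * _]mulrAC lerDr sqr_ge0.
have Lg : L2 (fun p => W (four c 0) 1%:M f p - f p).
  by apply: LC2B; [exact: (LC2_W _ (@generator1 R) (nice_LC2 nf))|exact: nice_LC2].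
apply: le_Rintegral => //; first by have [] := (LC2P _).1 Lg.
  exact: integrable_scale.
move=> p _; rewrite WE_translation -[X in _ - X]mul1r -mulrBl normsqM.
have [fp zp] := fM p; have n0 := normsq_ge0 (f p).
rewrite indicE; case: (pselect (box M p)) => bp; last first.
  by rewrite memNset// mulr0 zp// /normsq /= expr0n /= addr0 mulr0.
rewrite mem_set// mulr1; have e0 := eps_gt0 p.
have eM : eps p <= 1 + 3 * M by apply: box_eps => //; exact: ltW.
apply: le_trans (_ : 2 * (c * eps p) ^+ 2 * M <= _).
  by rewrite ler_pM ?normsq_ge0 ?normsq_cis_sub1.
have h : eps p ^+ 2 <= (1 + 3 * M) ^+ 2 by rewrite ler_sqr ?nnegrE//; lra.
have := ler_wpM2l (mulr_ge0 (sqr_ge0 c) (ltW M0)) h.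
by rewrite /k exprMn; lra.
Qed.

Lemma quad_translation (B : L2op R) f : nice f -> forall e : R, 0 < e ->
  exists2 d : R, 0 < d & forall c, `|c| <= d ->
    `|quad B (W (four c 0) 1%:M f) - quad B f| <= e.
Proof.
move=> nf e e0; have [d d0 Hd] := quad_continuous B (nice_LC2 nf) e0.
have [K K0 HK] := sqnorm_translation nf.
exists (Num.sqrt (d / K)); first by rewrite sqrtr_gt0 divr_gt0.
move=> c cd; apply: Hd; first exact: (LC2_W _ (@generator1 R) (nice_LC2 nf)).
apply: le_trans (HK c) _; rewrite mulrC -ler_pdivlMr//.
rewrite -[c ^+ 2]real_normK ?num_real// -[leRHS]sqr_sqrtr; last by rewrite divr_ge0// ltW.
by rewrite ler_sqr ?nnegrE ?sqrtr_ge0.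
Qed.

Lemma quad_graph_translation a b c S f : `|b| < 1 -> lebesgue_measurable3 S -> L2 f ->
  quad (Tx (graph (a - c) b S)) f = quad (Tx (graph a b S)) (W (four c 0) 1%:M f).
Proof.
move=> b1 mS Lf; have [_ Tx2] := ext; have gen := @generator1 R.
have := quad_op_eq gen (Tx2 (four (- c) 0) _ _ (gen_det gen) (region_graph a b1 mS)) Lf.
rewrite (WinvE _ gen) mul1mx.
have -> : - four (- c) 0 = four c 0 :> R4 by apply: col4P; rewrite !mxE /= opprK !oppr0.
move=> <-; congr quad; congr (L2op_fun (Tx _)).
apply/seteqP; split => [_ [x Sx <-]|_ [_ [x Sx <-] <-]].
  exists (four (a + b * x.2) x); first by exists x.
  by rewrite (poincareE _ gen) mul1mx; apply: col4P; rewrite !mxE /= !add0r; split => //; ring.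
exists x => //; rewrite (poincareE _ gen) mul1mx; apply: col4P; rewrite !mxE /= !add0r; split => //; ring.
Qed.

(** Only points with eta height > 0 contribute. These are the open halves of the region of influence
    at time zero, from [S] above it (eta = 1) and below it (eta = -1). *)
Definition influence eta a b (S : set R3) : set R3 :=
  [set x | exists2 z, S z & norm3 (z - x) < eta * height a b z].

Lemma precedes_four eta (h0 h1 : R) (x z : R3) :
  precedes eta (four h0 x) (four h1 z) = (norm3 (z - x) < eta * (h1 - h0)).
Proof. by rewrite /precedes !spatial_four !four0. Qed.

(** [S] may fail to be Borel, yet its open influence is a countable union of cones with rational
    apexes between [S] and time zero, which makes it measurable and ready for [graph_flux_le]. *)
Lemma influence_le eta a b (S A : set R3) : eta ^+ 2 = 1 -> `|b| < 1 -> measurable A -> A `<=` S ->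
  measurable (influence eta a b S) /\
  forall f, nice f ->
    quad (Tx (graph a b (A `&` [set z | 0 < eta * height a b z]))) f <= quad (T (influence eta a b S)) f.
Proof.
move=> eta2 b1 mA AS; set h := height a b.
have mpos (c : R) : measurable [set z | c < eta * h z].
  have mh : measurable_fun setT (fun z => eta * h z).
    by apply: measurable_funM; [exact: measurable_cst|exact: measurable_height].
  have := @measurable_fun_ltr _ _ _ setT (cst c) _ (measurable_cst _) mh.
  by move=> /(_ measurableT [set true] I); rewrite setTI; congr measurable; apply/seteqP; split.
have [[z0 Sz0 h0]|noS] := pselect (exists2 z, S z & 0 < eta * h z); last first.
  have -> : influence eta a b S = set0.
    apply/seteqP; split => // x [z Sz]; rewrite -/h => hz; apply: noS; exists z => //.
    exact: le_lt_trans (norm3_ge0 _) hz.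
  split => // f nf.
  have -> : A `&` [set z | 0 < eta * h z] = set0.
    by apply/seteqP; split => // z [/AS Sz hz]; apply: noS; exists z.
  have [nu [F [_ nuE]]] := graph_measure a b1 (nice_LC2 nf).
  have := nuE set0 set0 measurable0 (negligible_set0 _).
  rewrite preimage_set0 measure0 setU0 => -[<-]; exact: (quad_ge0 povm (nice_LC2 nf)).
pose Q := [set r : R4 | exists2 z, S z & precedes eta r (four (h z) z)].
have n0 : norm3 (0 : R3) = 0 by rewrite /norm3 /dot3 /= !mul0r !addr0 sqrtr0.
have : precedes eta (four 0 z0) (four (h z0) z0) by rewrite precedes_four subrr n0 subr0.
case/(rational_between eta2) => q0 [_ q0z]; have Qq0 : Q (rational_point q0) by exists z0.
have [r [rQ Qr]] := rational_sequence Qq0.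
have between x z : S z -> precedes eta x (four (h z) z) -> exists k, 0 < cone_weight eta (r k) x.
  move=> Sz /(rational_between eta2)[q [xq qz]].
  have [k rk] : exists k, r k = rational_point q by apply: Qr; exists z.
  by exists k; rewrite rk; exact/cone_weight_precedes.
have OE : influence eta a b S = cones_at0 eta r.
  apply/seteqP; split => [x [z Sz xz]|x [k /cone_weight_precedes xr]].
    by apply: (between _ z) => //; rewrite precedes_four subr0.
  have [z Sz rz] := rQ k; exists z => //.
  by have := precedes_trans xr rz; rewrite precedes_four subr0.
have mO : measurable (influence eta a b S) by rewrite OE; exact: measurable_cones_at0.
split => // f nf.
(* Here the height is bounded away from 0, so a time shift by at most 1 / (n + 1) toward time zero
   stays on the same side and enters the open cones; the box gives finite measure. *)
pose An n := A `&` [set z | n.+1%:R^-1 < eta * h z] `&` box n%:R.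
have mAn n : measurable (An n) by apply: measurableI; [exact: measurableI|exact: measurable_box].
have An_le n : quad (Tx (graph a b (An n))) f <= quad (T (influence eta a b S)) f.
  apply/ler_addgt0Pr => e e0.
  have [d d0 Hd] := quad_translation (Tx (graph a b (An n))) nf e0.
  pose c := Num.min d n.+1%:R^-1.
  have c0 : 0 < c by rewrite lt_min d0 invr_gt0 ltr0n.
  have cd : c <= d by rewrite ge_min lexx.
  have cn : c <= n.+1%:R^-1 by rewrite ge_min lexx orbT.
  have eta1 : `|eta| = 1 by apply/eqP; rewrite -sqrp_eq1// real_normK ?num_real// eta2.
  have := Hd (eta * c); rewrite normrM eta1 mul1r gtr0_norm// => /(_ cd).
  have lAn : lebesgue_measurable3 (An n).
    by exists (An n) => //; exists set0; [exact: negligible_set0|rewrite setU0].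
  rewrite -(quad_graph_translation a (eta * c) b1 lAn (nice_LC2 nf)).
  have hc z : height (a - eta * c) b z = h z - eta * c by rewrite /h /height; ring.
  have : quad (Tx (graph (a - eta * c) b (An n))) f <= quad (T (influence eta a b S)) f.
    rewrite OE; apply: (graph_flux_le povm kT ck ext nf eta2 b1 (N0 := n%:R)) => //.
    - by move=> z [].
    - move=> z [[_ hz] _]; rewrite hc mulrBr mulrA -expr2 eta2 mul1r subr_gt0.
      exact: le_lt_trans cn hz.
    - move=> z [[/AS Sz hz] _]; apply: (between _ z) => //.
      rewrite /slab mul1r hc precedes_four subrr n0.
      have -> : eta * (h z - (h z - eta * c)) = eta ^+ 2 * c by ring.
      by rewrite eta2 mul1r.
  by rewrite ler_norml => h1 /andP[h2 _]; move: h2; rewrite lerNl opprB lerBlDl => h2; exact: le_trans h2 (lerD h1 (lexx _)).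
have [nu [F [mF nuE]]] := graph_measure a b1 (nice_LC2 nf).
have nuE' B : measurable B -> nu (F @^-1` B) = (quad (Tx (graph a b B)) f)%:E.
  by move=> mB; have := nuE B set0 mB (negligible_set0 _); rewrite setU0.
have mFB B : measurable B -> measurable (F @^-1` B).
  by move=> mB; rewrite -[_ @^-1` _]setTI; exact: mF.
have AE : F @^-1` (A `&` [set z | 0 < eta * h z]) = \bigcup_n (F @^-1` (An n)).
  rewrite -preimage_bigcup; congr (_ @^-1` _); apply/seteqP; split => [z [Az hz]|z [n _ [[Az hz] _]]].
    pose c : R := `|(eta * h z)^-1| + `|z.1.1| + `|z.1.2| + `|z.2|.
    have c0 : 0 <= c by rewrite !addr_ge0.
    have [n cn] : exists n, c < n%:R by exists (Num.bound c); exact: archi_boundP.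
    have p0 := normr_ge0 (eta * h z)^-1; have p1 := normr_ge0 z.1.1; have p2 := normr_ge0 z.1.2; have p3 := normr_ge0 z.2.
    exists n => //; split; last by split; rewrite /c in cn; lra.
    split => //=; rewrite invf_plt ?posrE ?ltr0n//.
    apply: le_lt_trans (ler_norm _) _; apply: lt_trans (_ : n%:R < _); last by rewrite ltr_nat.
    by rewrite /c in cn; lra.
  by split => //; apply: lt_trans hz; rewrite invr_gt0 ltr0n.
have mA0 : measurable (A `&` [set z | 0 < eta * h z]) by exact: measurableI.
rewrite -lee_fin -nuE'// AE.
have C : nu (F @^-1` An n) @[n --> \oo] --> nu (\bigcup_n (F @^-1` An n)).
  apply: (@nondecreasing_cvg_mu _ _ _ nu (fun n => F @^-1` An n)) => [n||m n mn].
  - exact: mFB.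
  - by rewrite -AE; exact: mFB.
  - apply/subsetPset => x [[Ax hx] bx]; split; last by apply: box_le bx; rewrite ler_nat.
    by split => //=; apply: le_lt_trans hx; rewrite lef_pV2 ?posrE ?ltr0n// ler_nat.
rewrite -(cvg_lim _ C)//; apply: lime_le; first exact: cvgP C.
by near=> n; rewrite nuE'// lee_fin.
Unshelve. all: by end_near.
Qed.

End graph_influence.

(** * The boundary of the influence is a null set *)

Section null_boundary.
Context {R : realType}.
Local Notation R3 := (R3 R).
Local Notation mu3 := (mu3 R).

Lemma mu3_translation (G : set R3) (v : R3) : measurable G ->
  measurable ((fun x => x + v) @^-1` G) /\ mu3 ((fun x => x + v) @^-1` G) = mu3 G.
Proof.
move=> mG; have pT := preserves_translation v; have [mT _ _ P] := pT.
have mTG : measurable ((fun x => x + v) @^-1` G) by rewrite -[_ @^-1` _]setTI; exact: mT.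
split => //.
have mi : measurable_fun setT (fun x : R3 => (\1_G x)%:E : \bar R).
  by apply/measurable_EFinP; exact: measurable_indic.
have i0 x : (0 <= (\1_G x)%:E :> \bar R)%E by rewrite lee_fin indicE.
have := P _ mi i0; under eq_integral do rewrite mule1.
rewrite (integral_indic mu3 measurableT mG) setIT => <-.
rewrite -[X in mu3 X]setIT -(integral_indic mu3 measurableT mTG).
by [].
Qed.

(* The sets [G + tau_i e] are pairwise disjoint and all lie in a fixed box. *)
Lemma null_translates (O : set R3) (e : R3) (n : nat) (N : R) : measurable O -> box 1 e ->
  let tau i : R := (n.+1 + i)%:R^-1 in
  mu3.-negligible [set x | [/\ box N x, ~ O x &
    forall i j, (i < j)%N -> O (x + (tau i - tau j) *: e)]].
Proof.
move=> mO e1 tau; set G := [set x | _].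
have taulez i j : (i <= j)%N -> tau j <= tau i.
  by move=> ij; rewrite lef_pV2 ?posrE ?ltr0n// ler_nat leq_add2l.
have tau0 i : 0 <= tau i by rewrite invr_ge0 ler0n.
have tau1 i : tau i <= 1 by rewrite invf_le1 ?ltr0n// ler1n.
have mG : measurable G.
  rewrite (_ : G = box N `&` ~` O `&` \bigcap_i \bigcap_j [set x | (i < j)%N -> O (x + (tau i - tau j) *: e)]).
    apply: measurableI.
      by apply: measurableI; [exact: measurable_box|exact: measurableC].
    apply: bigcapT_measurable => i; apply: bigcapT_measurable => j.
    case: (ltnP i j) => ij; last first.
      by rewrite (_ : [set _ | _] = setT); [exact: measurableT|apply/seteqP; split].
    have [m _] := mu3_translation ((tau i - tau j) *: e) mO.
    by move: m; congr measurable; apply/seteqP; split => x H //; exact: (H isT).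
  apply/seteqP; split => [x [bx nx H]|x [[bx nx] H]].
    by split; [split|move=> i _ j _ /=; exact: H].
  by split => // i j; exact: (H i I j I).
pose F i := (fun x => x + (- tau i *: e)) @^-1` G.
have mF i : measurable (F i) by have [] := mu3_translation (- tau i *: e) mG.
have muF i : mu3 (F i) = mu3 G by have [] := mu3_translation (- tau i *: e) mG.
(* If x - tau_i e is in [G], its last condition puts x - tau_j e into [O], hence outside [G]. *)
have dF i j : (i < j)%N -> F i `&` F j = set0.
  move=> ij; apply/seteqP; split => // x [[_ _ Hi] [_ nj _]]; apply: nj.
  have := Hi i j ij; congr O.
  by rewrite -addrA -scalerDl; congr (_ + _ *: _); ring.
have FN i : F i `<=` box (N + 1).
  move=> x [[b1 b2 b3] _ _]; have [e1' e2' e3'] := e1.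
  have K (u v : R) : `|u + - tau i * v| <= N -> `|v| <= 1 -> `|u| <= N + 1.
    move=> h1 h2; have -> : u = (u + - tau i * v) + tau i * v by ring.
    apply: le_trans (ler_normD _ _) _; rewrite lerD// normrM ger0_norm//.
    by rewrite -[leRHS]mulr1 ler_pM.
  by split; [apply: K b1 _|apply: K b2 _|apply: K b3 _].
pose U m := \big[setU/set0]_(i < m) F i.
have mU m : measurable (U m) by apply: bigsetU_measurable.
have UN m : U m `<=` box (N + 1).
  by rewrite /U -bigcup_mkord => x [i _ Fx]; exact: FN Fx.
have muU m : mu3 (U m) = (m%:R%:E * mu3 G)%E.
  elim: m => [|m IH]; first by rewrite /U big_ord0 measure0 mul0e.
  have dUm : U m `&` F m = set0.
    apply/seteqP; split => // x [+ Fmx]; rewrite /U -bigcup_mkord => -[i im Fx].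
    by rewrite -(dF i m im).
  rewrite {1}/U big_ord_recr /= -/(U m).
  transitivity (mu3 (U m) + mu3 (F m))%E; first exact: (measureU mu3 (mU m) (mF m) dUm).
  rewrite IH muF -natr1 EFinD ge0_muleDl ?lee_fin ?ler0n//; congr (_ + _)%E.
  by rewrite mul1e.
have bN := @mu3_box R (N + 1).
have GN : (mu3 G < +oo)%E.
  rewrite -(muF 0%N); apply: le_lt_trans bN.
  exact: (le_measure mu3 (mem_set (mF 0%N)) (mem_set (@measurable_box R (N + 1))) (FN 0%N)).
have Ule m : (m%:R%:E * mu3 G <= mu3 (box (N + 1)))%E.
  rewrite -muU.
  exact: (le_measure mu3 (mem_set (mU m)) (mem_set (@measurable_box R (N + 1))) (UN m)).
have Gfin : mu3 G \is a fin_num by rewrite ge0_fin_numE.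
have Bfin : mu3 (box (N + 1)) \is a fin_num by rewrite ge0_fin_numE.
exists G; split => //; apply/eqP; rewrite eq_le measure_ge0 andbT leNgt; apply/negP => G0.
have g0 : 0 < fine (mu3 G) by rewrite fine_gt0// G0 GN.
have := Ule (Num.bound (fine (mu3 (box (N + 1))) / fine (mu3 G))).
rewrite -(fineK Gfin) -(fineK Bfin) -EFinM lee_fin /= leNgt => /negP; apply.
rewrite -ltr_pdivrMr//; apply: archi_boundP.
by apply: divr_ge0; apply: fine_ge0; exact: measure_ge0.
Qed.

Lemma null_height a b : (a != 0) || (b != 0) -> mu3.-negligible [set x : R3 | height a b x = 0].
Proof.
move=> ab; have [b0|b0] := eqVneq b 0.
  rewrite (_ : [set _ | _] = set0); first exact: negligible_set0.
  apply/seteqP; split => // x /=; rewrite /height b0 mul0r addr0 => a0.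
  by move: ab; rewrite a0 b0 eqxx.
pose c : measurableTypeR R := - a / b.
apply: (@negligibleS _ _ _ _ (setT `*` [set c])).
  move=> [u y] /= H; split => //=; rewrite /c; apply: (mulfI b0).
  rewrite [RHS]mulrC divfK//; move: H; rewrite /height /= => /eqP.
  by rewrite addrC addr_eq0 => /eqP.
have m1 : measurable [set c] by exact: measurable_set1.
exists (setT `*` [set c]); split => //; first exact: measurableX.
have e1 : mu3 (setT `*` [set c]) = (@sigma_finite_mu2 R setT * @lebesgue_measure R [set c])%E.
  exact: (product_measure1E (@sigma_finite_mu2 R) (@lebesgue_measure R) measurableT m1).
by rewrite lebesgue_measure_set1 mule0 in e1.
Qed.

(** The six signed unit vectors, and 0 for all later indices, so that [box_axis] holds throughout a
    countable union over k. *)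
Definition axis (k : nat) : R3 :=
  nth 0 [:: (1, 0, 0); (-1, 0, 0); (0, 1, 0); (0, -1, 0); (0, 0, 1); (0, 0, -1)] k.

Lemma box_axis k : box 1 (axis k).
Proof.
by rewrite /axis; do 6 (case: k => [|k] /=; first by split; rewrite /= ?normr0 ?normrN ?normr1 ?ler01);
  rewrite nth_nil; split; rewrite /= normr0.
Qed.

Lemma axis_pos (v : R3) : v != 0 -> exists k, 0 < dot3 (axis k) v /\ dot3 (axis k) (axis k) = 1.
Proof.
move=> v0.
have [v1|v1|v1] := ltgtP v.1.1 0.
- by exists 1%N; rewrite /dot3 /=; split; [lra|ring].
- by exists 0%N; rewrite /dot3 /=; split; [lra|ring].
have [v2|v2|v2] := ltgtP v.1.2 0.
- by exists 3%N; rewrite /dot3 /=; split; [lra|ring].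
- by exists 2%N; rewrite /dot3 /=; split; [lra|ring].
have [v3|v3|v3] := ltgtP v.2 0.
- by exists 5%N; rewrite /dot3 /=; split; [lra|ring].
- by exists 4%N; rewrite /dot3 /=; split; [lra|ring].
by exfalso; move/eqP: v0; apply; case: v v1 v2 v3 => [[? ?] ?] /= -> -> ->.
Qed.

(** [S] is arbitrary. A boundary point x realises the exact distance to some z; a small step tau
    along an axis e with e . v > 0, v = z - x, lowers the squared distance by tau (2 e . v - tau)
    and enters [O]. So x lies in one of countably many sets of the kind treated by
    [null_translates], or on the edge where the height is 0. *)
Lemma null_boundary a b (S O : set R3) : (a != 0) || (b != 0) -> measurable O ->
  influence 1 a b S `|` influence (-1) a b S `<=` O ->
  mu3.-negligible ([set x | exists2 z, S z & norm3 (z - x) <= `|height a b z|] `\` O).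
Proof.
move=> ab mO SO.
pose G k n := [set x | [/\ box n%:R x, ~ O x &
  forall i j, (i < j)%N -> O (x + ((n.+1 + i)%:R^-1 - (n.+1 + j)%:R^-1) *: axis k)]].
apply: (negligibleS _ (negligibleU (null_height ab)
  (negligible_bigcup (fun k => negligible_bigcup (fun n => null_translates n n%:R mO (box_axis k)))))).
move=> x [[z Sz xz] nOx].
have inO y : norm3 (z - y) < `|height a b z| -> O y.
  move=> yz; apply: SO; have [h0|h0] := leP 0 (height a b z).
    by left; exists z => //; rewrite mul1r -[height a b z]ger0_norm.
  by right; exists z => //; rewrite mulN1r -ltr0_norm.
have rho : norm3 (z - x) = `|height a b z|.
  by apply/eqP; rewrite eq_le xz leNgt; apply/negP => /inO.
have [h0|h0] := eqVneq (height a b z) 0.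
  left; move: rho; rewrite h0 normr0 => /eqP; rewrite sqrtr_eq0 => d0.
  have /eqP : z - x = 0 by apply: dot3_eq0; apply/eqP; rewrite eq_le d0 dot3_ge0.
  by rewrite subr_eq0 => /eqP <-.
right; set v := z - x in rho.
have v0 : v != 0.
  apply: contra_neq h0 => v0; apply/eqP; rewrite -normr_eq0 -rho v0.
  by rewrite /norm3 /dot3 /= !mul0r !addr0 sqrtr0.
have [k [kv kk]] := axis_pos v0.
(* A bound n above c puts x into [box n] and makes every step, being less than 1 / (n + 1), shorter
   than 2 e . v. *)
pose c : R := `|(2 * dot3 (axis k) v)^-1| + `|x.1.1| + `|x.1.2| + `|x.2|.
have c0 : 0 <= c by rewrite !addr_ge0.
have p0 := normr_ge0 (2 * dot3 (axis k) v)^-1.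
have p1 := normr_ge0 x.1.1; have p2 := normr_ge0 x.1.2; have p3 := normr_ge0 x.2.
have [n cn] : exists n, c < n%:R by exists (Num.bound c); exact: archi_boundP.
exists k => //; exists n => //; split => //; first by move: cn p0 p1 p2 p3; rewrite /c; clear => *; split; lra.
move=> i j ij; apply: inO; rewrite -rho.
set tau : R := _^-1 - _^-1.
have tau0 : 0 < tau by rewrite subr_gt0 ltf_pV2 ?posrE ?ltr0n// ltr_nat ltn_add2l.
have tau1 : tau < 2 * dot3 (axis k) v.
  apply: lt_le_trans (_ : n.+1%:R^-1 <= _).
    apply: lt_le_trans (_ : (n.+1 + i)%:R^-1 <= _).
      by rewrite ltrBlDr ltrDl invr_gt0 ltr0n.
    by rewrite lef_pV2 ?posrE ?ltr0n// ler_nat leq_addr.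
  rewrite -[leRHS]invrK lef_pV2 ?posrE ?ltr0n ?invr_gt0 ?mulr_gt0//.
  apply: le_trans (ler_norm _) _; apply: le_trans (_ : n%:R <= _); last by rewrite ler_nat.
  by move: cn p1 p2 p3; rewrite /c; clear; lra.
rewrite norm3_lt ?norm3_ge0// sqr_norm3.
have -> : z - (x + tau *: axis k) = v - tau *: axis k by rewrite opprD addrA.
have -> : dot3 (v - tau *: axis k) (v - tau *: axis k) =
  dot3 v v - tau * (2 * dot3 (axis k) v - tau * dot3 (axis k) (axis k)).
  by rewrite /dot3 /= /GRing.scale /=; ring.
by rewrite kk mulr1 ltrBlDr ltrDl mulr_gt0// subr_gt0.
Qed.

End null_boundary.

(** * Reduction of hyperplanes and regions to time zero *)

Section reductions.
Context {R : realType}.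
Local Notation C := R[i].
Local Notation R3 := (R3 R).
Local Notation R4 := 'cV[R]_4.
Local Notation mu3 := (mu3 R).
Local Notation L2 := (@LC R 2%:E).

Lemma poincare_hyperplane A A' L L' (a n : R4) tau : generator A A' L L' ->
  poincare a A @` [set x | mink n x = tau] = [set y | mink (L *m n) y = tau + mink (L *m n) a].
Proof.
move=> gen; apply/seteqP; split=> [_ [x /= nx <-]|y /= ny].
  by rewrite (poincareE _ gen) minkDr (gen_mink gen) nx addrC.
exists (L' *m (y - a)) => /=.
  by rewrite minkC (gen_minkl gen) minkC minkDr minkNr ny addrK.
by rewrite (poincareE _ gen) mulmxA (gen_mulL gen) mul1mx addrC subrK.
Qed.

(** The normal is timelike and, up to sign, future; [future_reduction] brings it to rest and a time
    translation finishes. *)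
Lemma hyperplane_reduction (P : set R4 -> Prop) :
  (forall A A' L L' a s, generator A A' L L' -> P (poincare a A @` s) -> P s) ->
  P (plane 0 0) -> forall s, spacelike_hyperplane s -> P s.
Proof.
move=> PL P0.
have Pf : forall n : R4, future n -> forall tau, P [set x | mink n x = tau].
  apply: future_reduction => [A A' L L' n gen IH tau|m m0 tau].
    by apply: (PL _ _ _ _ 0 _ gen); rewrite (poincare_hyperplane _ _ _ gen).
  (* Shifts the plane m x_0 = tau to x_0 = 0. *)
  apply: (PL _ _ _ _ (four (- tau / m) 0) _ (@generator1 R)).
  rewrite (poincare_hyperplane _ _ _ (@generator1 R)) mul1mx; move: P0; congr P.
  apply/seteqP; split => x; rewrite /plane /dot3 /mink /= !fourE /= !mul0r !subr0 !addr0 => H.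
    by rewrite H mulr0; field; exact: lt0r_neq0.
  apply: (mulfI (lt0r_neq0 m0)); rewrite H mulr0; field; exact: lt0r_neq0.
move=> s [[n [tau [n0 sE]]] ss].
have nn : 0 < mink n n.
  by apply: (spacelike_normal n0 (tau := tau)) => x y xs ys; apply: ss; rewrite sE.
rewrite sE; have [n00|n00|n00] := ltgtP (n 0 0) 0.
- have -> : [set x | mink n x = tau] = [set x | mink (- n) x = - tau].
    apply/seteqP; split => x /=; rewrite minkNl => H; first by rewrite H.
    by apply: oppr_inj.
  apply: Pf; split; first by rewrite mxE oppr_gt0.
  by rewrite minkNl minkNr opprK.
- exact: Pf.
- by exfalso; move: nn; rewrite /mink n00; clear; nra.
Qed.

Lemma region_plane0 (D : set R4) : region D -> D `<=` plane 0 0 ->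
  exists2 S, lebesgue_measurable3 S & D = [set four 0 x | x in S].
Proof.
move=> [s [_ _ mD]] D0; exists [set spatial x | x in D] => //.
apply/seteqP; split => [x Dx|_ [_ [x Dx <-] <-]].
  exists (spatial x); first by exists x.
  by have := D0 _ Dx; rewrite /plane /dot3 /= !mul0r !addr0 => x0; rewrite -[in LHS]x0 four_spatial.
have := D0 _ Dx; rewrite /plane /dot3 /= !mul0r !addr0 => x0.
by rewrite (_ : four 0 (spatial x) = x)// -[in LHS]x0 four_spatial.
Qed.

Lemma region_reduction (P : set R4 -> Prop) :
  (forall A A' L L' a D, generator A A' L L' -> region D -> P (poincare a A @` D) -> P D) ->
  (forall S, lebesgue_measurable3 S -> P [set four 0 x | x in S]) ->
  forall D, region D -> P D.
Proof.
move=> PL P0 D rD; have [s [ss Ds _]] := rD.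
move: D rD Ds; apply: (hyperplane_reduction (P := fun s => forall D, region D -> D `<=` s -> P D)) ss.
  move=> A A' L L' a s' gen IH D rD Ds; apply: (PL _ _ _ _ a _ gen) => //; apply: IH.
    exact: (region_poincare _ gen).
  exact: image_subset.
by move=> D rD /(region_plane0 rD)[S mS ->]; exact: P0.
Qed.

(** Turns imaginary parts into real inner products, for which unitarity of [W] and invariance under
    a.e. equality are available. *)
Lemma Im_inner (f g : R3 -> C) : complex.Im (inner f g) = rinner (fun p => (0 +i* 1) * f p) g.
Proof.
rewrite rinnerE /inner /cintegral /=; apply: eq_Rintegral => p _.
by case: (f p) (g p) => [? ?] [? ?]; rewrite /rdot /=; ring.
Qed.

Lemma Im_op_eq (B D : L2op R) A A' L L' (a : R4) (f : R3 -> C) : generator A A' L L' ->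
  op_eq (W a A \o D \o Winv a A) B -> L2 f ->
  complex.Im (inner f (B f)) = complex.Im (inner (Winv a A f) (D (Winv a A f))).
Proof.
move=> gen E Lf; have Lf' := LC2_Winv a gen Lf.
have [DL _ _ _] := L2opP D; have [BL _ _ _] := L2opP B.
rewrite !Im_inner.
have Wi : W a A (fun p => (0 +i* 1) * Winv a A f p) = fun p => (0 +i* 1) * f p.
  rewrite -[in RHS](WK a f gen); apply/funext => p.
  by rewrite !(WE _ gen); set u := Winv _ _ _ _; ring.
rewrite -(rinner_W a gen (LC2Z _ Lf') (DL _ Lf')) Wi.
apply: eq_rinner; [exact: LC2Z|exact: BL|exact: LC2Z|exact: (LC2_W _ gen (DL _ Lf'))|exact: aeW|].
by have := E _ Lf; apply: filterS => x H /H <-.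
Qed.

End reductions.

(** * Causality for all regions and spacelike hyperplanes *)

Section causality.
Context {R : realType}.
Local Notation C := R[i].
Local Notation R3 := (R3 R).
Local Notation R4 := 'cV[R]_4.
Local Notation mu3 := (mu3 R).
Local Notation L2 := (@LC R 2%:E).
Variables (T : set R3 -> L2op R) (Tx : set R4 -> L2op R).
Variables (t : R3 -> R3 -> C) (good : set R3) (V : R3 -> R3 -> 'cV[C]_4).
Hypothesis povm : is_POVM T.
Hypothesis kT : is_kernel T t.
Hypothesis ck : current_kernel t good V.
Hypothesis ext : is_covariant_extension T Tx.

Lemma op_eq_poincare A A' L L' a D : generator A A' L L' -> region D ->
  op_eq (W (- (L' *m a)) A' \o Tx (poincare a A @` D) \o Winv (- (L' *m a)) A') (Tx D).
Proof.
move=> gen rD; have [_ Tx2] := ext; have gen' := generatorV gen.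
have := Tx2 (- (L' *m a)) A' _ (gen_det gen') (region_poincare a gen rD).
by rewrite (poincareK a D gen).
Qed.

(** Without real forms [op_le] could not hold. Positivity of [T] makes them real at time zero, and
    covariance carries this to every region. *)
Lemma Im_region D f : region D -> L2 f -> complex.Im (inner f (Tx D f)) = 0.
Proof.
move=> rD Lf; move: D rD f Lf.
apply: region_reduction => [A A' L L' a D gen rD IH f Lf|S [A mA [N nN <-]] f Lf].
  rewrite (Im_op_eq (generatorV gen) (op_eq_poincare a gen rD) Lf).
  exact: (IH _ (LC2_Winv _ (generatorV gen) Lf)).
have [Tx1 _] := ext; have E := Tx1 A N mA nN.
have [posT _ _] := povm; have := posT A mA f Lf; rewrite lecE => /andP[/eqP imT _].
transitivity (complex.Im (inner f (T A f))); last exact: imT.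
have [BL _ _ _] := L2opP (T A); have [BL' _ _ _] := L2opP (Tx [set four 0 x | x in A `|` N]).
rewrite !Im_inner; apply: eq_rinner; [exact: LC2Z|exact: BL'|exact: LC2Z|exact: BL|exact: aeW|].
exact: E.
Qed.

Lemma quad_le_LC2 (A B : L2op R) : (forall f, nice f -> quad A f <= quad B f) ->
  forall f, L2 f -> quad A f <= quad B f.
Proof.
move=> H f Lf; apply/ler_addgt0Pr => e e0.
have e2 : 0 < e / 2 by rewrite divr_gt0.
have [d1 d10 H1] := quad_continuous A Lf e2; have [d2 d20 H2] := quad_continuous B Lf e2.
have d0 : 0 < Num.min d1 d2 by rewrite lt_min d10.
have [g ng gf] := nice_dense Lf d0; have Lg := nice_LC2 ng.
have := H1 g Lg (le_trans gf _); rewrite ge_min lexx => /(_ isT).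
have := H2 g Lg (le_trans gf _); rewrite ge_min lexx orbT => /(_ isT).
rewrite !ler_norml => /andP[_ h1] /andP[h2 _]; have := H g ng; lra.
Qed.

(** The first half is needed because covariance of [Tx], and with it the transport of the
    inequality, is granted only on regions. *)
Definition causal_pair (D s : set R4) : Prop := region (region_of_influence D s) /\
  forall f, nice f -> quad (Tx D) f <= quad (Tx (region_of_influence D s)) f.

Lemma causal_pair_poincare A A' L L' a D s : generator A A' L L' -> region D ->
  causal_pair (poincare a A @` D) (poincare a A @` s) -> causal_pair D s.
Proof.
move=> gen rD; rewrite /causal_pair (roi_poincare a D s gen); set I := region_of_influence D s => -[rI H].
have gen' := generatorV gen.
have rI' : region I.
  by rewrite -(poincareK a I gen); exact: (region_poincare _ gen').
split => // f nf; have Lf := nice_LC2 nf.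
rewrite (quad_op_eq gen' (op_eq_poincare a gen rD) Lf) (quad_op_eq gen' (op_eq_poincare a gen rI') Lf).
by apply: H; exact: (nice_Winv _ gen').
Qed.

Lemma roi_graph (a b : R) (S : set R3) : region_of_influence (graph a b S) (plane 0 0) =
  graph 0 0 [set x | exists2 z, S z & norm3 (z - x) <= `|height a b z|].
Proof.
have mE (x z : R3) h : mink (four 0 x - four h z) (four 0 x - four h z) = h ^+ 2 - norm3 (z - x) ^+ 2.
  by rewrite sqr_norm3 /mink /dot3 !mxE /=; ring.
have cE (x z : R3) h : (0 <= h ^+ 2 - norm3 (z - x) ^+ 2) = (norm3 (z - x) <= `|h|).
  by rewrite subr_ge0 -[h ^+ 2]real_normK ?num_real// ler_sqr ?nnegrE ?norm3_ge0.
rewrite graph0; apply/seteqP; split => [x [x0 [_ [z Sz <-] H]]|_ [x [z Sz xz] <-]].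
  have xE : x = four 0 (spatial x).
    move: x0; rewrite /plane /dot3 /= !mul0r !addr0 => x0.
    by rewrite -[LHS]four_spatial x0.
  exists (spatial x) => //; exists z => //.
  by rewrite -cE -mE -xE.
split; first by rewrite /plane /= four0 /dot3 /= !mul0r !addr0.
by exists (four (a + b * z.2) z); [exists z|rewrite mE cE].
Qed.

(** A point of both would lie between z in its future and y in its past, making z and y timelike
    related although both are on one spacelike plane. *)
Lemma influence_disjoint (a b : R) (S : set R3) : `|b| < 1 -> influence 1 a b S `&` influence (-1) a b S = set0.
Proof.
move=> b1; apply/seteqP; split => // x [[z Sz zx] [y Sy yx]].
have H : norm3 (z - y) < b * (z.2 - y.2).
  have -> : z - y = (z - x) - (y - x) by rewrite opprB addrA subrK.
  apply: le_lt_trans (norm3D _ _) _; rewrite norm3N.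
  move: zx yx; rewrite /height mul1r mulN1r; lra.
have [_ _ h3] := norm3_coord (z - y).
have := le_lt_trans h3 H; apply/negP; rewrite -leNgt /=.
apply: le_trans (ler_norm _) _; rewrite normrM -[leRHS]mul1r ler_wpM2r//.
exact: ltW.
Qed.

(** The Borel part of [S] splits by the sign of the height. Each sign is bounded by its own half of
    the influence; the halves are disjoint, so the bounds add up. *)
Lemma causal_pair_graph a b S : `|b| < 1 -> lebesgue_measurable3 S ->
  causal_pair (graph a b S) (plane 0 0).
Proof.
move=> b1 mS; rewrite /causal_pair roi_graph.
have b0 : `|0 : R| < 1 by rewrite normr0.
have [ab|] := boolP ((a != 0) || (b != 0)); last first.
  (* The degenerate wedge: both planes coincide and [S] influences only itself. Null boundaries fail
     here, since [S] is its own boundary set. *)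
  rewrite negb_or !negbK => /andP[/eqP a0 /eqP b00].
  have -> : [set x | exists2 z, S z & norm3 (z - x) <= `|height a b z|] = S.
    apply/seteqP; split => [x [z Sz]|x Sx].
      rewrite /height a0 b00 mul0r addr0 normr0 norm3_le// expr0n => d0.
      have /eqP : z - x = 0 by apply: dot3_eq0; apply/eqP; rewrite eq_le d0 dot3_ge0.
      by rewrite subr_eq0 => /eqP <-.
    by exists x => //; rewrite subrr norm3_le// /dot3 /= !mul0r !addr0 sqr_ge0.
  by rewrite a0 b00; split => //; exact: region_graph.
have [A mA [N nN SE]] := mS.
have AS : A `<=` S by rewrite -SE; exact: subsetUl.
have e1 : (1 : R) ^+ 2 = 1 by rewrite expr1n.
have e2 : (-1 : R) ^+ 2 = 1 by rewrite sqrrN expr1n.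
have [mI1 H1] := influence_le povm kT ck ext a e1 b1 mA AS.
have [mI2 H2] := influence_le povm kT ck ext a e2 b1 mA AS.
set I1 := influence 1 a b S in mI1 H1; set I2 := influence (-1) a b S in mI2 H2.
pose O := I1 `|` I2; have mO : measurable O by exact: measurableU.
set E := [set x | _].
have nE : mu3.-negligible (E `\` O) := null_boundary ab mO (@subset_refl _ _).
have EE : E = O `|` (E `\` O).
  rewrite setDE setUIr setUv setIT; apply/esym/setUidr => x [|] [z Sz hz]; exists z => //.
    by apply: le_trans (ltW hz) _; rewrite mul1r ler_norm.
  by apply: le_trans (ltW hz) _; rewrite mulN1r -normrN ler_norm.
split.
  by apply: region_graph => //; rewrite EE; exists O => //; exists (E `\` O).
move=> f nf; have Lf := nice_LC2 nf.
have [nu [F [mF nuE]]] := graph_measure povm ext a b1 Lf.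
have [nu0 nu0E] := POVM_measure povm Lf.
have -> : quad (Tx (graph 0 0 E)) f = quad (T O) f.
  by rewrite graph0 EE; have [Tx1 _] := ext; apply: op_eq_quad (Tx1 _ _ mO nE) Lf.
rewrite -lee_fin -SE -nuE// -nu0E//.
have mh : measurable_fun setT (height a b) := measurable_height a b.
have mpos (eta : R) : measurable [set z | 0 < eta * height a b z].
  have mh' : measurable_fun setT (fun z => eta * height a b z).
    by apply: measurable_funM; [exact: measurable_cst|].
  have := @measurable_fun_ltr _ _ _ setT (cst 0) _ (measurable_cst _) mh'.
  by move=> /(_ measurableT [set true] I); rewrite setTI; congr measurable; apply/seteqP; split.
pose P1 := A `&` [set z | 0 < 1 * height a b z]; pose P2 := A `&` [set z | 0 < -1 * height a b z].
pose P0 := A `\` (P1 `|` P2).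
have mP1 : measurable P1 by exact: measurableI.
have mP2 : measurable P2 by exact: measurableI.
have mP0 : measurable P0 by apply: measurableD => //; exact: measurableU.
have nP0 : mu3.-negligible P0.
  apply: negligibleS (null_height ab) => z [Az nz] /=.
  apply/eqP; rewrite eq_le !leNgt; apply/andP; split; apply/negP => hz; apply: nz.
    by left; split => //=; rewrite mul1r.
  by right; split => //=; rewrite mulN1r oppr_gt0.
have mFB B : measurable B -> measurable (F @^-1` B).
  by move=> mB; rewrite -[_ @^-1` _]setTI; exact: mF.
(* The set on the edge is read once as Borel part and once as null part of the same region; the
   second reading gives the value 0. *)
have nuP0 : nu (F @^-1` P0) = 0%E.
  have := nuE P0 set0 mP0 (negligible_set0 _); have := nuE set0 P0 measurable0 nP0.
  by rewrite setU0 set0U preimage_set0 measure0 => <- ->.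
have nuP B : measurable B -> nu (F @^-1` B) = (quad (Tx (graph a b B)) f)%:E.
  by move=> mB; have := nuE B set0 mB (negligible_set0 _); rewrite setU0.
apply: le_trans (_ : nu (F @^-1` P1) + nu (F @^-1` P2) <= _)%E.
  have AE : F @^-1` A `<=` (F @^-1` P1 `|` F @^-1` P2) `|` F @^-1` P0.
    by move=> x Ax; case: (pselect ((P1 `|` P2) (F x))) => h; [left|right].
  have m12 : measurable (F @^-1` P1 `|` F @^-1` P2) by apply: measurableU; exact: mFB.
  have mAll : measurable ((F @^-1` P1 `|` F @^-1` P2) `|` F @^-1` P0).
    by apply: measurableU => //; exact: mFB.
  apply: le_trans (le_measure nu (mem_set (mFB _ mA)) (mem_set mAll) AE) _.
  apply: le_trans (measureU2 nu m12 (mFB _ mP0)) _.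
  have nuP0' : (nu (F @^-1` P0) <= 0)%E by rewrite nuP0.
  apply: le_trans (leeD (measureU2 nu (mFB _ mP1) (mFB _ mP2)) nuP0') _.
  by rewrite adde0.
have -> : nu0 O = (nu0 I1 + nu0 I2)%E.
  by apply: (measureU nu0 mI1 mI2); exact: influence_disjoint.
by apply: leeD; rewrite nuP// nu0E// lee_fin; [exact: H1|exact: H2].
Qed.

Lemma causal_pair_plane0 D : region D -> causal_pair D (plane 0 0).
Proof.
move=> rD; have [s [ss Ds _]] := rD; have [a [e [e1 sE]]] := spacelike_planeP ss.
(* The slope is encoded as the purely spatial vector n = (0, e), with mink n x = - e . x, so that
   [rotation_reduction] can turn it onto the third axis; rotations fix the time zero plane. *)
suff H : forall n : R4, n 0 0 = 0 -> -1 < mink n n -> forall D, region D ->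
    D `<=` [set x : R4 | x 0 0 = a - mink n x] -> causal_pair D (plane 0 0).
  apply: (H (four 0 e)) => //; first by rewrite four0.
    by move: e1; rewrite /mink /dot3 !fourE /=; lra.
  by move=> x /Ds; rewrite sE /plane /= /mink /dot3 !fourE /= => ->; ring.
apply: rotation_reduction => [A A' L L' n gen Lfix IH n0 n1 D' rD' D's|t0 z n0 n1 D' rD' D's].
  have time (y : R4) : (L *m y) 0 0 = y 0 0.
    have tE (v : R4) : v 0 0 = mink (four 1 0) v by rewrite /mink !fourE /=; ring.
    by rewrite (tE (L *m y)) (tE y) -[RHS](gen_mink gen) Lfix.
  have time' (y : R4) : (L' *m y) 0 0 = y 0 0 by rewrite -(time (L' *m y)) mulmxA (gen_mulL gen) mul1mx.
  apply: (causal_pair_poincare (a := 0) gen) => //.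
  have -> : poincare 0 A @` plane 0 0 = plane 0 0.
    apply/seteqP; split => [_ [x x0 <-]|x x0].
      move: x0; rewrite (poincareE _ gen) add0r /plane /dot3 /= !mul0r !addr0.
      by rewrite time.
    exists (L' *m x); last by rewrite (poincareE _ gen) add0r mulmxA (gen_mulL gen) mul1mx.
    by move: x0; rewrite /plane /dot3 /= !mul0r !addr0 time'.
  apply: IH; [by rewrite time|by rewrite (gen_mink gen)|exact: (region_poincare _ gen)|].
  move=> _ [x Dx <-] /=; rewrite (poincareE _ gen) add0r time (gen_mink gen).
  exact: D's.
move: n0 n1; rewrite fourE /mink !fourE /= => t00 z1.
have z1' : `|z| < 1 by rewrite -ltr_sqr ?nnegrE// real_normK ?num_real// expr1n expr2; nra.
have [s' [_ _ mD']] := rD'.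
have -> : D' = graph a z [set spatial x | x in D'].
  have DE x : D' x -> x = four (a + z * x 3 0) (spatial x).
    move=> /D's /=; rewrite /mink !fourE /= t00 => x0.
    by rewrite -[LHS]four_spatial x0; congr four; ring.
  apply/seteqP; split => [x Dx|_ [_ [x Dx <-] <-]]; last by rewrite -DE.
  by exists (spatial x); [exists x|rewrite -DE].
exact: causal_pair_graph.
Qed.

Lemma causal_pair_spacelike D s : region D -> spacelike_hyperplane s -> causal_pair D s.
Proof.
move=> rD ss; move: D rD.
apply: (hyperplane_reduction (P := fun s => forall D, region D -> causal_pair D s)) ss.
  move=> A A' L L' a s' gen IH D rD; apply: (causal_pair_poincare gen rD); apply: IH.
  exact: (region_poincare _ gen).
exact: causal_pair_plane0.
Qed.

Lemma causal_extension : causal Tx.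
Proof.
move=> D s rD ss f Lf; have [rI H] := causal_pair_spacelike rD ss.
rewrite lecE (Im_region rD Lf) (Im_region rI Lf) eqxx /=.
exact: (quad_le_LC2 H Lf).
Qed.

End causality.

Theorem mainTheorem8 (R : realType)
    (T : set (R3 R) -> L2op R) (Tx : set 'cV[R]_4 -> L2op R)
    (t : R3 R -> R3 R -> R[i]) :
  is_POL T -> is_covariant_extension T Tx ->
  is_kernel T t -> conserved_covariant t ->
  causal Tx.
Proof.
move=> [povm _] ext kT cc; have [mt pd _ t1 _] := kT.
have [good [V [ng mV bV VE cov]]] := exists_current mt pd t1 cc.
have ck : current_kernel t good V.
  by split => // k p gk gp; have [] := VE k p gk gp.
exact: (causal_extension povm kT ck ext).
Qed.
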